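(* Let $G$ be an $m$-dimensional complex Lie group with identity element $e$ and holomorphic Lie algebra $\mathfrak g=T^{1,0}_eG$, and let $\Omega$ be a domain in $G$. Fix a basis $\varepsilon=(\varepsilon_1,\dots,\varepsilon_m)$ of $\mathfrak g$. Let $N$ be a compact Hermitian manifold and let $\mathscr F$ be a family of holomorphic mappings from $\Omega$ to $N$. Then $\mathscr F$ is not normal on $\Omega$ if and only if there exist (a) a sequence $\{f_j\}_{j=1}^{+\infty}\subset\mathscr F$; (b) a sequence $\{p_j\}_{j=1}^{+\infty}\subset\Omega$ with $p_j\to p_0\in\Omega$ as $j\to+\infty$; (c) a sequence $\{\rho_j\}_{j=1}^{+\infty}\subset\mathbb R$ with $0<\rho_j\to 0$ as $j\to+\infty$ such that the sequence $$\phi_j(z):=f_j\circ\exp_{p_j}\big(\rho_j\,(dL_{p_j})_e(\varepsilon z^T)\big),\qquad j=1,2,\dots$$ converges uniformly on compact subsets of $\mathbb C^m$ to a nonconstant holomorphic mapping $\phi:\mathbb C^m\to N$. Here $z^T$ is the transpose of $z=(z_1,\dots,z_m)$, so that $\varepsilon z^T=\sum_{k=1}^m z_k\varepsilon_k\in\mathfrak g$.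
   Context: A complex Lie group $G$ is a complex manifold with a group structure whose multiplication and inversion are holomorphic. $T^{1,0}_gG$ denotes the holomorphic tangent space of $G$ at $g$. For $g\in G$, $L_g:G\to G$, $L_g(h)=gh$, is the left translation, and $(dL_g)_h:T^{1,0}_hG\to T^{1,0}_{gh}G$ is its differential at $h$. Exponential mapping at $g$: each $\xi\in T^{1,0}_gG$ generates a unique left-invariant holomorphic vector field $\tilde\xi$ on $G$, $\tilde\xi_h=(dL_{hg^{-1}})_g(\xi)$, with $\tilde\xi_g=\xi$. Let $\gamma_\xi:\mathbb C\to G$ be the unique holomorphic curve with $\gamma_\xi'=\tilde\xi_{\gamma_\xi}$ and $\gamma_\xi(0)=g$. Then $\exp_g:T^{1,0}_gG\to G$ is defined by $\exp_g(\xi)=\gamma_\xi(1)$; it is holomorphic. Normality: for complex manifolds $M,N$, let $\mathscr C(M,N)$ be the set of continuous mappings $M\to N$ with the compact-open topology. A family $\mathscr F\subset\mathscr C(M,N)$ is normal (on $M$) if each sequence in $\mathscr F$ contains a subsequence which is either relatively compact in $\mathscr C(M,N)$ or compactly divergent. Convergence: $\phi_j$ is defined at those $z\in\mathbb C^m$ for which $\exp_{p_j}(\rho_j(dL_{p_j})_e(\varepsilon z^T))\in\Omega$; uniform convergence on compact subsets of $\mathbb C^m$ means that for every compact $K\subset\mathbb C^m$, $\phi_j$ is defined on $K$ for all sufficiently large $j$ and $\phi_j\to\phi$ uniformly on $K$ (with respect to a distance function on $N$). *)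

(* Defs.v *)
From HB Require Import structures.
From mathcomp Require Import all_boot all_order all_algebra.
From mathcomp Require Import sesquilinear.
From mathcomp Require Import all_classical all_reals all_analysis.
From mathcomp Require Import complex.

Set Implicit Arguments.
Unset Strict Implicit.
Unset Printing Implicit Defensive.

Import Order.TTheory GRing.Theory Num.Theory.
Import numFieldNormedType.Exports.

Local Open Scope classical_set_scope.
Local Open Scope ring_scope.

(* The topology of [R[i]] as a numFieldType, made canonical on [R[i]]. *)
HB.instance Definition _ (R : realType) :=
  PseudoPointedMetric.copy R[i] R[i]^o.

(* A homeomorphism between an open subset of [T] and an open subset of [E];
   the values of [chart_map] off [chart_dom] and of [chart_inv] off [chart_img]
   are junk. *)
Record chart (K : numFieldType) (E : normedModType K) (T : topologicalType) :=
  Chart {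
    chart_dom : set T;
    chart_img : set E;
    chart_map :> T -> E;
    chart_inv : E -> T;
    chart_dom_open : open chart_dom;
    chart_img_open : open chart_img;
    chart_map_img : forall x, chart_dom x -> chart_img (chart_map x);
    chart_inv_dom : forall u, chart_img u -> chart_dom (chart_inv u);
    chart_mapK : forall x, chart_dom x -> chart_inv (chart_map x) = x;
    chart_invK : forall u, chart_img u -> chart_map (chart_inv u) = u;
    chart_map_continuous : forall x, chart_dom x -> {for x, continuous chart_map};
    chart_inv_continuous : forall u, chart_img u -> {for u, continuous chart_inv}
  }.

(* The atlas is given as a family of charts indexed by the points, with
   [chart_at x] a chart around [x].  Any atlas contains such a family, and the
   family determines the holomorphic structure.  [differentiable] is Frechet
   differentiability over [K], i.e. holomorphy when [K] is the field of complex
   numbers. *)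
HB.mixin Record hasHolomorphicAtlas (K : numFieldType) (E : normedModType K) T
    of Topological T := {
  chart_at : T -> chart E T;
  chart_at_dom : forall x, chart_dom (chart_at x) x;
  chart_at_transition : forall (x y : T) (u : E),
    chart_img (chart_at x) u ->
    chart_dom (chart_at y) (chart_inv (chart_at x) u) ->
    differentiable (chart_at y \o chart_inv (chart_at x)) u
}.

#[short(type="chartedType")]
HB.structure Definition Charted (K : numFieldType) (E : normedModType K) :=
  { T of Topological T & hasHolomorphicAtlas K E T }.

Section ModelSpaces.
Context {K : numFieldType} (E : normedModType K).

Let id_continuous (x : E) : [set: E] x -> {for x, continuous (@idfun E)}.
Proof. by move=> _; exact: cvg_id. Qed.

Definition id_chart : chart E E :=
  @Chart K E E setT setT idfun idfun openT openT (fun _ _ => I) (fun _ _ => I)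
    (fun _ _ => erefl) (fun _ _ => erefl) id_continuous id_continuous.

Lemma id_chart_dom (x : E) : chart_dom id_chart x.
Proof. by []. Qed.

Lemma id_chart_transition (x y : E) (u : E) :
  chart_img id_chart u -> chart_dom id_chart (chart_inv id_chart u) ->
  differentiable (id_chart \o chart_inv id_chart) u.
Proof. by move=> _ _; exact: (@ex_diff _ _ _ _ _ _ _ (is_diff_id u)). Qed.

End ModelSpaces.

HB.instance Definition _ (K : numFieldType) :=
  hasHolomorphicAtlas.Build K K^o K^o
    (@id_chart_dom K K^o) (@id_chart_transition K K^o).

HB.instance Definition _ (K : numFieldType) (k n : nat) :=
  hasHolomorphicAtlas.Build K 'M[K]_(k, n) 'M[K]_(k, n)
    (@id_chart_dom K 'M[K]_(k, n)) (@id_chart_transition K 'M[K]_(k, n)).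

Section Products.
Context {K : numFieldType} {E1 E2 : normedModType K}.

Lemma openX (T1 T2 : topologicalType) (A : set T1) (B : set T2) :
  open A -> open B -> open (A `*` B).
Proof.
rewrite !openE => oA oB [x y] [/= Ax By].
by exists (A, B); [split; [exact: oA|exact: oB]|].
Qed.

Lemma prod_map_continuous (T1 T2 U1 U2 : topologicalType)
    (f : T1 -> U1) (g : T2 -> U2) (x : T1 * T2) :
  {for x.1, continuous f} -> {for x.2, continuous g} ->
  {for x, continuous (fun x => (f x.1, g x.2))}.
Proof.
move=> cf cg; apply: cvg_pair.
- by apply: (@continuous_comp _ _ _ fst f); [exact: cvg_fst|exact: cf].
- by apply: (@continuous_comp _ _ _ snd g); [exact: cvg_snd|exact: cg].
Qed.

Lemma prod_map_differentiable (F1 F2 : normedModType K)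
    (f : E1 -> F1) (g : E2 -> F2) (u : E1 * E2) :
  differentiable f u.1 -> differentiable g u.2 ->
  differentiable (fun u => (f u.1, g u.2)) u.
Proof.
move=> df dg; apply: differentiable_pair.
- apply: (@differentiable_comp _ _ _ _ fst f) => //.
  by apply: linear_differentiable => x; exact: cvg_fst.
- apply: (@differentiable_comp _ _ _ _ snd g) => //.
  by apply: linear_differentiable => x; exact: cvg_snd.
Qed.

Section ProductChart.
Context {T1 T2 : topologicalType} (c1 : chart E1 T1) (c2 : chart E2 T2).

Let dom := chart_dom c1 `*` chart_dom c2.
Let img := chart_img c1 `*` chart_img c2.
Let map (x : T1 * T2) : E1 * E2 := (c1 x.1, c2 x.2).
Let inv (u : E1 * E2) : T1 * T2 := (chart_inv c1 u.1, chart_inv c2 u.2).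

Let map_img x : dom x -> img (map x).
Proof. by move=> [? ?]; split; exact: chart_map_img. Qed.

Let inv_dom u : img u -> dom (inv u).
Proof. by move=> [? ?]; split; exact: chart_inv_dom. Qed.

Let mapK x : dom x -> inv (map x) = x.
Proof. by case: x => x y [/= ? ?]; rewrite /inv /= !chart_mapK. Qed.

Let invK u : img u -> map (inv u) = u.
Proof. by case: u => u v [/= ? ?]; rewrite /map /= !chart_invK. Qed.

Let map_continuous x : dom x -> {for x, continuous map}.
Proof.
by move=> [? ?]; apply: prod_map_continuous; exact: chart_map_continuous.
Qed.

Let inv_continuous u : img u -> {for u, continuous inv}.
Proof.
by move=> [? ?]; apply: prod_map_continuous; exact: chart_inv_continuous.
Qed.

Definition prod_chart : chart (E1 * E2)%type (T1 * T2)%type :=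
  @Chart K (E1 * E2)%type (T1 * T2)%type dom img map inv
    (openX (chart_dom_open c1) (chart_dom_open c2))
    (openX (chart_img_open c1) (chart_img_open c2))
    map_img inv_dom mapK invK map_continuous inv_continuous.

End ProductChart.

Context {M1 : chartedType E1} {M2 : chartedType E2}.

Definition prod_chart_at (x : M1 * M2) : chart (E1 * E2)%type (M1 * M2)%type :=
  prod_chart (chart_at x.1) (chart_at x.2).

Lemma prod_chart_dom (x : M1 * M2) : chart_dom (prod_chart_at x) x.
Proof. by split; exact: chart_at_dom. Qed.

Lemma prod_chart_transition (x y : M1 * M2) (u : E1 * E2) :
  chart_img (prod_chart_at x) u ->
  chart_dom (prod_chart_at y) (chart_inv (prod_chart_at x) u) ->
  differentiable (prod_chart_at y \o chart_inv (prod_chart_at x)) u.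
Proof.
move=> [iu iv] [du dv].
apply: (@prod_map_differentiable _ _ (chart_at y.1 \o chart_inv (chart_at x.1))
  (chart_at y.2 \o chart_inv (chart_at x.2))); exact: chart_at_transition.
Qed.

HB.instance Definition _ :=
  hasHolomorphicAtlas.Build K (E1 * E2)%type (M1 * M2)%type
    prod_chart_dom prod_chart_transition.

End Products.

(* The tangent space at [x] is the model space, a tangent vector being written
   in the coordinates of the chart [chart_at x]. *)
Definition tangent (K : numFieldType) (E : normedModType K)
  (M : chartedType E) (x : M) : normedModType K := E.

Section HolomorphicMaps.
Context {K : numFieldType} {E E' : normedModType K}.

Context {M : chartedType E} {N : chartedType E'}.

Definition local_expr (f : M -> N) (x : M) : E -> E' :=
  chart_at (f x) \o f \o chart_inv (chart_at x).

Definition holomorphic_at (f : M -> N) (x : M) :=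
  {for x, continuous f} /\ differentiable (local_expr f x) (chart_at x x).

Definition holomorphic_on (U : set M) (f : M -> N) :=
  forall x, U x -> holomorphic_at f x.

Definition holomorphic (f : M -> N) := holomorphic_on setT f.

Definition differential (f : M -> N) (x : M) : tangent x -> tangent (f x) :=
  'd (local_expr f x) (chart_at x x).

End HolomorphicMaps.

HB.mixin Record isSeparatedManifold T of Topological T := {
  manifold_hausdorff : hausdorff_space T;
  manifold_second_countable : @second_countable T
}.

#[short(type="complexManifoldType")]
HB.structure Definition ComplexManifold (R : realType) (n : nat) :=
  { T of @Charted R[i] 'rV[R[i]]_n T & isSeparatedManifold T }.

HB.mixin Record isComplexLieGroup (R : realType) (m : nat) G
    of ComplexManifold R m G & Group G := {
  mulg_holomorphic : holomorphic (fun x : G * G => (x.1 * x.2)%g : G);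
  invg_holomorphic : holomorphic (fun x : G => (x^-1)%g : G)
}.

#[short(type="complexLieGroupType")]
HB.structure Definition ComplexLieGroup (R : realType) (m : nat) :=
  { G of ComplexManifold R m G & Group G & isComplexLieGroup R m G }.

Section Exponential.
Context {R : realType} {m : nat} {G : complexLieGroupType R m}.

Definition dL (g h : G) : tangent h -> tangent (g * h)%g :=
  differential (fun k : G => (g * k)%g) (x := h).

Arguments dL : clear implicits.

(* [h * g^-1 * g = h], so that this is a tangent vector at [h], written in the
   chart at [h]. *)
Definition left_invariant_field (g : G) (xi : tangent g) (h : G) : tangent h :=
  dL (h * g^-1)%g g xi.

Definition integral_curve (g : G) (xi : tangent g) : set (R[i]^o -> G) :=
  [set c : R[i]^o -> G | [/\ holomorphic c, c 0 = g &
    forall t, differential c (x := t) 1 = left_invariant_field xi (c t)]].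

(* The integral curve exists and is unique; the default value of [xget] is
   never used. *)
Definition exp_at (g : G) (xi : tangent g) : G :=
  xget (fun=> g) (integral_curve xi) 1.

End Exponential.

Arguments dL {R m G} g h.
Arguments exp_at {R m G} g xi.

Section Smoothness.
Context {R : realType} {V W : normedModType R}.

Definition iter_derive (s : seq V) (f : V -> W) : V -> W :=
  foldr (fun v g => 'D_v g) f s.

(* For an open set [U]: all iterated directional derivatives exist and are
   Frechet differentiable, hence continuous, on [U]. *)
Definition smooth_on (U : set V) (f : V -> W) :=
  forall s x, U x -> differentiable (iter_derive s f) x.

End Smoothness.

Definition complex_point (R : realType) (n : nat)
    (p : 'rV[R]_n * 'rV[R]_n) : 'rV[R[i]]_n :=
  \row_j (p.1 ord0 j +i* p.2 ord0 j)%C.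

HB.mixin Record hasHermitianMetric (R : realType) (n : nat) N
    of ComplexManifold R n N := {
  hermitian_metric : forall p : N, {dot (tangent p) for (@Num.conj R[i])};
  (* In each chart the coefficients [h(d/du_j, d/du_k)] of the metric are
     smooth functions of the real coordinates. *)
  hermitian_metric_smooth : forall (p : N) (j k : 'I_n),
    let c := chart_at p in
    let d_ (i : 'I_n) (u : 'rV[R[i]]_n) :=
      differential (chart_inv c) (x := u) 'e_i in
    let h (xy : 'rV[R]_n * 'rV[R]_n) := let u := complex_point xy in
      hermitian_metric (chart_inv c u) (d_ j u) (d_ k u) in
    let U := [set xy | chart_img c (complex_point xy)] in
    smooth_on U (fun xy => complex.Re (h xy)) /\
    smooth_on U (fun xy => complex.Im (h xy))
}.

#[short(type="hermitianManifoldType")]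
HB.structure Definition HermitianManifold (R : realType) (n : nat) :=
  { N of ComplexManifold R n N & hasHermitianMetric R n N }.

Section NormalFamilies.
Context {X Y : topologicalType}.

(* Relative compactness in the subspace of continuous maps. *)
Definition relatively_compact (A : set {compact-open, X -> Y}) :=
  compact (closure A `&` [set f | continuous (f : X -> Y)]).

Definition compactly_divergent (f_ : nat -> X -> Y) :=
  forall (K : set X) (L : set Y), compact K -> compact L ->
    \forall k \near \oo, (f_ k @` K) `&` L = set0.

(* For families of continuous maps. *)
Definition normal_family (F : set (X -> Y)) :=
  forall f_ : nat -> X -> Y, (forall k, F (f_ k)) ->
  exists s : nat -> nat, {homo s : i j / (i < j)%N >-> (i < j)%N} /\
    (relatively_compact (range (f_ \o s)) \/ compactly_divergent (f_ \o s)).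

End NormalFamilies.

Definition is_domain (X : topologicalType) (A : set X) :=
  [/\ open A, connected A & A !=set0].

Definition is_distance (R : realType) (Y : topologicalType)
    (d : Y -> Y -> R) :=
  [/\ forall x y, d x y = 0 <-> x = y,
      forall x y, d x y = d y x,
      forall x y z, d x z <= d x y + d y z &
      forall x, nbhs x =
        filter_from [set e | 0 < e] (fun e => [set y | d x y < e])].

(* The [j]-th map is only meaningful on [D j]. *)
Definition cvg_on_compacts (R : realType) (X Y : topologicalType)
    (d : Y -> Y -> R) (D : nat -> set X) (f_ : nat -> X -> Y) (f : X -> Y) :=
  forall K : set X, compact K ->
    (\forall j \near \oo, K `<=` D j) /\
    (forall e, 0 < e -> \forall j \near \oo, forall z, K z ->
       d (f_ j z) (f z) < e).

Definition nonconstant (X Y : Type) (f : X -> Y) := exists x y, f x <> f y.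

(* [z |-> exp_p (r (dL_p)_e (eps z^T))], where [eps z^T] is the combination of
   the vectors of [eps] with coefficients [z]. *)
Definition zoom (R : realType) (m : nat) (G : complexLieGroupType R m)
    (eps : m.-tuple (tangent (1%g : G))) (p : G) (r : R)
    (z : 'rV[R[i]]_m) : G :=
  exp_at p (r%:C%C *: dL p 1%g (\sum_(k < m) z 0 k *: tnth eps k)).

(* Main.v *)
Require Import Defs.
From HB Require Import structures.
From mathcomp Require Import all_boot all_order all_algebra.
From mathcomp Require Import sesquilinear.
From mathcomp Require Import all_classical all_reals all_analysis.
From mathcomp Require Import complex.
From mathcomp Require Import ring lra.

Set Implicit Arguments.
Unset Strict Implicit.
Unset Printing Implicit Defensive.

Import Order.TTheory GRing.Theory Num.Theory.
Import numFieldNormedType.Exports.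

Local Open Scope classical_set_scope.
Local Open Scope ring_scope.

(**
If the family is normal, the zoomed maps can only have constant limits. By
compactness of [N] no sequence of the family is compactly divergent, so a
subsequence of the [f_j] accumulates at a continuous map [h]; the points
[exp_{p_j} (rho_j z)] tend to [p_0] for each fixed [z], hence the limit takes
the value [h p_0] at every [z] ([concentrated_limit_constant],
[normal_zoom_limit_constant]).

Conversely, a family that is not normal fails, by Ascoli's theorem ([ascoli]),
to be equicontinuous at some point [p0].  In the chart at [p0] this is the
situation of Zalcman's lemma ([zalcman]), which is proved without
derivatives.  A Lebesgue number of the atlas of [N] gives an oscillation
threshold below which maps stay in one chart, so that Cauchy estimates make
them uniformly equicontinuous ([oscillation_control]).  A doubling argument
([doubling]) chooses points [u_j] and scales [r_j] such that the rescaled maps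
have oscillation above the threshold on the unit ball around the origin but
below it on half-unit balls around all points of a ball of radius [j + 1].
The rescaled maps converge locally uniformly, the limit is holomorphic by
Weierstrass's theorem, and the oscillation that survives at the origin makes
it nonconstant.

Zalcman's lemma rescales by dilations of the chart, the theorem by the
exponential map at the moving point [p_j].  The two agree to first order: in
the chart at [p0], the map [zeta |-> exp_{p_j} (r_j zeta)] is
[u_j + r_j (L zeta + o(1))], uniformly on compact sets, where [L] is a linear
isomorphism ([exp_zoom_chart]).  The zoomed maps therefore converge to the
limit of Zalcman's lemma composed with [L] and with the coordinates in the
basis ([not_normal_zoom]).

What this needs from Lie theory is a formula for [exp_at], which is defined by
integral curves of left-invariant fields.  In coordinates at [1] squaring is
[x |-> 2 x + O(|x| ^ 2)], and [exp xi] is the limit of the [2 ^ k]-th powers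
of the points with coordinates [xi / 2 ^ k] ([approx_exp_cvg]).  It is
additive along real rays ([koenigs_add_real]), extends to the whole Lie
algebra by taking powers ([global_exponential]), and
[t |-> g exp (t xi)] is the unique integral curve through [g] of the
left-invariant field given by [xi] ([exp_atE]).

The one-variable Cauchy estimate behind all this comes from Goursat's theorem
for rectangles ([goursat], [cauchy_deriv]); estimates in several variables and
in coordinates follow by restriction to complex lines and to coordinates.
*)

(** * Real-valued norms over the complex numbers *)

Section RealNorm.
Context {R : realType}.
Local Notation C := (R[i]).

(** The norm of a normed space over [R[i]] is valued in [R[i]]; this is the same
    norm as a real number, so that real arithmetic applies to estimates. *)
Definition nrm {V : normedZmodType C} (v : V) : R := complex.Re `|v|.

Section Generic.
Context {V : normedZmodType C}.
Implicit Types (u v : V).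

Lemma nrmE v : `|v| = (nrm v)%:C%C.
Proof. by rewrite /nrm RRe_real // normr_real. Qed.

Lemma nrm_ge0 v : 0 <= nrm v.
Proof. by rewrite -ler0c -nrmE. Qed.

Lemma nrm0 : nrm (0 : V) = 0.
Proof. by rewrite /nrm normr0. Qed.

Lemma nrm_eq0 v : nrm v = 0 -> v = 0.
Proof. by move=> v0; apply: normr0_eq0; rewrite nrmE v0. Qed.

Lemma nrmD u v : nrm (u + v) <= nrm u + nrm v.
Proof. by rewrite -lecR rmorphD /= -!nrmE ler_normD. Qed.

Lemma nrmN v : nrm (- v) = nrm v.
Proof. by rewrite /nrm normrN. Qed.

Lemma nrm_distC u v : nrm (u - v) = nrm (v - u).
Proof. by rewrite -nrmN opprB. Qed.

Lemma nrmB u v : nrm (u - v) <= nrm u + nrm v.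
Proof. by rewrite (le_trans (nrmD _ _)) // nrmN. Qed.

Lemma nrm_dist_trans (w u v : V) : nrm (u - v) <= nrm (u - w) + nrm (w - v).
Proof. by rewrite (le_trans _ (nrmD _ _)) // addrA subrK. Qed.

End Generic.

Lemma nrmZ (V : normedModType C) (a : C) (v : V) :
  nrm (a *: v) = nrm (a : C^o) * nrm v.
Proof. by apply: complexI; rewrite rmorphM /= -!nrmE normrZ. Qed.

Lemma nrmM (a b : C^o) : nrm (a * b : C^o) = nrm a * nrm b.
Proof. by apply: complexI; rewrite rmorphM /= -!nrmE normrM. Qed.

Lemma nrmC (x : R) : nrm (x%:C%C : C^o) = `|x|.
Proof. by rewrite /nrm normc_def /= expr0n addr0 sqrtr_sqr. Qed.

Lemma nrm1 : nrm (1 : C^o) = 1.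
Proof. by rewrite /nrm normr1. Qed.

Lemma nrmV (a : C^o) : nrm (a^-1 : C^o) = (nrm a)^-1.
Proof. by apply: complexI; rewrite fmorphV /= -!nrmE normfV. Qed.

Lemma nrmX (a : C^o) k : nrm (a ^+ k : C^o) = nrm a ^+ k.
Proof. by apply: complexI; rewrite rmorphXn /= -!nrmE normrX. Qed.

Lemma nrm_i : nrm ('i%C : C^o) = 1.
Proof. by rewrite /nrm normc_def /= expr0n /= add0r expr1n sqrtr1. Qed.

Lemma nrm_Re (z : C^o) : `|complex.Re z| <= nrm z.
Proof. by rewrite -lecR -nrmE normc_ge_Re. Qed.

Lemma nrm_Im (z : C^o) : `|complex.Im z| <= nrm z.
Proof.
have := nrm_Re (z * 'i%C : C^o); rewrite ReiNIm normrN nrmM.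
by rewrite nrm_i mulr1.
Qed.

Lemma nrm_le_ReIm (z : C^o) : nrm z <= `|complex.Re z| + `|complex.Im z|.
Proof.
rewrite /nrm normc_def /= -(@ler_pXn2r _ 2) ?nnegrE ?addr_ge0 //.
rewrite sqr_sqrtr ?addr_ge0 ?sqr_ge0 //.
rewrite -(real_normK (num_real (complex.Re z))) -(real_normK (num_real (complex.Im z))).
by have := normr_ge0 (complex.Re z); have := normr_ge0 (complex.Im z); nra.
Qed.

Lemma nbhs_nrmP (V : normedModType C) (a : V) (P : set V) :
  nbhs a P <-> exists2 e : R, 0 < e & forall v, nrm (v - a) < e -> P v.
Proof.
split=> [/nbhs_normP[e /= e0 eP]|[e e0 eP]].
- exists (complex.Re e); first by move: e0; rewrite ltcE => /andP[].
  move=> v va; apply: eP; rewrite /ball_ /= distrC nrmE.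
  have -> : e = (complex.Re e)%:C%C by rewrite RRe_real // gtr0_real.
  by rewrite ltcR.
- apply/nbhs_normP; exists e%:C%C => /=; first by rewrite ltcR.
  by move=> v /=; rewrite distrC nrmE ltcR; exact: eP.
Qed.

Lemma cvg_nrmP (V : normedModType C) (T : Type) (F : set_system T)
    (FF : Filter F) (f : T -> V) (a : V) :
  f @ F --> a <-> forall e : R, 0 < e -> \forall x \near F, nrm (f x - a) < e.
Proof.
split=> [fa e e0|fa P /nbhs_nrmP[e e0 eP]].
- by apply: (fa [set v | nrm (v - a) < e]); apply/nbhs_nrmP; exists e.
- by apply: filterS (fa e e0) => x; exact: eP.
Qed.

End RealNorm.

(** * Integrals of complex functions over segments *)

Section SegmentIntegral.
Context {R : realType}.
Local Notation C := (R[i]^o).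
Local Notation mu := (@lebesgue_measure R).
Implicit Types (u v : R -> C) (a b c : R).

Definition cont_on (a b : R) (u : R -> C) :=
  forall t, a <= t <= b -> forall e, 0 < e ->
  exists2 del : R, 0 < del &
    forall s, a <= s <= b -> `|s - t| < del -> nrm (u s - u t) < e.

Definition cint (u : R -> C) (a b : R) : C :=
  ((\int[mu]_(x in `[a, b]) complex.Re (u x)) +i*
   (\int[mu]_(x in `[a, b]) complex.Im (u x)))%C.

Lemma ReB (z w : C) : complex.Re (z - w) = complex.Re z - complex.Re w.
Proof. by case: z w => [? ?] [? ?]. Qed.

Lemma ImB (z w : C) : complex.Im (z - w) = complex.Im z - complex.Im w.
Proof. by case: z w => [? ?] [? ?]. Qed.

Lemma integrable_part (p : C -> R) a b u :
    (forall z w : C, `|p z - p w| <= nrm (z - w)) -> cont_on a b u ->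
  mu.-integrable `[a, b] (EFin \o (p \o u)).
Proof.
move=> pL cu; apply: continuous_compact_integrable; first exact: segment_compact.
apply/subspace_continuousP => t /=; rewrite in_itv /= => tab.
apply/cvgrPdist_lt => e e0.
have [d d0 dP] := cu t tab e e0.
near=> s; apply: le_lt_trans (pL _ _) _; rewrite nrm_distC; apply: dP.
- have : `[a, b]%classic s by near: s; exact: withinT.
  by rewrite /= in_itv.
- rewrite distrC; near: s; apply: (@cvg_within _ (nbhs t)).
  exact: nbhsx_ballx.
Unshelve. all: by end_near. Qed.

Lemma Re_lip (z w : C) : `|complex.Re z - complex.Re w| <= nrm (z - w).
Proof. by rewrite -ReB nrm_Re. Qed.

Lemma Im_lip (z w : C) : `|complex.Im z - complex.Im w| <= nrm (z - w).
Proof. by rewrite -ImB nrm_Im. Qed.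

Lemma integrable_Re a b u : cont_on a b u ->
  mu.-integrable `[a, b] (EFin \o (fun x => complex.Re (u x))).
Proof. by move=> cu; apply: (integrable_part Re_lip cu). Qed.

Lemma integrable_Im a b u : cont_on a b u ->
  mu.-integrable `[a, b] (EFin \o (fun x => complex.Im (u x))).
Proof. by move=> cu; apply: (integrable_part Im_lip cu). Qed.

Lemma cont_on_cst a b (k : C) : cont_on a b (fun=> k).
Proof. by move=> t _ e e0; exists 1 => // s _ _; rewrite subrr nrm0. Qed.

Lemma cont_on_lin a b (k : C) u v : cont_on a b u -> cont_on a b v ->
  cont_on a b (fun x => k * u x + v x).
Proof.
move=> cu cv t tab e e0.
have k0 : 0 < nrm k + 1 by rewrite ltr_wpDl ?nrm_ge0.
have [|d1 d10 P1] := cu t tab (e / 2 / (nrm k + 1)); first by rewrite !divr_gt0.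
have [|d2 d20 P2] := cv t tab (e / 2); first by rewrite divr_gt0.
exists (Num.min d1 d2); first by rewrite lt_min d10.
move=> s sab; rewrite lt_min => /andP[/(P1 s sab) h1 /(P2 s sab) h2].
have -> : k * u s + v s - (k * u t + v t) = k * (u s - u t) + (v s - v t) by ring.
rewrite (le_lt_trans (nrmD _ _)) // [ltRHS]splitr ler_ltD // nrmM.
rewrite (@le_trans _ _ ((nrm k + 1) * (e / 2 / (nrm k + 1)))) //.
  by rewrite ler_pM ?nrm_ge0 ?lerDl // ltW.
by rewrite mulrC divfK // gt_eqF.
Qed.

Lemma cont_onB a b u v : cont_on a b u -> cont_on a b v ->
  cont_on a b (fun x => u x - v x).
Proof.
move=> cu cv t tab e e0.
have [d dp dP] := cont_on_lin (-1) cv cu tab e0.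
exists d => // s sab st; have := dP s sab st.
by congr (nrm _ < _); ring.
Qed.

Lemma cint_linear a b (k : C) u v : cont_on a b u -> cont_on a b v ->
  cint (fun x => k * u x + v x) a b = k * cint u a b + cint v a b.
Proof.
move=> cu cv; have [ru iu] := (integrable_Re cu, integrable_Im cu).
have [rv iv] := (integrable_Re cv, integrable_Im cv).
case: k => kr ki; rewrite /cint.
have mI : measurable (`[a, b]%classic : set (measurableTypeR R)) by exact: measurable_itv.
have lin (p q : R) (f g h : R -> R) :
    mu.-integrable `[a, b] (EFin \o f) -> mu.-integrable `[a, b] (EFin \o g) ->
    mu.-integrable `[a, b] (EFin \o h) ->
    \int[mu]_(x in `[a, b]) (p * f x + q * g x + h x) =
    p * \int[mu]_(x in `[a, b]) f x + q * \int[mu]_(x in `[a, b]) g x +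
      \int[mu]_(x in `[a, b]) h x.
  move=> If Ig Ih.
  have If' : mu.-integrable `[a, b] (EFin \o (fun x => p * f x)).
    exact: (integrableZl mI p If).
  have Ig' : mu.-integrable `[a, b] (EFin \o (fun x => q * g x)).
    exact: (integrableZl mI q Ig).
  have Ifg : mu.-integrable `[a, b] (EFin \o (fun x => p * f x + q * g x)).
    exact: (integrableD mI If' Ig').
  by rewrite (RintegralD mI Ifg Ih) (RintegralD mI If' Ig') !RintegralZl.
congr (_ +i* _)%C.
- rewrite -mulNr -(lin kr (- ki)) //; apply: eq_Rintegral => x _.
  by case: (u x) (v x) => [? ?] [? ?] /=; ring.
- rewrite -(lin kr ki) //; apply: eq_Rintegral => x _.
  by case: (u x) (v x) => [? ?] [? ?] /=; ring.
Qed.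

Lemma eq_cint a b u v : (forall x, a <= x <= b -> u x = v x) ->
  cint u a b = cint v a b.
Proof.
move=> uv; rewrite /cint; congr (_ +i* _)%C; apply: eq_Rintegral => x;
  by rewrite inE /= in_itv /= => /uv ->.
Qed.

Lemma mu_itv a b : a <= b -> fine (mu `[a, b]) = b - a.
Proof.
rewrite lebesgue_measure_itv /= lte_fin le_eqVlt => /predU1P[->|ab].
  by rewrite ltxx subrr.
by rewrite ab.
Qed.

Lemma cint_cst a b (k : C) : a <= b -> cint (fun=> k) a b = k * (b - a)%:C%C.
Proof.
move=> ab; rewrite /cint !Rintegral_cst //; rewrite mu_itv //.
by case: k => p q; apply/eqP; rewrite eq_complex /= !mulr0 subr0 add0r !eqxx.
Qed.

Lemma cint_split a b c u : a <= b -> b <= c -> cont_on a c u ->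
  cint u a c = cint u a b + cint u b c.
Proof.
move=> ab bc cu.
have spl (f : R -> R) : mu.-integrable `[a, c] (EFin \o f) ->
    \int[mu]_(x in `[a, c]) f x =
    \int[mu]_(x in `[a, b]) f x + \int[mu]_(x in `[b, c]) f x.
  move=> If; apply/eqP; rewrite addrC -subr_eq; apply/eqP.
  rewrite (Rintegral_itvB If) ?bnd_simp // Rintegral_itv_obnd_cbnd //.
  by apply: integrableS If => //; apply: subset_itvr; rewrite bnd_simp.
by rewrite /cint (spl _ (integrable_Re cu)) (spl _ (integrable_Im cu)).
Qed.

(** The factor [2] comes from estimating real and imaginary parts separately; it is
    harmless where only some explicit constant is needed. *)
Lemma cint_le a b u (M : R) : a <= b -> cont_on a b u ->
  (forall x, a <= x <= b -> nrm (u x) <= M) ->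
  nrm (cint u a b) <= 2 * M * (b - a).
Proof.
move=> ab cu uM; rewrite (le_trans (nrm_le_ReIm _)) //=.
have mI : measurable (`[a, b]%classic : set (measurableTypeR R)) by exact: measurable_itv.
have bnd (f : R -> R) : mu.-integrable `[a, b] (EFin \o f) ->
    (forall x, a <= x <= b -> `|f x| <= M) ->
    `|\int[mu]_(x in `[a, b]) f x| <= M * (b - a).
  move=> If fM; rewrite (le_trans (le_normr_Rintegral mI If)) //.
  rewrite -(mu_itv ab) -Rintegral_cst //; apply: le_Rintegral => //.
  - exact: (integrable_norm If).
  - apply: continuous_compact_integrable; first exact: segment_compact.
    by move=> x; apply: cvg_cst.
have -> : 2 * M * (b - a) = M * (b - a) + M * (b - a) by ring.
apply: lerD; apply: bnd.
- exact: integrable_Re.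
- by move=> x /uM; exact: le_trans (nrm_Re _).
- exact: integrable_Im.
- by move=> x /uM; exact: le_trans (nrm_Im _).
Qed.

End SegmentIntegral.

(** * Goursat's theorem for rectangles *)

Section Goursat.
Context {R : realType}.
Local Notation C := (R[i]^o).
Implicit Types (F : C -> C) (z w l : C).

(** Complex differentiability with derivative [l], in a form that feeds the
    elementary estimates below; it is equivalent to [differentiable]. *)
Definition cdiff (F : C -> C) (z l : C) :=
  forall e : R, 0 < e -> exists2 d : R, 0 < d &
    forall w, nrm (w - z) < d -> nrm (F w - F z - l * (w - z)) <= e * nrm (w - z).

Definition ccont (F : C -> C) (z : C) :=
  forall e : R, 0 < e -> exists2 d : R, 0 < d &
    forall w, nrm (w - z) < d -> nrm (F w - F z) < e.

Lemma cdiff_ccont F z l : cdiff F z l -> ccont F z.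
Proof.
move=> Fz e e0; have [d d0 dP] := Fz 1 ltr01.
have l0 : 0 < nrm l + 1 by rewrite ltr_wpDl ?nrm_ge0.
exists (Num.min d (e / (nrm l + 1))); first by rewrite lt_min d0 divr_gt0.
move=> w; rewrite lt_min => /andP[wd we].
have -> : F w - F z = (F w - F z - l * (w - z)) + l * (w - z) by ring.
rewrite (le_lt_trans (nrmD _ _)) // nrmM.
have := dP w wd; rewrite mul1r => h.
rewrite (@le_lt_trans _ _ ((nrm l + 1) * nrm (w - z))) //; last first.
  by rewrite mulrC -ltr_pdivlMr.
by rewrite mulrDl mul1r addrC lerD2l.
Qed.

Definition rect (x0 x1 y0 y1 : R) : set C :=
  [set z | x0 <= complex.Re z <= x1 /\ y0 <= complex.Im z <= y1].

Definition rect_bd (x0 x1 y0 y1 : R) : set C :=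
  [set z | rect x0 x1 y0 y1 z /\
    [\/ complex.Re z = x0, complex.Re z = x1, complex.Im z = y0 | complex.Im z = y1]].

(** The contour integral of [F] along the boundary of a rectangle, opposite
    sides being put under one integral sign. *)
Definition rint (F : C -> C) (x0 x1 y0 y1 : R) : C :=
  cint (fun x => F (x +i* y0)%C - F (x +i* y1)%C) x0 x1 +
  'i%C * cint (fun y => F (x1 +i* y)%C - F (x0 +i* y)%C) y0 y1.

Lemma cont_on_hor F x0 x1 y : (forall x, x0 <= x <= x1 -> ccont F (x +i* y)%C) ->
  cont_on x0 x1 (fun x => F (x +i* y)%C).
Proof.
move=> cF t /cF cFt e /cFt [d d0 dP]; exists d => // s _ st; apply: dP.
by rewrite (le_lt_trans (nrm_le_ReIm _)) //= subrr normr0 addr0.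
Qed.

Lemma cont_on_ver F x y0 y1 : (forall y, y0 <= y <= y1 -> ccont F (x +i* y)%C) ->
  cont_on y0 y1 (fun y => F (x +i* y)%C).
Proof.
move=> cF t /cF cFt e /cFt [d d0 dP]; exists d => // s _ st; apply: dP.
by rewrite (le_lt_trans (nrm_le_ReIm _)) //= subrr normr0 add0r.
Qed.

Section Continuous.
Variables (F : C -> C) (x0 x1 y0 y1 : R).
Hypotheses (x01 : x0 <= x1) (y01 : y0 <= y1).
Hypothesis cF : forall z, rect_bd x0 x1 y0 y1 z -> ccont F z.

Let hx0 : x0 <= x0 <= x1. Proof. by rewrite lexx. Qed.
Let hx1 : x0 <= x1 <= x1. Proof. by rewrite lexx andbT. Qed.
Let hy0 : y0 <= y0 <= y1. Proof. by rewrite lexx. Qed.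
Let hy1 : y0 <= y1 <= y1. Proof. by rewrite lexx andbT. Qed.

Let ch0 (G : C -> C) : (forall z, rect_bd x0 x1 y0 y1 z -> ccont G z) ->
  cont_on x0 x1 (fun x => G (x +i* y0)%C).
Proof.
by move=> cG; apply: cont_on_hor => x hx; apply: cG; split => //; constructor 3.
Qed.

Let ch1 (G : C -> C) : (forall z, rect_bd x0 x1 y0 y1 z -> ccont G z) ->
  cont_on x0 x1 (fun x => G (x +i* y1)%C).
Proof.
by move=> cG; apply: cont_on_hor => x hx; apply: cG; split => //; constructor 4.
Qed.

Let cv0 (G : C -> C) : (forall z, rect_bd x0 x1 y0 y1 z -> ccont G z) ->
  cont_on y0 y1 (fun y => G (x0 +i* y)%C).
Proof.
by move=> cG; apply: cont_on_ver => x hx; apply: cG; split => //; constructor 1.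
Qed.

Let cv1 (G : C -> C) : (forall z, rect_bd x0 x1 y0 y1 z -> ccont G z) ->
  cont_on y0 y1 (fun y => G (x1 +i* y)%C).
Proof.
by move=> cG; apply: cont_on_ver => x hx; apply: cG; split => //; constructor 2.
Qed.

Let chx : cont_on x0 x1 (fun x => F (x +i* y0)%C - F (x +i* y1)%C).
Proof. by apply: cont_onB; [exact: ch0|exact: ch1]. Qed.

Let cvy : cont_on y0 y1 (fun y => F (x1 +i* y)%C - F (x0 +i* y)%C).
Proof. by apply: cont_onB; [exact: cv1|exact: cv0]. Qed.

Lemma cintD a b (u v : R -> C) : cont_on a b u -> cont_on a b v ->
  cint (fun x => u x + v x) a b = cint u a b + cint v a b.
Proof.
move=> cu cv; rewrite -[cint u a b]mul1r -(cint_linear 1) //.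
by apply: eq_cint => x _; rewrite mul1r.
Qed.

Lemma rint_splitx x : x0 <= x <= x1 ->
  (forall y, y0 <= y <= y1 -> ccont F (x +i* y)%C) ->
  rint F x0 x1 y0 y1 = rint F x0 x y0 y1 + rint F x x1 y0 y1.
Proof.
move=> /andP[xl xr] cx; rewrite /rint (cint_split xl xr chx).
have -> : cint (fun y => F (x1 +i* y)%C - F (x0 +i* y)%C) y0 y1 =
    cint (fun y => F (x +i* y)%C - F (x0 +i* y)%C) y0 y1 +
    cint (fun y => F (x1 +i* y)%C - F (x +i* y)%C) y0 y1.
  rewrite -cintD; first by apply: eq_cint => y _; ring.
  - by apply: cont_onB; [exact: cont_on_ver|exact: cv0].
  - by apply: cont_onB; [exact: cv1|exact: cont_on_ver].
by rewrite mulrDr; ring.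
Qed.

Lemma rint_splity y : y0 <= y <= y1 ->
  (forall x, x0 <= x <= x1 -> ccont F (x +i* y)%C) ->
  rint F x0 x1 y0 y1 = rint F x0 x1 y0 y + rint F x0 x1 y y1.
Proof.
move=> /andP[yl yr] cy; rewrite /rint (cint_split yl yr cvy).
have -> : cint (fun x => F (x +i* y0)%C - F (x +i* y1)%C) x0 x1 =
    cint (fun x => F (x +i* y0)%C - F (x +i* y)%C) x0 x1 +
    cint (fun x => F (x +i* y)%C - F (x +i* y1)%C) x0 x1.
  rewrite -cintD; first by apply: eq_cint => x _; ring.
  - by apply: cont_onB; [exact: ch0|exact: cont_on_hor].
  - by apply: cont_onB; [exact: cont_on_hor|exact: ch1].
by rewrite mulrDr; ring.
Qed.

Lemma rint_linear (k : C) (G : C -> C) :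
  (forall z, rect_bd x0 x1 y0 y1 z -> ccont G z) ->
  rint (fun z => k * F z + G z) x0 x1 y0 y1 =
  k * rint F x0 x1 y0 y1 + rint G x0 x1 y0 y1.
Proof.
move=> cG; rewrite /rint.
rewrite (_ : cint (fun x => _ - _) x0 x1 =
   k * cint (fun x => F (x +i* y0)%C - F (x +i* y1)%C) x0 x1 +
   cint (fun x => G (x +i* y0)%C - G (x +i* y1)%C) x0 x1); last first.
  rewrite -cint_linear //; first by apply: eq_cint => x _; ring.
  by apply: cont_onB; [exact: ch0|exact: ch1].
rewrite (_ : cint (fun y => _ - _) y0 y1 =
   k * cint (fun y => F (x1 +i* y)%C - F (x0 +i* y)%C) y0 y1 +
   cint (fun y => G (x1 +i* y)%C - G (x0 +i* y)%C) y0 y1); last first.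
  rewrite -cint_linear //; first by apply: eq_cint => x _; ring.
  by apply: cont_onB; [exact: cv1|exact: cv0].
by ring.
Qed.

Lemma rint_le (e : R) : (forall z, rect_bd x0 x1 y0 y1 z -> nrm (F z) <= e) ->
  nrm (rint F x0 x1 y0 y1) <= 4 * e * ((x1 - x0) + (y1 - y0)).
Proof.
move=> Fe; rewrite /rint (le_trans (nrmD _ _)) // nrmM nrm_i mul1r.
have -> : 4 * e * (x1 - x0 + (y1 - y0)) =
  2 * (2 * e) * (x1 - x0) + 2 * (2 * e) * (y1 - y0) by ring.
apply: lerD; apply: cint_le => //.
- move=> x hx; rewrite (le_trans (nrmB _ _)) // mulr_natl mulr2n.
  by apply: lerD; apply: Fe; split => //; [constructor 3|constructor 4].
- move=> y hy; rewrite (le_trans (nrmB _ _)) // mulr_natl mulr2n.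
  by apply: lerD; apply: Fe; split => //; [constructor 2|constructor 1].
Qed.

(** Affine functions have integral [0] along the boundary of a rectangle, so only
    the deviation from one of them contributes. *)
Lemma rint_affine (c l z : C) (e : R) :
  (forall w, rect x0 x1 y0 y1 w -> nrm (F w - c - l * (w - z)) <= e) ->
  nrm (rint F x0 x1 y0 y1) <= 4 * e * ((x1 - x0) + (y1 - y0)).
Proof.
move=> Fe; rewrite /rint.
pose kx : C := l * ((0 : R) +i* (y0 - y1))%C.
pose ky : C := l * ((x1 - x0) +i* (0 : R))%C.
pose ux x : C := F (x +i* y0)%C - F (x +i* y1)%C - kx.
pose uy y : C := F (x1 +i* y)%C - F (x0 +i* y)%C - ky.
have -> : cint (fun x => F (x +i* y0)%C - F (x +i* y1)%C) x0 x1 =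
    kx * (x1 - x0)%:C%C + cint ux x0 x1.
  rewrite -cint_cst // -cintD; first by apply: eq_cint => x _; rewrite /ux; ring.
    exact: cont_on_cst.
  by apply: cont_onB => //; exact: cont_on_cst.
have -> : cint (fun y => F (x1 +i* y)%C - F (x0 +i* y)%C) y0 y1 =
    ky * (y1 - y0)%:C%C + cint uy y0 y1.
  rewrite -cint_cst // -cintD; first by apply: eq_cint => x _; rewrite /uy; ring.
    exact: cont_on_cst.
  by apply: cont_onB => //; exact: cont_on_cst.
have -> : kx * (x1 - x0)%:C%C + cint ux x0 x1 +
    'i%C * (ky * (y1 - y0)%:C%C + cint uy y0 y1) =
    cint ux x0 x1 + 'i%C * cint uy y0 y1.
  rewrite mulrDr addrACA -[RHS]add0r; congr (_ + _).
  rewrite /kx /ky; case: (l) => p q; apply/eqP; rewrite eq_complex /=.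
  by apply/andP; split; apply/eqP; ring.
rewrite (le_trans (nrmD _ _)) // nrmM nrm_i mul1r.
have -> : 4 * e * (x1 - x0 + (y1 - y0)) =
  2 * (2 * e) * (x1 - x0) + 2 * (2 * e) * (y1 - y0) by ring.
apply: lerD; apply: cint_le => //.
- by apply: cont_onB => //; exact: cont_on_cst.
- move=> x hx.
  have -> : ux x = (F (x +i* y0)%C - c - l * ((x +i* y0)%C - z)) -
                   (F (x +i* y1)%C - c - l * ((x +i* y1)%C - z)).
    rewrite /ux /kx; have -> : (0 +i* (y0 - y1))%C = (x +i* y0)%C - (x +i* y1)%C :> C.
      by apply/eqP; rewrite eq_complex /= subrr !eqxx.
    by ring.
  by rewrite (le_trans (nrmB _ _)) // mulr_natl mulr2n; apply: lerD; apply: Fe.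
- by apply: cont_onB => //; exact: cont_on_cst.
- move=> y hy.
  have -> : uy y = (F (x1 +i* y)%C - c - l * ((x1 +i* y)%C - z)) -
                   (F (x0 +i* y)%C - c - l * ((x0 +i* y)%C - z)).
    rewrite /uy /ky; have -> : ((x1 - x0) +i* 0)%C = (x1 +i* y)%C - (x0 +i* y)%C :> C.
      by apply/eqP; rewrite eq_complex /= subrr !eqxx.
    by ring.
  by rewrite (le_trans (nrmB _ _)) // mulr_natl mulr2n; apply: lerD; apply: Fe.
Qed.

End Continuous.

Lemma rect_sub x0 x1 y0 y1 x0' x1' y0' y1' :
  x0 <= x0' -> x1' <= x1 -> y0 <= y0' -> y1' <= y1 ->
  rect x0' x1' y0' y1' `<=` rect x0 x1 y0 y1.
Proof.
move=> a b c d z [/andP[p q] /andP[r s]].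
by split; apply/andP; split; [exact: le_trans p|exact: le_trans b|
   exact: le_trans r|exact: le_trans d].
Qed.

End Goursat.

Section GoursatTheorem.
Context {R : realType}.
Local Notation C := (R[i]^o).
Implicit Types (F : C -> C) (z w l : C).

Lemma nested_segments (u v : nat -> R) :
  (forall n, u n <= u n.+1) -> (forall n, v n.+1 <= v n) -> (forall n, u n <= v n) ->
  exists x, forall n, u n <= x <= v n.
Proof.
move=> iu dv uv.
have ui n k : u n <= u (n + k)%N.
  by elim: k => [|k IH]; rewrite ?addn0 // addnS (le_trans IH).
have vd n k : v (n + k)%N <= v n.
  by elim: k => [|k IH]; rewrite ?addn0 // addnS (le_trans (dv _)).
have uvmn m n : u m <= v n.
  rewrite (le_trans (ui m n)) // (le_trans (uv _)) // addnC; exact: vd.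
exists (sup (range u)) => n; apply/andP; split.
- apply: ub_le_sup; last by exists n.
  by exists (v 0%N) => _ [m _ <-].
- by apply: ge_sup; [exists (u 0%N), 0%N|move=> _ [m _ <-]].
Qed.

Lemma half_pow_small (e : R) : 0 < e -> exists n, 2^-1 ^+ n < e.
Proof.
move=> e0.
have h : `|2^-1 : R| < 1 by rewrite ger0_norm ?invr_ge0 // invf_lt1 ?ltr1n.
have /cvgrPdist_lt/(_ e e0)[n _ /(_ n (leqnn n))] := cvg_expr h.
by rewrite /= sub0r normrN ger0_norm ?exprn_ge0 ?invr_ge0 // => ?; exists n.
Qed.

Lemma lower_half (u0 u1 u a : R) : u0 <= u -> u + (a + a) <= u1 -> 0 <= a ->
  [/\ u0 <= u, u + a <= u1, u <= u & u + a <= u + (a + a)].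
Proof. by move=> h1 h2 h3; split=> //; lra. Qed.

Lemma upper_half (u0 u1 u a : R) : u0 <= u -> u + (a + a) <= u1 -> 0 <= a ->
  [/\ u0 <= u + a, u + a + a <= u1, u <= u + a & u + a + a <= u + (a + a)].
Proof. by move=> h1 h2 h3; split=> //; lra. Qed.

(** Quartering the rectangle repeatedly and keeping a quarter that carries at
    least a quarter of the integral leads to nested rectangles that shrink to a
    point; differentiability there makes [F] affine up to an error that is too
    small for the integral retained. *)
Lemma goursat F x0 x1 y0 y1 : x0 <= x1 -> y0 <= y1 ->
  (forall z, rect x0 x1 y0 y1 z -> exists l, cdiff F z l) ->
  rint F x0 x1 y0 y1 = 0.
Proof.
move=> x01 y01 dF; pose T := nrm (rint F x0 x1 y0 y1).
have cF z : rect x0 x1 y0 y1 z -> ccont F z.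
  by move=> /dF[l]; exact: cdiff_ccont.
apply: nrm_eq0; apply/eqP; rewrite -/T; apply: contrapT => /negP T0.
have {T0}T0 : 0 < T by rewrite lt_def T0 nrm_ge0.
pose a := x1 - x0; pose b := y1 - y0; pose q n : R := 2^-1 ^+ n.
have a0 : 0 <= a by rewrite subr_ge0.
have b0 : 0 <= b by rewrite subr_ge0.
have q0 n : 0 < q n by rewrite exprn_gt0 ?invr_gt0.
have qS n : q n = 2 * q n.+1.
  by rewrite /q exprS mulrA divff ?mul1r // pnatr_eq0.
(* the rectangle of generation [n] with lower left corner [(x, y)] *)
pose good (s : nat * (R * R)) := let: (n, (x, y)) := s in
  [/\ x0 <= x, x + a * q n <= x1, y0 <= y, y + b * q n <= y1 &
   T * q n ^+ 2 <= nrm (rint F x (x + a * q n) y (y + b * q n))].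
have step (s : nat * (R * R)) : exists p : R * R, good s ->
    good (s.1.+1, p) /\
    [/\ s.2.1 <= p.1, p.1 + a * q s.1.+1 <= s.2.1 + a * q s.1,
        s.2.2 <= p.2 & p.2 + b * q s.1.+1 <= s.2.2 + b * q s.1].
  case: s => n [x y] /=.
  have [[h1 h2 h3 h4 h5]|ng] := pselect (good (n, (x, y))); last first.
    by exists (0, 0) => /ng.
  pose a' := a * q n.+1; pose b' := b * q n.+1.
  have a'0 : 0 <= a' by rewrite mulr_ge0 // ltW.
  have b'0 : 0 <= b' by rewrite mulr_ge0 // ltW.
  have ea : a * q n = a' + a' by rewrite qS /a'; ring.
  have eb : b * q n = b' + b' by rewrite qS /b'; ring.
  rewrite ea eb in h2 h4 h5.
  have cF' x' x'' y' y'' : x <= x' -> x'' <= x + (a' + a') -> y <= y' ->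
      y'' <= y + (b' + b') -> forall z, rect x' x'' y' y'' z -> ccont F z.
    move=> k1 k2 k3 k4 z hz; apply: cF; apply: rect_sub hz; lra.
  have e1 : rint F x (x + (a' + a')) y (y + (b' + b')) =
     (rint F x (x + a') y (y + b') + rint F x (x + a') (y + b') (y + b' + b')) +
     (rint F (x + a') (x + a' + a') y (y + b') +
      rint F (x + a') (x + a' + a') (y + b') (y + b' + b')).
    have e2 : x + (a' + a') = x + a' + a' by ring.
    have e3 : y + (b' + b') = y + b' + b' by ring.
    have cR : forall z, rect x (x + (a' + a')) y (y + (b' + b')) z -> ccont F z.
      by apply: cF'.
    rewrite e2 e3 in cR *; rewrite (@rint_splitx _ _ _ _ _ _ _ _ _ (x + a')); first last.
    - by move=> t ht; apply: cR; split => //=; lra.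
    - by apply/andP; split; lra.
    - by move=> z [zr _]; exact: cR.
    - lra.
    - lra.
    rewrite (@rint_splity _ _ x (x + a') _ _ _ _ _ (y + b')); first last.
    - by move=> t ht; apply: cR; split => //=; lra.
    - by apply/andP; split; lra.
    - by move=> z [zr _]; apply: cR; apply: rect_sub zr; lra.
    - lra.
    - lra.
    rewrite (@rint_splity _ _ (x + a') _ _ _ _ _ _ (y + b')) //; first last.
    - by move=> t ht; apply: cR; split => //=; lra.
    - by apply/andP; split; lra.
    - by move=> z [zr _]; apply: cR; apply: rect_sub zr; lra.
    - lra.
    - lra.
  pose Tq := T * q n.+1 ^+ 2.
  have TqE : T * q n ^+ 2 = Tq + Tq + (Tq + Tq) by rewrite qS /Tq; ring.
  have {h5 TqE e1} : [\/ Tq <= nrm (rint F x (x + a') y (y + b')),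
    Tq <= nrm (rint F x (x + a') (y + b') (y + b' + b')),
    Tq <= nrm (rint F (x + a') (x + a' + a') y (y + b')) |
    Tq <= nrm (rint F (x + a') (x + a' + a') (y + b') (y + b' + b'))].
    move: h5; rewrite e1 TqE => /le_trans/(_ (nrmD _ _)).
    have := nrmD (rint F x (x + a') y (y + b')) (rint F x (x + a') (y + b') (y + b' + b')).
    have := nrmD (rint F (x + a') (x + a' + a') y (y + b'))
      (rint F (x + a') (x + a' + a') (y + b') (y + b' + b')).
    move: (nrm (rint F x (x + a') y (y + b'))) (nrm (rint F x (x + a') (y + b') (y + b' + b')))
      (nrm (rint F (x + a') (x + a' + a') y (y + b')))
      (nrm (rint F (x + a') (x + a' + a') (y + b') (y + b' + b'))) => s1 s2 s3 s4 k1 k2 k3.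
    have [|t1] := leP Tq s1; first by constructor 1.
    have [|t2] := leP Tq s2; first by constructor 2.
    have [|t3] := leP Tq s3; first by constructor 3.
    have [|t4] := leP Tq s4; first by constructor 4.
    lra.
  have [xl1 xl2 xl3 xl4] := lower_half h1 h2 a'0.
  have [xr1 xr2 xr3 xr4] := upper_half h1 h2 a'0.
  have [yl1 yl2 yl3 yl4] := lower_half h3 h4 b'0.
  have [yr1 yr2 yr3 yr4] := upper_half h3 h4 b'0.
  case=> hT.
  - by exists (x, y) => _; split; split=> //=; rewrite -?/a' -?/b' ?ea ?eb.
  - by exists (x, y + b') => _; split; split=> //=; rewrite -?/a' -?/b' ?ea ?eb.
  - by exists (x + a', y) => _; split; split=> //=; rewrite -?/a' -?/b' ?ea ?eb.
  - by exists (x + a', y + b') => _; split; split=> //=; rewrite -?/a' -?/b' ?ea ?eb.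
have [f fP] := choice step.
pose p := fix p n := if n is k.+1 then f (k, p k) else (x0, y0).
have pG n : good (n, p n).
  elim: n => [|n IH]; last by have [] := fP _ IH.
  rewrite /good /= /q expr0 !mulr1 expr1n mulr1 /a /b.
  have -> : x0 + (x1 - x0) = x1 by ring.
  by have -> : y0 + (y1 - y0) = y1 by ring.
have pN n : [/\ (p n).1 <= (p n.+1).1, (p n.+1).1 + a * q n.+1 <= (p n).1 + a * q n,
        (p n).2 <= (p n.+1).2 & (p n.+1).2 + b * q n.+1 <= (p n).2 + b * q n].
  by have [_] := fP _ (pG n).
have [xs xsP] : exists xs, forall n, (p n).1 <= xs <= (p n).1 + a * q n.
  apply: nested_segments => n; [by have [] := pN n|by have [] := pN n|].
  by rewrite lerDl mulr_ge0 // ltW.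
have [ys ysP] : exists ys, forall n, (p n).2 <= ys <= (p n).2 + b * q n.
  apply: nested_segments => n; [by have [] := pN n|by have [] := pN n|].
  by rewrite lerDl mulr_ge0 // ltW.
pose zs : C := (xs +i* ys)%C.
have zsr : rect x0 x1 y0 y1 zs.
  have := xsP 0%N; have := ysP 0%N; rewrite /= /q expr0 !mulr1 /a /b.
  by move=> h1 h2; split; rewrite /=; lra.
have [l ldiff] := dF _ zsr.
pose D := a + b.
have D0 : 0 <= D by rewrite addr_ge0.
pose e := T / (8 * D ^+ 2 + 1).
have den0 : 0 < 8 * D ^+ 2 + 1 by rewrite ltr_wpDl // mulr_ge0 // sqr_ge0.
have e0 : 0 < e by rewrite divr_gt0.
have [d d0 dP] := ldiff e e0.
have [n nD] : exists n, D * q n < d.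
  have D1 : 0 < D + 1 by rewrite ltr_wpDl.
  have [n nP] := half_pow_small (divr_gt0 d0 D1).
  exists n; rewrite (@le_lt_trans _ _ ((D + 1) * q n)) //.
    by rewrite ler_pM2r // lerDl.
  by rewrite mulrC -ltr_pdivlMr.
have := pG n; rewrite /good; case pE : (p n) => [x y] [h1 h2 h3 h4 h5].
have := xsP n; have := ysP n; rewrite pE /= => /andP[hy1 hy2] /andP[hx1 hx2].
have : nrm (rint F x (x + a * q n) y (y + b * q n)) <=
    4 * (e * (D * q n)) * ((x + a * q n - x) + (y + b * q n - y)).
  apply: (@rint_affine _ F _ _ _ _ _ _ _ (F zs) l zs).
  - by rewrite lerDl mulr_ge0 // ltW.
  - by rewrite lerDl mulr_ge0 // ltW.
  - by move=> z [hz _]; apply: cF; apply: rect_sub hz.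
  move=> w [/andP[w1 w2] /andP[w3 w4]].
  have wD : nrm (w - zs) <= D * q n.
    rewrite (le_trans (nrm_le_ReIm _)) // ReB ImB /= /D mulrDl.
    by apply: lerD; rewrite ler_norml; apply/andP; split; lra.
  by rewrite (le_trans (dP w _)) ?(le_lt_trans wD) // ler_pM2l.
move=> /(le_trans h5); apply/negP; rewrite -ltNge.
have -> : 4 * (e * (D * q n)) * (x + a * q n - x + (y + b * q n - y)) =
  (e * (4 * D ^+ 2)) * q n ^+ 2 by rewrite /D; ring.
rewrite ltr_pM2r ?exprn_gt0 // /e mulrAC ltr_pdivrMr // ltr_pM2l //.
have := sqr_ge0 D; lra.
Qed.

End GoursatTheorem.

(** * The Cauchy estimate for the derivative at a point *)

Section DifferentiableNrm.
Context {R : realType}.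
Local Notation C := (R[i]^o).

Lemma diff_nrm (V W : normedModType R[i]) (f : V -> W) (a : V) :
  differentiable f a -> forall e : R, 0 < e -> exists2 d : R, 0 < d &
    forall x, nrm (x - a) < d -> nrm (f x - f a - 'd f a (x - a)) <= e * nrm (x - a).
Proof.
move=> /diff_locallyP[_ /eqaddoP fa] e e0.
have eC : 0 < e%:C%C :> R[i] by rewrite ltcR.
have /nbhs_nrmP[d d0 dP] := fa _ eC.
exists d => // x xa; have := dP (x - a); rewrite subr0 => /(_ xa).
rewrite /= !fctE /= subrK opprD addrA !nrmE.
by rewrite -rmorphM /= lecR.
Qed.

Lemma nrm_diff (V W : normedModType R[i]) (f : V -> W) (a : V)
    (L : {linear V -> W}) : continuous L ->
  (forall e : R, 0 < e -> exists2 d : R, 0 < d &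
    forall x, nrm (x - a) < d -> nrm (f x - f a - L (x - a)) <= e * nrm (x - a)) ->
  differentiable f a /\ ('d f a = L :> (V -> W)).
Proof.
move=> cL fL.
have H : f \o shift a = cst (f a) + L +o_ 0 id.
  apply/eqaddoP => e e0.
  have eE : e = (complex.Re e)%:C%C by rewrite RRe_real // gtr0_real.
  have e0' : 0 < complex.Re e by rewrite eE ltcR in e0.
  have [d d0 dP] := fL _ e0'.
  apply/nbhs_nrmP; exists d => // x; rewrite subr0 => xd.
  have := dP (x + a); rewrite addrK => /(_ xd).
  by rewrite /= !fctE /= opprD addrA !nrmE eE -rmorphM /= lecR.
have dE := diff_unique cL H.
split=> //; apply/diff_locallyP; split; first by rewrite dE.
by rewrite dE.
Qed.

Lemma nrm_lin_continuous (V W : normedModType R[i]) (L : {linear V -> W}) (K : R) :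
  (forall v, nrm (L v) <= K * nrm v) -> continuous L.
Proof.
move=> LK x; apply/cvg_nrmP => e e0.
have K0 : 0 < `|K| + 1 by rewrite ltr_wpDl.
apply/nbhs_nrmP; exists (e / (`|K| + 1)); first by rewrite divr_gt0.
move=> y yx; rewrite -linearB (le_lt_trans (LK _)) //.
rewrite (@le_lt_trans _ _ ((`|K| + 1) * nrm (y - x))) //.
  by rewrite ler_wpM2r ?nrm_ge0 // (le_trans (ler_norm _)) // lerDl.
by rewrite mulrC -ltr_pdivlMr.
Qed.

Lemma cdiff_differentiable (F : C -> C) z l : cdiff F z l -> differentiable F z.
Proof.
move=> Fl.
have cL : continuous (l \*: (@idfun C) : C -> C).
  by apply: (@nrm_lin_continuous _ _ _ (nrm l)) => v; rewrite /= nrmM.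
by have [] := nrm_diff cL Fl.
Qed.

Lemma differentiable_cdiff (F : C -> C) z :
  differentiable F z -> cdiff F z ('d F z (1 : C)).
Proof.
move=> /diff_nrm Fd e /Fd[d d0 dP]; exists d => // w /dP.
have -> : 'd F z (w - z) = 'd F z (1 : C) * (w - z).
  by rewrite -[in LHS](mulr1 (w - z)) linearZ /= mulrC.
by [].
Qed.

(** This replaces the exact value [2 i pi]: on both pairs of opposite sides the
    integrand contributing to the imaginary part is [2 r / (x ^ 2 + r ^ 2)], which
    is at least [1 / r]. *)
Lemma rint_inv_ge (r : R) : 0 < r ->
  4 <= nrm (rint (fun z : C => z^-1) (- r) r (- r) r).
Proof.
move=> r0; pose F : C -> C := fun z => z^-1.
have r2 : - r <= r by lra.
have cF (z : C) : z != 0 -> ccont F z.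
  move=> z0; apply: (@cdiff_ccont _ _ _ ('d F z (1 : C))).
  by apply: differentiable_cdiff; apply: differentiable_Rinv.
have neq0x (x y : R) : y != 0 -> (x +i* y)%C != 0 :> C.
  by move=> y0; rewrite eq_complex /= negb_and y0 orbT.
have neq0y (x y : R) : x != 0 -> (x +i* y)%C != 0 :> C.
  by move=> x0; rewrite eq_complex /= negb_and x0.
have rn0 : r != 0 by rewrite gt_eqF.
have nrn0 : - r != 0 by rewrite oppr_eq0.
apply: le_trans (nrm_Im _); apply: le_trans (ler_norm _).
rewrite /rint; set u := fun x => _ - _; set v := fun y => _ - _.
have cu : cont_on (- r) r u.
  by apply: cont_onB; apply: cont_on_hor => x _; apply: cF; apply: neq0x.
have cv : cont_on (- r) r v.
  by apply: cont_onB; apply: cont_on_ver => x _; apply: cF; apply: neq0y.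
have bnd (g : R -> R) : (@lebesgue_measure R).-integrable `[(- r), r] (EFin \o g) ->
    (forall x, - r <= x <= r -> r^-1 <= g x) ->
    2 <= \int[@lebesgue_measure R]_(x in `[(- r), r]) g x.
  move=> Ig gr.
  have -> : 2 = \int[@lebesgue_measure R]_(x in `[(- r), r]) r^-1 :> R.
    rewrite Rintegral_cst //; rewrite (mu_itv r2); field.
    exact: rn0.
  apply: le_Rintegral => //.
  apply: continuous_compact_integrable; first exact: segment_compact.
  by move=> x; apply: cvg_cst.
have key (x : R) : - r <= x <= r -> r^-1 <= 2 * r / (x ^+ 2 + r ^+ 2).
  move=> /andP[h1 h2].
  have p0 : 0 < x ^+ 2 + r ^+ 2 by rewrite ltr_wpDl ?sqr_ge0 // exprn_gt0.
  rewrite ler_pdivlMr // mulrC ler_pdivrMr //; nra.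
have h1 : 2 <= \int[@lebesgue_measure R]_(x in `[(- r), r]) complex.Im (u x).
  apply: bnd; first exact: integrable_Im.
  move=> x hx; rewrite (le_trans (key x hx)) // /u /=.
  by rewrite sqrrN le_eqVlt; apply/orP; left; apply/eqP; ring.
have h2 : 2 <= \int[@lebesgue_measure R]_(x in `[(- r), r]) complex.Re (v x).
  apply: bnd; first exact: integrable_Re.
  move=> x hx; rewrite (le_trans (key x hx)) // /v /=.
  rewrite sqrrN le_eqVlt; apply/orP; left; apply/eqP.
  by rewrite [r ^+ 2 + _]addrC; ring.
rewrite /cint /= mul0r mul1r add0r.
lra.
Qed.

(** The function [h z = (F z - F 0 - l z) / z ^ 2] has the same integral along all
    squares centred at [0], by Goursat's theorem off the origin, and this integral
    tends to [0] with the square since [h z = o(1 / z)].  Hence [l] times the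
    integral of [1 / z] is the integral of [(F z - F 0) / z ^ 2], which is at most
    of the order of [M / r]. *)
Lemma cauchy_deriv (F : C -> C) (r M : R) (l : C) : 0 < r ->
  (forall z, nrm z <= 2 * r -> exists l, cdiff F z l) ->
  (forall z, nrm z <= 2 * r -> nrm (F z) <= M) ->
  cdiff F 0 l -> nrm l <= 8 * M / r.
Proof.
move=> r0 dF FM dF0.
pose h : C -> C := fun z => (F z - F 0 - l * z) / z ^+ 2.
have in2 (z : C) s : 0 <= s -> s <= r -> rect (- s) s (- s) s z -> nrm z <= 2 * r.
  move=> s0 sr [h1 h2]; rewrite (le_trans (nrm_le_ReIm _)) //.
  have : `|complex.Re z| <= s by rewrite ler_norml.
  have : `|complex.Im z| <= s by rewrite ler_norml.
  lra.
have dh (z : C) : nrm z <= 2 * r -> z != 0 -> exists l', cdiff h z l'.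
  move=> zr z0; have [l' /cdiff_differentiable dz] := dF z zr.
  exists ('d h z (1 : C)); apply: differentiable_cdiff.
  have d1 : differentiable (fun z : C => F z - F 0 - l * z) z.
    apply: differentiableB.
      by apply: differentiableB => //; exact: differentiable_cst.
    apply: differentiableM; first exact: differentiable_cst.
    exact: (@ex_diff _ _ _ _ _ _ _ (is_diff_id z)).
  have d2 : differentiable (fun z : C => (z ^+ 2)^-1) z.
    apply: (@differentiableV _ _ (fun z : C => z ^+ 2)); last by rewrite expf_neq0.
    have -> : (fun z : C => z ^+ 2) = (fun z : C => z * z) by apply/funext.
    by apply: differentiableM; exact: (@ex_diff _ _ _ _ _ _ _ (is_diff_id z)).
  exact: differentiableM d1 d2.
have ch (z : C) : nrm z <= 2 * r -> z != 0 -> ccont h z.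
  by move=> zr z0; have [l' /cdiff_ccont] := dh z zr z0.
have nz (x y : R) : x != 0 \/ y != 0 -> (x +i* y)%C != 0 :> C.
  by rewrite eq_complex /= negb_and => -[->|->]; rewrite ?orbT.
have bd0 s (z : C) : 0 < s -> rect_bd (- s) s (- s) s z -> s <= nrm z.
  move=> s0 [_ [] zs].
  - by rewrite (le_trans _ (nrm_Re _)) // zs normrN ler_norm.
  - by rewrite (le_trans _ (nrm_Re _)) // zs ler_norm.
  - by rewrite (le_trans _ (nrm_Im _)) // zs normrN ler_norm.
  - by rewrite (le_trans _ (nrm_Im _)) // zs ler_norm.
have bdn0 s (z : C) : 0 < s -> rect_bd (- s) s (- s) s z -> z != 0.
  move=> s0 /bd0-/(_ s0); apply: contraTneq => ->.
  by rewrite nrm0 -ltNge.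
have r0' : 0 <= r by rewrite ltW.
(* the eight outer rectangles of a 3 x 3 subdivision do not meet the origin *)
have shrink s : 0 < s -> s <= r ->
    rint h (- r) r (- r) r = rint h (- s) s (- s) s.
  move=> s0 sr.
  have zero x0 x1 y0 y1 : - r <= x0 -> x0 <= x1 -> x1 <= r ->
      - r <= y0 -> y0 <= y1 -> y1 <= r ->
      [\/ x1 < 0, 0 < x0, y1 < 0 | 0 < y0] -> rint h x0 x1 y0 y1 = 0.
    move=> a1 a2 a3 a4 a5 a6 a7; apply: goursat => // z zr.
    apply: dh; first by apply: (in2 z r) => //; apply: rect_sub zr.
    case: z zr => p t [/= /andP[k1 k2] /andP[k3 k4]].
    by apply: nz; case: a7 => a7; [left|left|right|right]; apply/eqP; lra.
  have cc (x y : R) : - r <= x <= r -> - r <= y <= r -> x != 0 \/ y != 0 ->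
      ccont h (x +i* y)%C.
    by move=> hx hy xy; apply: ch; [exact: (in2 _ r)|exact: nz].
  have sn0 : s != 0 by rewrite gt_eqF.
  have snn0 : - s != 0 by rewrite oppr_eq0.
  have rn0 : r != 0 by rewrite gt_eqF.
  have rnn0 : - r != 0 by rewrite oppr_eq0.
  have ccbd x0 x1 y0 y1 : - r <= x0 -> x0 <= x1 -> x1 <= r ->
      - r <= y0 -> y0 <= y1 -> y1 <= r -> x0 != 0 -> x1 != 0 -> y0 != 0 -> y1 != 0 ->
      forall z, rect_bd x0 x1 y0 y1 z -> ccont h z.
    move=> a1 a2 a3 a4 a5 a6 b1 b2 b3 b4 [p t] [[/= /andP[k1 k2] /andP[k3 k4]] k5].
    apply: cc; rewrite /=; [lra|lra|].
    by case: k5 => ->; [left|left|right|right].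
  have hs : - r <= - s <= r by apply/andP; split; lra.
  have hs' : - r <= s <= r by apply/andP; split; lra.
  rewrite (@rint_splitx _ _ _ _ _ _ _ _ _ (- s)) //; first last.
  - by move=> y hy; apply: cc => //; left.
  - by apply: ccbd => //; lra.
  - lra.
  - lra.
  rewrite (zero (- r) (- s) (- r) r); first last.
  - by constructor 1; lra.
  1-6: lra.
  rewrite add0r (@rint_splitx _ _ (- s) r _ _ _ _ _ s) //; first last.
  - by move=> y hy; apply: cc => //; left.
  - by apply/andP; split; lra.
  - by apply: ccbd => //; lra.
  - lra.
  - lra.
  rewrite (zero s r (- r) r); first last.
  - by constructor 2; lra.
  1-6: lra.
  rewrite addr0 (@rint_splity _ _ (- s) s _ _ _ _ _ (- s)) //; first last.
  - by move=> x hx; apply: cc; [lra|lra|right].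
  - by apply: ccbd => //; lra.
  - lra.
  - lra.
  rewrite (zero (- s) s (- r) (- s)); first last.
  - by constructor 3; lra.
  1-6: lra.
  rewrite add0r (@rint_splity _ _ (- s) s (- s) r _ _ _ s) //; first last.
  - by move=> x hx; apply: cc; [lra|lra|right].
  - by apply/andP; split; lra.
  - by apply: ccbd => //; lra.
  - lra.
  - lra.
  rewrite (zero (- s) s s r); first last.
  - by constructor 4; lra.
  1-6: lra.
  by rewrite addr0.
have h0 : rint h (- r) r (- r) r = 0.
  apply: nrm_eq0; apply/eqP; rewrite eq_le nrm_ge0 andbT.
  apply/ler_addgt0Pl => e e0; rewrite addr0.
  have e16 : 0 < e / 16 by rewrite divr_gt0.
  have [d d0 dP] := dF0 _ e16.
  pose s := Num.min r (d / 4).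
  have s0 : 0 < s by rewrite lt_min r0 divr_gt0.
  have sr : s <= r by rewrite ge_min lexx.
  have sd : s <= d / 4 by rewrite ge_min lexx orbT.
  rewrite (shrink s) //.
  have : nrm (rint h (- s) s (- s) s) <= 4 * (e / 16 / s) * ((s - - s) + (s - - s)).
    apply: rint_le; first lra.
    - lra.
    - move=> z hz; apply: ch; last exact: (bdn0 s).
      by apply: (in2 _ s) => //; [rewrite ltW|case: hz].
    move=> z hz; have zs := bd0 _ _ s0 hz.
    have zd : nrm (z - 0) < d.
      rewrite subr0 (le_lt_trans (nrm_le_ReIm _)) //; case: hz => -[k1 k2] _.
      have : `|complex.Re z| <= s by rewrite ler_norml.
      have : `|complex.Im z| <= s by rewrite ler_norml.
      lra.
    have := dP z zd; rewrite subr0 => k.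
    have z0 : 0 < nrm z by rewrite (lt_le_trans s0).
    rewrite /h nrmM nrmV nrmX ler_pdivrMr ?exprn_gt0 //.
    rewrite (le_trans k) //.
    have -> : e / 16 * nrm z = e / 16 / s * (s * nrm z) by field; rewrite gt_eqF.
    by rewrite ler_pM2l ?divr_gt0 // expr2 ler_pM2r.
  move=> /le_trans; apply; rewrite le_eqVlt; apply/orP; left; apply/eqP.
  by field; rewrite gt_eqF.
pose g : C -> C := fun z => (F z - F 0) / z ^+ 2.
have eqr (F1 F2 : C -> C) s : 0 < s -> (forall z, rect_bd (- s) s (- s) s z -> F1 z = F2 z) ->
    rint F1 (- s) s (- s) s = rint F2 (- s) s (- s) s.
  move=> s0 F12; have ss : - s <= s <= s by apply/andP; split; lra.
  have ss' : - s <= - s <= s by apply/andP; split; lra.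
  rewrite /rint; congr (_ + _ * _); apply: eq_cint => x hx; congr (_ - _); apply: F12;
    split => //=; by [constructor 1|constructor 2|constructor 3|constructor 4].
have bd2 z : rect_bd (- r) r (- r) r z -> nrm z <= 2 * r /\ z != 0.
  by move=> hz; split; [case: hz => + _; apply: in2|exact: bdn0 hz].
have cinv z : rect_bd (- r) r (- r) r z -> ccont (fun z : C => z^-1) z.
  move=> /bd2[_ z0]; apply: (@cdiff_ccont _ _ _ ('d (fun z : C => z^-1) z (1 : C))).
  by apply: differentiable_cdiff; apply: differentiable_Rinv.
have e1 : rint g (- r) r (- r) r = l * rint (fun z : C => z^-1) (- r) r (- r) r.
  rewrite -[RHS]addr0 -h0 -rint_linear //.
  - apply: eqr => // z /bd2[_ z0]; rewrite /g /h.
    by field.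
  - lra.
  - lra.
  - by move=> z /bd2[? ?]; exact: ch.
have : nrm (rint g (- r) r (- r) r) <= 4 * (2 * M / r ^+ 2) * ((r - - r) + (r - - r)).
  apply: rint_le; first lra.
  - lra.
  - move=> z hz; have [z2 z0] := bd2 z hz.
    apply: (@cdiff_ccont _ _ _ ('d g z (1 : C))); apply: differentiable_cdiff.
    have -> : g = (fun z => h z + l * z^-1) :> (C -> C).
      apply/funext => w; rewrite /g /h; have [->|w0] := eqVneq w 0.
        by rewrite expr0n /= invr0 !mulr0 addr0.
      by field.
    apply: differentiableD.
      by have [l' /cdiff_differentiable] := dh z z2 z0.
    apply: differentiableM; first exact: differentiable_cst.
    exact: differentiable_Rinv.
  - move=> z hz; have [z2 z0] := bd2 z hz; have zr := bd0 _ _ r0 hz.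
    have M0 : 0 <= M by rewrite (le_trans (nrm_ge0 (F z))) // FM.
    rewrite /g nrmM nrmV nrmX ler_pM ?nrm_ge0 ?invr_ge0 ?exprn_ge0 ?nrm_ge0 //.
      rewrite (le_trans (nrmB _ _)) // mulr_natl mulr2n lerD // FM // nrm0.
      lra.
    rewrite lef_pV2 ?posrE ?exprn_gt0 ?(lt_le_trans r0) //.
    by rewrite ler_pXn2r ?nnegrE ?nrm_ge0 // ltW.
rewrite e1 nrmM => k.
have k' := rint_inv_ge r0.
have : nrm l * 4 <= 4 * (2 * M / r ^+ 2) * (r - - r + (r - - r)).
  by apply: le_trans k; rewrite ler_wpM2l ?nrm_ge0.
have -> : 4 * (2 * M / r ^+ 2) * (r - - r + (r - - r)) = (8 * M / r) * 4.
  by field; rewrite gt_eqF.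
by rewrite ler_pM2r.
Qed.

End DifferentiableNrm.

(** * Row vectors: norm, compactness, mean value inequality *)

Section RowNorm.
Context {R : realType}.
Local Notation C := (R[i]^o).

Lemma nrm_coord m n (v : 'M[R[i]]_(m, n)) i j : nrm (v i j : C) <= nrm v.
Proof.
rewrite -lecR -!nrmE [leRHS]/Num.Def.normr /= mx_normE.
have -> : `|v i j| = (`|v i j|%:nng)%:num by [].
rewrite num_le.
exact: (le_bigmax _ (fun ij => `|v ij.1 ij.2|%:nng) (i, j)).
Qed.

Lemma nrm_mx_le m n (v : 'M[R[i]]_(m, n)) (B : R) : 0 <= B ->
  (forall i j, nrm (v i j : C) <= B) -> nrm v <= B.
Proof.
move=> B0 vB; rewrite -lecR -nrmE [leLHS]/Num.Def.normr /= mx_normE.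
have BC : 0 <= B%:C%C :> R[i] by rewrite ler0c.
rewrite [leRHS](_ : _ = (NngNum BC)%:num) // num_le.
by apply/bigmax_leP; split=> [|[i j] _]; rewrite -num_le //= nrmE lecR.
Qed.

Lemma nrm_sum (V : normedZmodType R[i]) (I : Type) (s : seq I) (F : I -> V) :
  nrm (\sum_(i <- s) F i) <= \sum_(i <- s) nrm (F i).
Proof.
elim: s => [|x s IH]; first by rewrite !big_nil nrm0.
by rewrite !big_cons (le_trans (nrmD _ _)) // lerD2l.
Qed.

Lemma nrm_mulmx m n (v : 'rV[R[i]]_m) (A : 'M[R[i]]_(m, n)) :
  nrm (v *m A) <= (\sum_k \sum_i nrm (A k i : C)) * nrm v.
Proof.
have A0 : 0 <= \sum_k \sum_i nrm (A k i : C).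
  by apply: sumr_ge0 => k _; apply: sumr_ge0 => i _; exact: nrm_ge0.
apply: nrm_mx_le; first by rewrite mulr_ge0 // nrm_ge0.
move=> i j; rewrite mxE (le_trans (nrm_sum _ _)) // mulr_suml.
apply: ler_sum => k _; rewrite nrmM mulrC ler_pM ?nrm_ge0 //.
  rewrite (bigD1 j) //= lerDl; apply: sumr_ge0 => ? _; exact: nrm_ge0.
exact: nrm_coord.
Qed.

Lemma mulmxr_continuous m n (A : 'M[R[i]]_(m, n)) :
  continuous (mulmxr A : 'rV[R[i]]_m -> 'rV[R[i]]_n).
Proof. by apply: nrm_lin_continuous => v /=; exact: nrm_mulmx. Qed.

(** Closed squares stand in for closed discs: they are products of segments. *)
Definition csquare (B : R) : set R[i] :=
  [set z | `|complex.Re z| <= B /\ `|complex.Im z| <= B].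

Lemma csquare_compact (B : R) : compact (csquare B).
Proof.
have -> : csquare B = (fun p : R * R => (p.1 +i* p.2)%C) @`
    (`[- B, B]%classic `*` `[- B, B]%classic).
  apply/seteqP; split=> [z [h1 h2]|_ [[x y] [/= h1 h2] <-]].
    by exists (complex.Re z, complex.Im z); [split; rewrite /= in_itv /= -ler_norml|case: (z)].
  by move: h1 h2; rewrite !in_itv /= -!ler_norml.
apply: continuous_compact; last by apply: compact_setX; exact: segment_compact.
apply: continuous_subspaceT => -[x y].
apply/(@cvg_nrmP R C) => e e0.
have e2 : 0 < e / 2 by rewrite divr_gt0.
have c1 : \forall p \near nbhs (x, y), `|x - p.1| < e / 2.
  have h : (fun p : R * R => p.1) @ nbhs (x, y) --> x by exact: cvg_fst.
  by move/cvgrPdist_lt : h => /(_ _ e2).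
have c2 : \forall p \near nbhs (x, y), `|y - p.2| < e / 2.
  have h : (fun p : R * R => p.2) @ nbhs (x, y) --> y by exact: cvg_snd.
  by move/cvgrPdist_lt : h => /(_ _ e2).
near=> p; rewrite (le_lt_trans (nrm_le_ReIm _)) // ReB ImB /= [ltRHS]splitr.
by apply: ltrD; rewrite distrC; near: p.
Unshelve. all: by end_near. Qed.

Lemma ball_rV_compact m (a : 'rV[R[i]]_m) (B : R) :
  compact [set v : 'rV[R[i]]_m | nrm (v - a) <= B].
Proof.
have cB : compact [set v : 'rV[R[i]]_m | forall i, csquare (nrm a + `|B|) (v ord0 i)].
  by apply: (@rV_compact R[i] m (fun=> csquare (nrm a + `|B|))) => i; exact: csquare_compact.
apply: subclosed_compact cB _.
- have -> : [set v : 'rV[R[i]]_m | nrm (v - a) <= B] =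
    ~` [set v | B < nrm (v - a)].
    by apply/seteqP; split => v /=; rewrite leNgt => /negP.
  apply: open_closedC; rewrite openE => v /= vB.
  apply/nbhs_nrmP; exists (nrm (v - a) - B); first by rewrite subr_gt0.
  move=> w wv /=; have := nrm_dist_trans w v a.
  by rewrite (nrm_distC v w); lra.
- move=> v /= va i; have : nrm (v ord0 i : C) <= nrm a + `|B|.
    rewrite (le_trans (nrm_coord _ _ _)) // -[v](subrK a) addrC.
    by rewrite (le_trans (nrmD _ _)) // lerD2l (le_trans va) // ler_norm.
  by move=> h; split; [exact: le_trans (nrm_Re _) h|exact: le_trans (nrm_Im _) h].
Qed.

Lemma bounded_seq_cluster m (u : nat -> 'rV[R[i]]_m) (B : R) :
  (forall j, nrm (u j) <= B) ->
  exists x, forall e : R, 0 < e -> forall N, exists2 j, (N <= j)%N & nrm (u j - x) < e.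
Proof.
move=> uB; have := @ball_rV_compact m 0 B (u @ \oo).
case=> [|x [_ cx]].
  by exists 0%N => // j _ /=; rewrite subr0.
exists x => e e0 N.
have [||y [[j /= Nj <-] yx]] := cx [set u j | j in [set j | (N <= j)%N]]
    [set v | nrm (v - x) < e].
- by exists N => // j /= Nj; exists j.
- by apply/nbhs_nrmP; exists e.
- by exists j.
Qed.

Lemma geometric_seq_limit m (u : nat -> 'rV[R[i]]_m) (c : R) : 0 <= c ->
  (forall k, nrm (u k.+1 - u k) <= c * 2^-1 ^+ k) ->
  exists x, forall k, nrm (u k - x) <= 2 * c * 2^-1 ^+ k.
Proof.
move=> c0 uc; pose q k : R := 2^-1 ^+ k.
have q0 k : 0 < q k by rewrite exprn_gt0 ?invr_gt0.
have qS k : q k = 2 * q k.+1.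
  by rewrite /q exprS mulrA divff ?mul1r // pnatr_eq0.
have ukj k j : nrm (u k - u (k + j)%N) <= 2 * c * (q k - q (k + j)%N).
  elim: j => [|j IH]; first by rewrite addn0 !subrr nrm0 mulr0.
  rewrite (le_trans (nrm_dist_trans (u (k + j)%N) _ _)) // addnS.
  have := uc (k + j)%N; rewrite -/(q _) (nrm_distC (u (k + j).+1)).
  move: IH; rewrite (qS (k + j)%N). lra.
have [j|x xP] := @bounded_seq_cluster m u (nrm (u 0%N) + 2 * c).
  have := ukj 0%N j; rewrite add0n => h.
  rewrite -[u j](subrK (u 0%N)) addrC (le_trans (nrmD _ _)) // lerD2l nrm_distC.
  rewrite (le_trans h) // -[leRHS]mulr1 ler_wpM2l ?mulr_ge0 //.
  by rewrite /q expr0 lerBlDr lerDl ltW.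
exists x => k; apply/ler_addgt0Pl => e e0.
have [j kj uj] := xP e e0 k.
rewrite (le_trans (nrm_dist_trans (u j) _ _)) // addrC lerD //; first exact: ltW.
have := ukj k (j - k)%N; rewrite subnKC // => /le_trans; apply.
by rewrite ler_wpM2l ?mulr_ge0 // lerBlDr lerDl ltW.
Qed.

(** If the increment over [[0, 1]] exceeded [B + e], bisection would give nested
    segments with increments of slope above [B + e], against the local bound at
    their common point. *)
Lemma mean_value (W : normedModType R[i]) (phi : R -> W) (B : R) :
  (forall t, 0 <= t <= 1 -> forall e : R, 0 < e -> exists2 d : R, 0 < d &
     forall s, 0 <= s <= 1 -> `|s - t| < d -> nrm (phi s - phi t) <= (B + e) * `|s - t|) ->
  nrm (phi 1 - phi 0) <= B.
Proof.
move=> dphi; apply/ler_addgt0Pl => e e0; rewrite (addrC e) leNgt; apply/negP => big.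
pose q n : R := 2^-1 ^+ n.
have q0 n : 0 < q n by rewrite exprn_gt0 ?invr_gt0.
have qS n : q n = 2 * q n.+1.
  by rewrite /q exprS mulrA divff ?mul1r // pnatr_eq0.
pose good (s : nat * R) := [/\ 0 <= s.2, s.2 + q s.1 <= 1 &
  (B + e) * q s.1 < nrm (phi (s.2 + q s.1) - phi s.2)].
have step (s : nat * R) : exists p : R, good s -> good (s.1.+1, p) /\
    (s.2 <= p /\ p + q s.1.+1 <= s.2 + q s.1).
  case: s => n x; have [[/= h1 h2 h3]|ng] := pselect (good (n, x)); last first.
    by exists 0 => /ng.
  have qn := q0 n.+1; rewrite qS in h2 h3 *.
  have [hl|hr] := ltP ((B + e) * q n.+1) (nrm (phi (x + q n.+1) - phi x)).
    exists x => _; split; [split => //=|split => //]; rewrite /=; lra.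
  exists (x + q n.+1) => _.
  have -> : x + q n.+1 + q n.+1 = x + 2 * q n.+1 by ring.
  split; [split => //=|split => //=]; try lra.
  have -> : x + q n.+1 + q n.+1 = x + 2 * q n.+1 by ring.
  have := nrm_dist_trans (phi (x + q n.+1)) (phi (x + 2 * q n.+1)) (phi x); lra.
have [f fP] := choice step.
pose p := fix p n := if n is k.+1 then f (k, p k) else 0.
have pG n : good (n, p n).
  elim: n => [|n IH]; last by have [] := fP _ IH.
  by split; rewrite /q /= ?expr0 ?add0r ?mulr1 ?lexx.
have pN n : p n <= p n.+1 /\ p n.+1 + q n.+1 <= p n + q n.
  by have [_] := fP _ (pG n).
have [t tP] : exists t, forall n, p n <= t <= p n + q n.
  apply: nested_segments => n; [by have [] := pN n|by have [] := pN n|].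
  by rewrite lerDl ltW.
have t01 : 0 <= t <= 1 by have := tP 0%N; rewrite /= /q expr0 add0r.
have [d d0 dP] := dphi t t01 e e0.
have [n nP] := half_pow_small d0.
have [/= h1 h2 h3] := pG n; have /andP[t1 t2] := tP n.
have qn := q0 n; rewrite -/(q n) in nP.
have k1 : nrm (phi (p n + q n) - phi t) <= (B + e) * (p n + q n - t).
  have := dP (p n + q n); rewrite ger0_norm ?subr_ge0 //; apply; lra.
have k2 : nrm (phi (p n) - phi t) <= (B + e) * (t - p n).
  have := dP (p n); rewrite distrC ger0_norm ?subr_ge0 //; apply; lra.
have := nrm_dist_trans (phi t) (phi (p n + q n)) (phi (p n)).
rewrite [X in _ <= _ + X]nrm_distC; lra.
Qed.

End RowNorm.

(** * Cauchy estimates and strict derivatives *)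

Section ZmodIdentities.
Variable W : zmodType.
Implicit Types x y z t u : W.

Lemma second_diffE x y z : x - y - (y - z) = x - z - ((y - z) + (y - z)).
Proof.
have -> : x - y = (x - z) - (y - z) by rewrite opprB addrA subrK.
by rewrite -addrA -opprD.
Qed.

Lemma subrACA x y t u : (x - t) - (y - u) = (x - y) - (t - u).
Proof. by rewrite !opprD !opprK addrACA. Qed.

Lemma remainder_diffE x y z t u : (x - z - t) - (y - z - u) = x - y - (t - u).
Proof. by rewrite subrACA opprB addrA subrK. Qed.

End ZmodIdentities.

Section CauchyEstimates.
Context {R : realType} {V : normedModType R[i]}.
Local Notation C := (R[i]^o).

Definition hol_bounded (W : normedModType R[i]) (f : V -> W) (a : V) (r M : R) :=
  forall u, nrm (u - a) < r -> differentiable f u /\ nrm (f u) <= M.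

Lemma line_cdiff (f : V -> C) (u v : V) (t : C) : differentiable f (u + t *: v) ->
  cdiff (fun s : C => f (u + s *: v)) t ('d f (u + t *: v) v).
Proof.
move=> df e e0; have v1 : 0 < nrm v + 1 by rewrite ltr_wpDl // nrm_ge0.
have e1 : 0 < e / (nrm v + 1) by rewrite divr_gt0.
have [d d0 dP] := diff_nrm df e1.
exists (d / (nrm v + 1)); first by rewrite divr_gt0.
move=> s st; have E : u + s *: v - (u + t *: v) = (s - t) *: v.
  by rewrite opprD addrACA subrr add0r scalerBl.
have h : nrm ((s - t) *: v) <= nrm (s - t) * (nrm v + 1).
  by rewrite nrmZ ler_wpM2l ?nrm_ge0 // lerDl.
have := dP (u + s *: v); rewrite E linearZ /= => k.
rewrite [_ * (s - t)]mulrC (le_trans (k _)) //.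
  by rewrite (le_lt_trans h) // -ltr_pdivlMr.
rewrite (@le_trans _ _ (e / (nrm v + 1) * (nrm (s - t) * (nrm v + 1)))) //.
  by rewrite ler_pM2l.
by rewrite le_eqVlt; apply/orP; left; apply/eqP; field; rewrite gt_eqF.
Qed.

(** Restriction to the complex line through [a] in the direction [v]. *)
Lemma cauchy_diff (f : V -> C) (a : V) (r M : R) : 0 < r ->
  hol_bounded f a r M -> forall v, nrm ('d f a v) <= 32 * M / r * nrm v.
Proof.
move=> r0 hf v.
have [v0|v0] := eqVneq (nrm v) 0.
  by rewrite (nrm_eq0 v0) linear0 !nrm0 mulr0.
have {}v0 : 0 < nrm v by rewrite lt_def v0 nrm_ge0.
have lineB (z : C) : nrm z <= 2 * (r / (4 * nrm v)) -> nrm (a + z *: v - a) < r.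
  rewrite addrAC subrr add0r nrmZ => hz.
  rewrite (@le_lt_trans _ _ (2 * (r / (4 * nrm v)) * nrm v)) ?ler_pM2r //.
  have -> : 2 * (r / (4 * nrm v)) * nrm v = r / 2 by field; rewrite gt_eqF.
  lra.
have := @cauchy_deriv R (fun s : C => f (a + s *: v)) (r / (4 * nrm v)) M ('d f a v).
have -> : 8 * M / (r / (4 * nrm v)) = 32 * M / r * nrm v.
  by field; rewrite !gt_eqF.
apply.
- by rewrite divr_gt0 // mulr_gt0.
- move=> z /lineB/hf[dz _]; exists ('d f (a + z *: v) v); exact: line_cdiff.
- by move=> z /lineB/hf[].
- have := @line_cdiff f a v 0; rewrite scale0r addr0; apply.
  by have [] := hf a; rewrite ?subrr ?nrm0.
Qed.

Lemma hol_bounded_sub (W : normedModType R[i]) (f : V -> W) (a b : V) (r s M : R) :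
  nrm (b - a) + s <= r -> hol_bounded f a r M -> hol_bounded f b s M.
Proof.
move=> bs hf u ub; apply: hf; rewrite (le_lt_trans (nrm_dist_trans b _ _)) //; lra.
Qed.

Lemma cauchy_lip_scalar (f : V -> C) (a : V) (r M : R) : 0 < r -> hol_bounded f a r M ->
  forall u w, nrm (u - a) < r / 2 -> nrm (w - a) < r / 2 ->
  nrm (f u - f w) <= 64 * M / r * nrm (u - w).
Proof.
move=> r0 hf u w ua wa.
have r2 : 0 < r / 2 by rewrite divr_gt0.
pose phi (t : R) : C := f (w + t%:C%C *: (u - w)).
have -> : f u = phi 1 by rewrite /phi scale1r addrC subrK.
have -> : f w = phi 0 by rewrite /phi scale0r addr0.
apply: mean_value => t /andP[t0 t1] e e0.
pose x := w + t%:C%C *: (u - w).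
have xa : nrm (x - a) < r / 2.
  have -> : x - a = (1 - t)%:C%C *: (w - a) + t%:C%C *: (u - a).
    rewrite rmorphB rmorph1 scalerBl scale1r /x.
    have -> : u - w = (u - a) - (w - a) by rewrite opprB addrA subrK.
    by rewrite scalerBr addrAC addrCA addrC.
  rewrite (le_lt_trans (nrmD _ _)) // !nrmZ !nrmC ger0_norm ?subr_ge0 // ger0_norm //.
  have [->|t0'] := eqVneq t 0; first by rewrite subr0 mul1r mul0r addr0.
  have tp : 0 < t by rewrite lt_def t0'.
  have t1' : 0 <= 1 - t by rewrite subr_ge0.
  have k1 : (1 - t) * nrm (w - a) <= (1 - t) * (r / 2) by rewrite ler_wpM2l // ltW.
  have k2 : t * nrm (u - a) < t * (r / 2) by rewrite ltr_pM2l.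
  lra.
have hx : hol_bounded f x (r / 2) M by apply: hol_bounded_sub hf; lra.
have [dx _] : differentiable f x /\ nrm (f x) <= M.
  by apply: hx; rewrite subrr nrm0.
have [d d0 dP] := line_cdiff dx e0.
exists d => // s _ st.
have := dP s%:C%C; rewrite -rmorphB nrmC => /(_ st) k.
have dB : nrm ('d f x (u - w)) <= 64 * M / r * nrm (u - w).
  have := cauchy_diff r2 hx (u - w).
  have -> : 32 * M / (r / 2) = 64 * M / r by field; rewrite gt_eqF.
  by [].
rewrite -/(phi s) -/(phi t) in k.
rewrite -[phi s - phi t](subrK ('d f x (u - w) * (s - t)%:C%C)).
rewrite (le_trans (nrmD _ _)) // addrC mulrDl lerD //.
by rewrite nrmM nrmC ler_wpM2r.
Qed.

(** The Lipschitz estimate is taken as a hypothesis: it holds for scalar functions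
    by the mean value inequality, and then for row vectors coordinate by
    coordinate. *)
Section Taylor.
Variable W : normedModType R[i].
Hypothesis lipW : forall (f : V -> W) (a : V) (r M : R), 0 < r -> hol_bounded f a r M ->
  forall u w, nrm (u - a) < r / 2 -> nrm (w - a) < r / 2 ->
  nrm (f u - f w) <= 64 * M / r * nrm (u - w).

Lemma shift_differentiable (f : V -> W) (u b : V) :
  differentiable f (u + b) -> differentiable (fun x => f (x + b)) u.
Proof.
by move=> df; apply: (@differentiable_comp _ _ _ _ (fun x => x + b) f).
Qed.

(** Second differences are first differences of first differences, so the
    Lipschitz estimate applied twice bounds them. *)
Let second_difference (f : V -> W) (a : V) (r M : R) : 0 < r -> hol_bounded f a r M ->
  forall v, nrm v < r / 8 ->
  nrm (f (a + v + v) - f (a + v) - (f (a + v) - f a)) <= (64 * 64 * 4) * M / r ^+ 2 * nrm v ^+ 2.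
Proof.
move=> r0 hf v vr; pose F x := f (x + v) - f x.
have r4 : 0 < r / 4 by rewrite divr_gt0.
have v0 := nrm_ge0 v.
have hF : hol_bounded F a (r / 4) (64 * M / r * nrm v).
  move=> u ua; have uva : nrm (u + v - a) < r / 2.
    by rewrite addrAC (le_lt_trans (nrmD _ _)) //; lra.
  split.
    apply: differentiableB; last by have [|] := hf u; first lra.
    by apply: shift_differentiable; have [|] := hf (u + v); first lra.
  have := lipW r0 hf uva; rewrite /F => /(_ u).
  by rewrite addrAC subrr add0r; apply; lra.
have := lipW r4 hF (u := a + v) (w := a).
rewrite /F addrAC subrr add0r nrm0.
have -> : 64 * (64 * M / r * nrm v) / (r / 4) * nrm v = (64 * 64 * 4) * M / r ^+ 2 * nrm v ^+ 2.
  by field; rewrite gt_eqF.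
by apply; lra.
Qed.

(** A function whose second differences at [a] are quadratically small has a
    quadratically small first-order remainder: halve the increment and sum. *)
Lemma taylor2 (f : V -> W) (a : V) (r M : R) : 0 < r -> hol_bounded f a r M ->
  forall v, nrm v < r / 8 ->
  nrm (f (a + v) - f a - 'd f a v) <= (64 * 64 * 2) * M / r ^+ 2 * nrm v ^+ 2.
Proof.
move=> r0 hf v vr; pose Q := (64 * 64 * 4) * M / r ^+ 2.
have M0 : 0 <= M.
  by have [] := hf a; rewrite ?subrr ?nrm0 // => _; exact: le_trans (nrm_ge0 _).
have Q0 : 0 <= Q by apply: divr_ge0; [rewrite !mulr_ge0|apply: exprn_ge0; rewrite ltW].
have -> : (64 * 64 * 2) * M / r ^+ 2 = Q / 2 by rewrite /Q; field; rewrite gt_eqF.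
pose q k : R := 2^-1 ^+ k.
have q0 k : 0 < q k by rewrite exprn_gt0 ?invr_gt0.
have qS k : q k = 2 * q k.+1.
  by rewrite /q exprS mulrA divff ?mul1r // pnatr_eq0.
pose D (x : V) : W := f (a + x) - f a.
pose w k := (q k)%:C%C *: v.
have wS k : w k = w k.+1 + w k.+1.
  by rewrite /w -scalerDl -rmorphD; congr (_%:C%C *: _); rewrite qS; ring.
have nw k : nrm (w k) = q k * nrm v by rewrite nrmZ nrmC ger0_norm // ltW.
have q1 k : q k <= 1 by rewrite exprn_ile1 // ?invr_ge0 // invf_le1 // ler1n.
pose p k : R := 2 ^+ k.
have p0 k : 0 < p k by rewrite exprn_gt0.
have pq k : p k * q k = 1 by rewrite /p /q exprVn divff // expf_neq0 // pnatr_eq0.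
have tele k : nrm (D v - (p k)%:C%C *: D (w k)) <= Q / 2 * nrm v ^+ 2 * (1 - q k).
  elim: k => [|k IH].
    by rewrite /p /q /w /q !expr0 !scale1r !subrr nrm0 mulr0.
  rewrite (le_trans (nrm_dist_trans ((p k)%:C%C *: D (w k)) _ _)) //.
  have pS : p k.+1 = p k * 2 by rewrite /p exprSr.
  rewrite pS rmorphM -scalerA -scalerBr nrmZ nrmC ger0_norm ?(ltW (p0 k)) //.
  have wr : nrm (w k.+1) < r / 8.
    rewrite nw (le_lt_trans _ vr) // -[leRHS]mul1r ler_wpM2r ?nrm_ge0 //.
  have := second_difference r0 hf wr.
  have -> : f (a + w k.+1 + w k.+1) - f (a + w k.+1) - (f (a + w k.+1) - f a) =
      D (w k) - 2%:C%C *: D (w k.+1).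
    rewrite rmorph_nat scaler_nat mulr2n /D (wS k) addrA.
    exact: second_diffE.
  rewrite -/Q nw => h2.
  have h3 : p k * nrm (D (w k) - 2%:C%C *: D (w k.+1)) <=
      p k * (Q * (q k.+1 * nrm v) ^+ 2) by rewrite ler_pM2l.
  have h4 : p k * (Q * (q k.+1 * nrm v) ^+ 2) = Q / 2 * nrm v ^+ 2 * (q k.+1).
    have -> : p k * (Q * (q k.+1 * nrm v) ^+ 2) =
       (p k * (2 * q k.+1)) * (Q / 2 * nrm v ^+ 2 * q k.+1) by field.
    by rewrite -qS pq mul1r.
  rewrite (qS k) in IH; lra.
apply/ler_addgt0Pl => e e0.
have v1 : 0 < nrm v + 1 by rewrite ltr_wpDl // nrm_ge0.
have [da _] : differentiable f a /\ nrm (f a) <= M by apply: hf; rewrite subrr nrm0.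
have [d d0 dP] := diff_nrm da (divr_gt0 e0 v1).
have [k kP] := half_pow_small (divr_gt0 d0 v1).
have wk : nrm (a + w k - a) < d.
  rewrite addrAC subrr add0r nw -/(q k) (@le_lt_trans _ _ (q k * (nrm v + 1))) //.
    by rewrite ler_pM2l // lerDl.
  by rewrite -ltr_pdivlMr.
have aw : a + w k - a = w k by rewrite addrC addKr.
have := dP _ wk; rewrite aw -/(D _) => h.
rewrite (le_trans (nrm_dist_trans ((p k)%:C%C *: D (w k)) _ _)) // addrC lerD //.
  have -> : 'd f a v = (p k)%:C%C *: 'd f a (w k).
    by rewrite /w linearZ /= scalerA -rmorphM pq scale1r.
  rewrite -scalerBr nrmZ nrmC ger0_norm ?(ltW (p0 k)) //.
  rewrite (@le_trans _ _ (p k * (e / (nrm v + 1) * nrm (w k)))) ?ler_pM2l // nw.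
  have -> : p k * (e / (nrm v + 1) * (q k * nrm v)) =
    (p k * q k) * (e * (nrm v / (nrm v + 1))) by field; rewrite gt_eqF.
  rewrite pq mul1r -[leRHS]mulr1 ler_pM2l // ler_pdivrMr // mul1r lerDl //.
rewrite (le_trans (tele k)) // -[leRHS]mulr1 ler_wpM2l //.
  by rewrite mulr_ge0 ?exprn_ge0 ?nrm_ge0 // divr_ge0.
by rewrite lerBlDr lerDl ltW.
Qed.

(** The first-order remainder is of order [s ^ 2] on the ball of radius [2 s] by
    [taylor2], so the Lipschitz estimate gives it a Lipschitz constant of order
    [s]. *)
Lemma strict_bounded (f : V -> W) (a : V) (r M s : R) : 0 < r -> hol_bounded f a r M ->
  continuous ('d f a) ->
  0 < s -> 2 * s <= r / 8 -> forall x y, nrm (x - a) < s -> nrm (y - a) < s ->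
  nrm (f x - f y - 'd f a (x - y)) <= 64 * (64 * 64 * 4) * M / r ^+ 2 * s * nrm (x - y).
Proof.
move=> r0 hf cL s0 sr x y xs ys.
pose F u := f u - f a - 'd f a (u - a).
have dlin u : differentiable (fun u => 'd f a (u - a)) u.
  apply: (@differentiable_comp _ _ _ _ (fun x => x - a) ('d f a)).
    by apply: differentiableB.
  exact: linear_differentiable.
have hF : hol_bounded F a (2 * s) ((64 * 64 * 2) * M / r ^+ 2 * (2 * s) ^+ 2).
  move=> u ua; split.
    apply: differentiableB => //; apply: differentiableB => //.
    by have [|] := hf u; first lra.
  have ur : nrm (u - a) < r / 8 by lra.
  have := taylor2 r0 hf ur; rewrite [a + _]addrC subrK => /le_trans; apply.
  apply: ler_wpM2l.
    have M0 : 0 <= M.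
      by have [] := hf a; rewrite ?subrr ?nrm0 // => _; exact: le_trans (nrm_ge0 _).
    by apply: divr_ge0; [rewrite !mulr_ge0|apply: exprn_ge0; rewrite ltW].
  by rewrite ler_pXn2r ?nnegrE ?nrm_ge0 //; lra.
have s2 : 0 < 2 * s by lra.
have := lipW s2 hF (u := x) (w := y).
have -> : 64 * ((64 * 64 * 2) * M / r ^+ 2 * (2 * s) ^+ 2) / (2 * s) * nrm (x - y) =
   64 * (64 * 64 * 4) * M / r ^+ 2 * s * nrm (x - y).
  by field; rewrite !gt_eqF.
have -> : F x - F y = f x - f y - 'd f a (x - y).
  have -> : x - y = (x - a) - (y - a) by rewrite opprB addrA subrK.
  by rewrite (linearB ('d f a)) /F remainder_diffE.
by apply; lra.
Qed.

(** The quantity [nrm (x - a) + nrm (y - a)] is a radius adapted to the two points: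
    [strict_bounded] is used with twice this value as [s]. *)
Lemma strict_local (f : V -> W) (a : V) : (\forall u \near a, differentiable f u) ->
  exists K r : R, [/\ 0 <= K, 0 < r & forall x y, nrm (x - a) < r -> nrm (y - a) < r ->
    nrm (f x - f y - 'd f a (x - y)) <= K * (nrm (x - a) + nrm (y - a)) * nrm (x - y)].
Proof.
move=> df; have da := nbhs_singleton df.
have ca := differentiable_continuous da.
have /cvg_nrmP /(_ _ ltr01) /nbhs_nrmP [r1 r10 r1P] := ca.
have /nbhs_nrmP[r2 r20 r2P] := df.
pose r := Num.min r1 r2.
have r0 : 0 < r by rewrite lt_min r10.
have hf : hol_bounded f a r (nrm (f a) + 1).
  move=> u; rewrite lt_min => /andP[/r1P h1 /r2P h2]; split=> //.
  rewrite -(subrK (f a) (f u)) addrC (le_trans (nrmD _ _)) // lerD2l.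
  exact: ltW.
pose K := 64 * (64 * 64 * 4) * (nrm (f a) + 1) / r ^+ 2 * 2.
have K0 : 0 <= K.
  apply: mulr_ge0 => //; apply: divr_ge0; last by apply: exprn_ge0; rewrite ltW.
  by rewrite !mulr_ge0 // addr_ge0 ?nrm_ge0.
exists K, (r / 64); split=> //; first by rewrite divr_gt0.
move=> x y xa ya.
have [s0|s0] := eqVneq (nrm (x - a) + nrm (y - a)) 0.
  have := nrm_ge0 (x - a); have := nrm_ge0 (y - a) => h1 h2.
  have xE : x - a = 0 by apply: nrm_eq0; lra.
  have yE : y - a = 0 by apply: nrm_eq0; lra.
  have -> : x = y by rewrite -(subrK a x) xE -(subrK a y) yE.
  by rewrite !subrr linear0 subrr !nrm0 mulr0.
have h1 := nrm_ge0 (x - a); have h2 := nrm_ge0 (y - a).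
have {}s0 : 0 < nrm (x - a) + nrm (y - a) by rewrite lt_def s0 addr_ge0.
have cL : continuous ('d f a) by exact: diff_continuous.
have := @strict_bounded f a r _ (2 * (nrm (x - a) + nrm (y - a))) r0 hf cL.
rewrite -/K; have -> : 64 * (64 * 64 * 4) * (nrm (f a) + 1) / r ^+ 2 *
   (2 * (nrm (x - a) + nrm (y - a))) = K * (nrm (x - a) + nrm (y - a)).
  by rewrite /K; ring.
by apply; lra.
Qed.

End Taylor.

Lemma coord_differentiable n (f : V -> 'rV[R[i]]_n) u (j : 'I_n) :
  differentiable f u -> differentiable (fun x => f x ord0 j : C) u.
Proof.
move=> df; apply: (@differentiable_comp _ _ _ _ f (fun v => v ord0 j : C)) => //.
exact: differentiable_coord.
Qed.

Lemma hol_bounded_coord n (f : V -> 'rV[R[i]]_n) a r M (j : 'I_n) :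
  hol_bounded f a r M -> hol_bounded (fun x => f x ord0 j : C) a r M.
Proof.
move=> hf u /hf[du fu]; split; first exact: coord_differentiable.
by rewrite (le_trans _ fu) // nrm_coord.
Qed.

Lemma cauchy_lip n (f : V -> 'rV[R[i]]_n) (a : V) (r M : R) : 0 < r ->
  hol_bounded f a r M ->
  forall u w, nrm (u - a) < r / 2 -> nrm (w - a) < r / 2 ->
  nrm (f u - f w) <= 64 * M / r * nrm (u - w).
Proof.
move=> r0 hf u w ua wa.
have M0 : 0 <= M.
  by have [] := hf a; rewrite ?subrr ?nrm0 // => _; exact: le_trans (nrm_ge0 _).
apply: nrm_mx_le.
  by rewrite mulr_ge0 ?nrm_ge0 // divr_ge0 ?mulr_ge0 // ltW.
move=> i j; rewrite (ord1 i) !mxE.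
exact: (cauchy_lip_scalar r0 (hol_bounded_coord j hf)).
Qed.

End CauchyEstimates.

(** * Weierstrass's theorem for bounded sequences *)

Section Weierstrass.
Context {R : realType}.
Local Notation C := (R[i]^o).

(** Every holomorphic map has a strict derivative with an explicit modulus; this is
    how products in Lie groups are controlled. *)
Lemma strict_rV (V : normedModType R[i]) n (f : V -> 'rV[R[i]]_n) (a : V) :
  (\forall u \near a, differentiable f u) ->
  exists K r : R, [/\ 0 <= K, 0 < r & forall x y, nrm (x - a) < r -> nrm (y - a) < r ->
    nrm (f x - f y - 'd f a (x - y)) <= K * (nrm (x - a) + nrm (y - a)) * nrm (x - y)].
Proof. by apply: strict_local; exact: cauchy_lip. Qed.

(** The gradients of a locally bounded sequence have a cluster point [L], and the
    quadratic remainder estimate, which is uniform in the sequence, passes to the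
    limit along it. *)
Lemma weierstrass_scalar m (f_ : nat -> 'rV[R[i]]_m -> C) (f : 'rV[R[i]]_m -> C) a (r M : R) :
  0 < r -> (forall j, hol_bounded (f_ j) a r M) ->
  (forall u, nrm (u - a) < r -> forall e : R, 0 < e ->
     exists N, forall j, (N <= j)%N -> nrm (f_ j u - f u) < e) ->
  exists L : 'cV[R[i]]_m, forall v, nrm v < r / 8 ->
    nrm (f (a + v) - f a - (v *m L) ord0 ord0) <= 64 * 64 * 2 * M / r ^+ 2 * nrm v ^+ 2.
Proof.
move=> r0 hf fcv.
pose g j : 'rV[R[i]]_m := \row_k 'd (f_ j) a (delta_mx ord0 k).
have dE j v : 'd (f_ j) a v = (v *m (g j)^T) ord0 ord0.
  rewrite [v in LHS]row_sum_delta linear_sum mxE; apply: eq_bigr => k _.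
  by rewrite linearZ !mxE.
have [j|L LP] := @bounded_seq_cluster R m g (`|32 * M / r|).
  apply: nrm_mx_le => // i k; rewrite mxE.
  rewrite (le_trans (cauchy_diff r0 (hf j) _)) // -[leRHS]mulr1.
  rewrite (le_trans (ler_norm _)) // normrM ler_wpM2l // ger0_norm ?nrm_ge0 //.
  apply: nrm_mx_le => // p q; rewrite mxE.
  by case: (_ && _); rewrite ?nrm1 ?nrm0.
exists L^T => v vr; apply/ler_addgt0Pl => e e0.
have r8 : r / 8 <= r by lra.
have e3 : 0 < e / 3 by rewrite divr_gt0.
have [|N1 N1P] := fcv (a + v) _ _ e3.
  by rewrite addrC addKr (lt_le_trans vr).
have [|N2 N2P] := fcv a _ _ e3; first by rewrite subrr nrm0.
have m1 : 0 < nrm v * m%:R + 1 by rewrite ltr_wpDl // mulr_ge0 ?nrm_ge0.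
have [j jN jL] := LP _ (divr_gt0 e3 m1) (maxn N1 N2).
rewrite geq_max in jN; case/andP: jN => /N1P h1 /N2P h2.
have h3 := taylor2 (@cauchy_lip_scalar _ _) r0 (hf j) vr.
have h4 : nrm ((v *m (g j)^T) ord0 ord0 - (v *m L^T) ord0 ord0 : C) <= e / 3.
  have -> : (v *m (g j)^T) ord0 ord0 - (v *m L^T) ord0 ord0 =
     \sum_k v ord0 k * (g j - L) ord0 k.
    rewrite !mxE -sumrB; apply: eq_bigr => k _.
    by rewrite !mxE mulrBr.
  rewrite (le_trans (nrm_sum _ _)) //.
  rewrite (@le_trans _ _ (\sum_(k < m) nrm v * (e / 3 / (nrm v * m%:R + 1)))) //.
    apply: ler_sum => k _; rewrite nrmM ler_pM ?nrm_ge0 ?nrm_coord //.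
    by rewrite (le_trans (nrm_coord _ _ _)) // ltW.
  rewrite sumr_const card_ord -[leLHS]mulr_natr.
  have -> : nrm v * (e / 3 / (nrm v * m%:R + 1)) * m%:R =
    e / 3 * (nrm v * m%:R / (nrm v * m%:R + 1)) by field; rewrite gt_eqF.
  by rewrite -[leRHS]mulr1 ler_pM2l // ler_pdivrMr // mul1r lerDl.
rewrite -dE in h4.
have -> : f (a + v) - f a - (v *m L^T) ord0 ord0 =
  (f_ j (a + v) - f_ j a - 'd (f_ j) a v) - (f_ j (a + v) - f (a + v)) +
  (f_ j a - f a) + ('d (f_ j) a v - (v *m L^T) ord0 ord0) :> C by ring.
rewrite (le_trans (nrmD _ _)) // (le_trans (lerD (nrmD _ _) (lexx _))) //.
rewrite (le_trans (lerD (lerD (nrmB _ _) (lexx _)) (lexx _))) //.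
lra.
Qed.

Lemma weierstrass m n (f_ : nat -> 'rV[R[i]]_m -> 'rV[R[i]]_n)
    (f : 'rV[R[i]]_m -> 'rV[R[i]]_n) a (r M : R) :
  0 < r -> (forall j, hol_bounded (f_ j) a r M) ->
  (forall u, nrm (u - a) < r -> forall e : R, 0 < e ->
     exists N, forall j, (N <= j)%N -> nrm (f_ j u - f u) < e) ->
  differentiable f a.
Proof.
move=> r0 hf fcv; pose Q := 64 * 64 * 2 * M / r ^+ 2.
have M0 : 0 <= M.
  by have [] := hf 0%N a; rewrite ?subrr ?nrm0 // => _; exact: le_trans (nrm_ge0 _).
have Q0 : 0 <= Q by apply: divr_ge0; [rewrite !mulr_ge0|apply: exprn_ge0; rewrite ltW].
have [L LP] : exists L : 'I_n -> 'cV[R[i]]_m, forall i v, nrm v < r / 8 ->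
    nrm (f (a + v) ord0 i - f a ord0 i - (v *m L i) ord0 ord0 : C) <= Q * nrm v ^+ 2.
  suff H i : exists L : 'cV[R[i]]_m, forall v, nrm v < r / 8 ->
    nrm (f (a + v) ord0 i - f a ord0 i - (v *m L) ord0 ord0 : C) <= Q * nrm v ^+ 2.
    by have [L LP] := choice H; exists L.
  apply: (@weierstrass_scalar m (fun j u => f_ j u ord0 i) (fun u => f u ord0 i) a r M r0).
    by move=> j; exact: hol_bounded_coord.
  move=> u ur e e0; have [N NP] := fcv u ur e e0.
  exists N => j /NP; apply: le_lt_trans.
  by have := nrm_coord (f_ j u - f u) ord0 i; rewrite !mxE.
pose A : 'M[R[i]]_(m, n) := \matrix_(k, i) L i k ord0.
apply: (proj1 (@nrm_diff R _ _ f a (mulmxr A) (@mulmxr_continuous _ _ _ A) _)).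
move=> e e0; have Q1 : 0 < Q + 1 by rewrite ltr_wpDl.
exists (Num.min (r / 8) (e / (Q + 1))); first by rewrite lt_min !divr_gt0.
move=> x; rewrite lt_min => /andP[x8 xe].
have h : Q * nrm (x - a) ^+ 2 <= e * nrm (x - a).
  rewrite expr2 mulrA ler_wpM2r ?nrm_ge0 //.
  rewrite (@le_trans _ _ ((Q + 1) * nrm (x - a))) //.
    by rewrite ler_wpM2r ?nrm_ge0 // lerDl.
  by rewrite mulrC -ler_pdivlMr // ltW.
apply: nrm_mx_le => [|i j]; first by rewrite mulr_ge0 ?nrm_ge0 // ltW.
rewrite (le_trans _ h) // (ord1 i).
have := LP j (x - a) x8; rewrite [a + _]addrC subrK.
rewrite (_ : (f x - f a - mulmxr A (x - a)) ord0 j =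
  f x ord0 j - f a ord0 j - ((x - a) *m L j) ord0 ord0) //.
by rewrite !mxE; congr (_ - _); apply: eq_bigr => k _; rewrite !mxE.
Qed.

End Weierstrass.

(** * Distances and oscillation of maps into a compact manifold *)

Lemma ultra_limit (T : Type) (Y : topologicalType) (U : set_system T) (f : T -> Y) :
  UltraFilter U -> compact [set: Y] -> exists y : Y, f @ U --> y.
Proof.
move=> UU cY; have [|y [_ cy]] := cY (f @ U) _; first exact: filterT.
exists y => A Ay; have [//|nA] := in_ultra_setVsetC (f @^-1` A) UU.
have fnA : (f @ U) (~` A) by [].
by have [z []] := cy _ _ fnA Ay.
Qed.

Section Distance.
Context {R : realType} (Y : topologicalType) (d : Y -> Y -> R).
Hypothesis dd : is_distance d.

Lemma dist_refl x : d x x = 0.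
Proof. by case: dd => d0 _ _ _; apply/d0. Qed.

Lemma dist_sym x y : d x y = d y x.
Proof. by case: dd. Qed.

Lemma dist_trans y x z : d x z <= d x y + d y z.
Proof. by case: dd. Qed.

Lemma dist_ge0 x y : 0 <= d x y.
Proof. by have := dist_trans y x x; rewrite dist_refl (dist_sym y x); lra. Qed.

Lemma dist_nbhs x (P : set Y) :
  nbhs x P <-> exists2 e : R, 0 < e & forall y, d x y < e -> P y.
Proof.
case: dd => _ _ _ ->; split.
- by case=> e /= e0 eP; exists e.
- by case=> e e0 eP; exists e.
Qed.

Lemma dist_cvg (T : Type) (F : set_system T) (FF : Filter F) (f : T -> Y) x :
  f @ F --> x <-> forall e : R, 0 < e -> \forall t \near F, d x (f t) < e.
Proof.
split=> [fx e e0|fx A /dist_nbhs[e e0 eA]].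
- by apply: (fx [set y | d x y < e]); apply/dist_nbhs; exists e.
- by apply: filterS (fx e e0) => t; exact: eA.
Qed.

End Distance.

Section ChartedTarget.
Context {R : realType} {n : nat} {N : complexManifoldType R n}.

(** Differentiability is required in every chart that contains the value, so that
    a chart can be kept fixed while [u] and the map vary. *)
Definition hol_into (V : normedModType R[i]) (F : V -> N) (u : V) :=
  {for u, continuous F} /\
  forall y : N, chart_dom (chart_at y) (F u) -> differentiable (chart_at y \o F) u.

Lemma hol_into_comp (V W : normedModType R[i]) (F : V -> N) (h : W -> V) (w : W) :
  differentiable h w -> hol_into F (h w) -> hol_into (F \o h) w.
Proof.
move=> dh [cF dF]; split.
  by apply: continuous_comp cF; exact: differentiable_continuous.
move=> y hy; apply: (@differentiable_comp _ _ _ _ h (chart_at y \o F)) => //.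
exact: dF.
Qed.

Variable d : N -> N -> R.
Hypothesis dd : is_distance d.
Hypothesis cN : compact [set: N].

Let dsym := dist_sym dd.
Let dtri := dist_trans dd.

Lemma chart_near (x y : N) (e : R) : chart_dom (chart_at x) y -> 0 < e ->
  exists2 del : R, 0 < del & forall b, d y b < del ->
    chart_dom (chart_at x) b /\ nrm (chart_at x b - chart_at x y) < e.
Proof.
move=> xy e0.
have h1 : nbhs y (chart_dom (chart_at x)).
  by apply: open_nbhs_nbhs; split=> //; exact: chart_dom_open.
have /cvg_nrmP/(_ e e0) h2 := @chart_map_continuous _ _ _ (chart_at x) y xy.
by case: (proj1 (dist_nbhs dd _ _) (filterI h1 h2)) => del d0 dP; exists del.
Qed.

Lemma chart_inv_near (x y : N) (e : R) : chart_dom (chart_at x) y -> 0 < e ->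
  exists2 eta : R, 0 < eta & forall b, chart_dom (chart_at x) b ->
    nrm (chart_at x b - chart_at x y) < eta -> d y b < e.
Proof.
move=> xy e0.
have ci := @chart_inv_continuous _ _ _ (chart_at x) _ (chart_map_img xy).
have /(ci _)/nbhs_nrmP[eta eta0 etaP] : nbhs (chart_inv (chart_at x) (chart_at x y))
    [set b | d y b < e].
  by rewrite chart_mapK //; apply/(dist_nbhs dd); exists e.
by exists eta => // b xb /etaP /=; rewrite chart_mapK.
Qed.

Lemma near_pos_ex (P : R -> Prop) (e : R) : 0 < e -> (\forall t \near (0 : R)^'+, P t) ->
  exists t, [/\ 0 < t, t < e & P t].
Proof.
move=> e0 nP; have /filter_ex[t [[h1 h2] h3]] :
    \forall t \near (0 : R)^'+, ((0 < t /\ t < e) /\ P t).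
  apply: filterI => //; apply: filterI; [exact: nbhs_right_gt|exact: nbhs_right_lt].
by exists t.
Qed.

(** A Lebesgue number of the atlas of the compact manifold, for the coordinate
    balls of radius [1]. *)
Lemma chart_lebesgue : exists2 del : R, 0 < del & forall y, exists x, forall b,
  d y b < del -> chart_dom (chart_at x) b /\ nrm (chart_at x b - chart_at x x) < 1.
Proof.
pose P (t : R) (y : N) := exists x, forall b, d y b < t ->
  chart_dom (chart_at x) b /\ nrm (chart_at x b - chart_at x x) < 1.
have H : \forall t \near (0 : R)^'+, [set: N] `<=` P t.
  apply: (proj1 (compact_near_coveringP _) cN) => y _.
  have [e e0 eP] := @chart_near y y 1 (chart_at_dom y) ltr01.
  have e2 : 0 < e / 2 by rewrite divr_gt0.
  have h1 : \forall y' \near y, d y y' < e / 2.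
    by apply/(dist_nbhs dd); exists (e / 2).
  have h2 : \forall t \near (0 : R)^'+, t < e / 2 by exact: nbhs_right_lt.
  exists ([set y' | d y y' < e / 2], [set t | t < e / 2]) => //.
  move=> [y' t] /= [yy' te]; exists y => b y'b; apply: eP.
  by rewrite (le_lt_trans (dtri y' _ _)) //; lra.
have [t [t0 _ tP]] := near_pos_ex ltr01 H.
by exists t => // y; apply: tP.
Qed.

(** Maps of a ball whose oscillation is below the Lebesgue number of the atlas
    take values in one chart, where the Cauchy estimates apply; compactness of
    the target makes the resulting modulus of continuity uniform. *)
Lemma oscillation_control : exists2 del : R, 0 < del &
  forall e : R, 0 < e -> exists tau : R, [/\ 0 < tau, tau < 1 &
    forall (V : normedModType R[i]) (F : V -> N) (u : V) (r : R), 0 < r ->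
      (forall v, nrm (v - u) < r -> hol_into F v /\ d (F u) (F v) < del) ->
      forall v, nrm (v - u) < tau * r -> d (F u) (F v) < e].
Proof.
have sum2 (a b s : R) : a < s / 2 -> b < s / 2 -> a + b < s by lra.
have le_half (a : R) : a < 1 / 2 -> a <= 2^-1 by lra.
have lt_twice (a s : R) : 0 < s -> a < s / 2 -> a < s by lra.
have le_64 (a s : R) : a < s / 128 -> 64 * a <= s / 2 by lra.
have [del0 del00 delP] := chart_lebesgue.
pose del := del0 / 2; have del_gt0 : 0 < del by rewrite divr_gt0.
exists del => // e e0.
pose P (tau : R) (y : N) := forall (V : normedModType R[i]) (F : V -> N) (u : V) (r : R),
  0 < r -> F u = y ->
  (forall v, nrm (v - u) < r -> hol_into F v /\ d (F u) (F v) < del) ->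
  forall v, nrm (v - u) < tau * r -> d (F u) (F v) < e.
suff H : \forall tau \near (0 : R)^'+, [set: N] `<=` P tau.
  have [tau [t0 t1 tP]] := near_pos_ex ltr01 H; exists tau; split=> //.
  by move=> V F u r r0 hF; exact: (tP (F u) I V F u r r0 erefl hF).
apply: (proj1 (compact_near_coveringP _) cN) => y _.
have [x xP] := delP y.
have [yx _] := xP y (eq_ind_r (fun t => t < del0) del00 (dist_refl dd y)).
have e2 : 0 < e / 2 by rewrite divr_gt0.
have [eta eta0 etaP] := chart_inv_near yx e2.
have eta2 : 0 < eta / 2 by rewrite divr_gt0.
have [s s0 sP] := chart_near yx eta2.
pose s' := Num.min s (Num.min del (e / 2)).
have s'0 : 0 < s' by rewrite !lt_min s0 del_gt0.
pose t' := Num.min (1 / 2) (eta / 128).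
have t'0 : 0 < t' by rewrite lt_min !divr_gt0.
have h1 : \forall y' \near y, d y y' < s' by apply/(dist_nbhs dd); exists s'.
have h2 : \forall t \near (0 : R)^'+, t < t' by exact: nbhs_right_lt.
exists ([set y' | d y y' < s'], [set t | t < t']) => //.
move=> [y' tau] /= []; rewrite !lt_min => /and3P[ys yd ye] /andP[tau2 taue].
move=> V F u r r0 Fu hF v vu.
have [tau0|tau0] := leP tau 0.
  have : nrm (v - u) < 0 by rewrite (lt_le_trans vu) // mulr_le0_ge0 // ltW.
  by rewrite ltNge nrm_ge0.
have inx w : nrm (w - u) < r ->
    chart_dom (chart_at x) (F w) /\ nrm (chart_at x (F w) - chart_at x x) < 1.
  move=> /hF[_ dw]; apply: xP; rewrite (le_lt_trans (dtri y' _ _)) //.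
  by move: dw; rewrite Fu => dw; exact: sum2 yd dw.
pose f w := chart_at x (F w) - chart_at x x.
have hf : hol_bounded f u r 1.
  move=> w wr; have [xw w1] := inx w wr; split; last exact: ltW.
  apply: differentiableB; last exact: differentiable_cst.
  by have [[_ /(_ x xw)]] := hF w wr.
have vr2 : nrm (v - u) < r / 2.
  by rewrite (lt_le_trans vu) // mulrC ler_pM2l //; exact: le_half.
have := @cauchy_lip R V n f u r 1 r0 hf v u vr2.
rewrite subrr nrm0 divr_gt0 // => /(_ isT) lip.
have [xv _] : chart_dom (chart_at x) (F v) /\ nrm (chart_at x (F v) - chart_at x x) < 1.
  by apply: inx; exact: lt_twice.
have k1 : nrm (chart_at x (F v) - chart_at x (F u)) < eta / 2.
  have -> : chart_at x (F v) - chart_at x (F u) = f v - f u.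
    by rewrite /f subrACA subrr subr0.
  rewrite (le_lt_trans lip) // mulr1.
  rewrite (@lt_le_trans _ _ (64 / r * (tau * r))) ?ltr_pM2l ?divr_gt0 //.
  have -> : 64 / r * (tau * r) = 64 * tau by field; rewrite gt_eqF.
  exact: le_64.
have [_ k2] := sP y' ys; rewrite -Fu in k2.
have k3 : d y (F v) < e / 2.
  apply: etaP => //; rewrite (le_lt_trans (nrm_dist_trans (chart_at x (F u)) _ _)) //.
  exact: sum2.
apply: le_lt_trans (dtri y _ _) _; rewrite dsym Fu; exact: sum2.
Qed.

End ChartedTarget.

(** * Zalcman's rescaling *)

Section Zalcman.
Context {R : realType} {m n : nat} {N : complexManifoldType R n}.
Variable d : N -> N -> R.
Hypothesis dd : is_distance d.
Hypothesis cN : compact [set: N].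
Local Notation V := ('rV[R[i]]_m).

Let dsym := dist_sym dd.
Let dtri := dist_trans dd.

(** The largest calm radius takes the place of the inverse of the derivative at [u]
    in Zalcman's lemma. *)
Definition calm (osc : R) (F : V -> N) (u : V) (r : R) :=
  forall v, nrm (v - u) <= r -> d (F u) (F v) <= osc.

Lemma calm_uniform (osc rho : R) (F : V -> N) (u0 : V) : 0 < osc ->
  (forall u, nrm (u - u0) <= rho -> {for u, continuous F}) ->
  exists2 s : R, 0 < s & forall u, nrm (u - u0) <= rho -> calm osc F u s.
Proof.
move=> osc0 cF.
have H : \forall s \near (0 : R)^'+, [set u | nrm (u - u0) <= rho] `<=` (fun u => calm osc F u s).
  apply: (proj1 (compact_near_coveringP _) (@ball_rV_compact _ _ u0 rho)) => u /cF cu.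
  have osc2 : 0 < osc / 2 by rewrite divr_gt0.
  have /nbhs_nrmP[e e0 eP] : nbhs u [set v | d (F u) (F v) < osc / 2].
    by apply: (cu [set y | d (F u) y < osc / 2]); apply/(dist_nbhs dd); exists (osc / 2).
  have e2 : 0 < e / 2 by rewrite divr_gt0.
  have h1 : \forall u' \near u, nrm (u' - u) < e / 2 by apply/nbhs_nrmP; exists (e / 2).
  have h2 : \forall t \near (0 : R)^'+, t < e / 2 by exact: nbhs_right_lt.
  exists ([set u' | nrm (u' - u) < e / 2], [set t | t < e / 2]) => //.
  move=> [u' t] /= [uu te] v vu'.
  have k1 : d (F u) (F u') < osc / 2 by apply: eP; lra.
  have k2 : d (F u) (F v) < osc / 2.
    by apply: eP; rewrite (le_lt_trans (nrm_dist_trans u' _ _)) //; lra.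
  by rewrite (le_trans (dtri (F u) _ _)) // (dsym (F u')); lra.
have [s [s0 _ sP]] := near_pos_ex ltr01 H.
by exists s.
Qed.

(** Otherwise one could move repeatedly to a point whose scale is half as
    large, staying in a fixed ball, against the continuity of [F]. *)
Lemma doubling (osc A r1 rho : R) (F : V -> N) (u0 : V) : 0 < osc -> 0 <= A -> 0 < r1 ->
  2 * A * r1 <= rho ->
  (forall u, nrm (u - u0) <= rho -> {for u, continuous F}) ->
  ~ calm osc F u0 r1 ->
  exists u r, [/\ 0 < r, r <= r1, nrm (u - u0) <= 2 * A * r1, ~ calm osc F u r &
    forall v, nrm (v - u) <= A * r -> calm osc F v (r / 2)].
Proof.
move=> osc0 A0 r10 Ar cF nc.
have [s s0 sP] := calm_uniform osc0 cF.
apply: contrapT => nodoubling.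
pose q k : R := 2^-1 ^+ k.
have q0 k : 0 < q k by rewrite exprn_gt0 ?invr_gt0.
have qS k : q k = 2 * q k.+1.
  by rewrite /q exprS mulrA divff ?mul1r // pnatr_eq0.
have q1 k : q k <= 1 by rewrite exprn_ile1 // ?invr_ge0 // invf_le1 // ler1n.
have Ar0 : 0 <= 2 * A * r1 by rewrite !mulr_ge0 // ltW.
have step k : exists u, nrm (u - u0) <= 2 * A * r1 * (1 - q k) /\ ~ calm osc F u (r1 * q k).
  elim: k => [|k [u [uu0 nu]]].
    by exists u0; rewrite subrr nrm0 /q expr0 subrr mulr0 mulr1.
  have [v [vu nv]] : exists v, nrm (v - u) <= A * (r1 * q k) /\
      ~ calm osc F v (r1 * q k / 2).
    apply: contrapT => nv; apply: nodoubling; exists u, (r1 * q k); split=> //.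
    - by rewrite mulr_gt0.
    - by rewrite -[leRHS]mulr1 ler_pM2l.
    - rewrite (le_trans uu0) // -[leRHS]mulr1 ler_wpM2l // lerBlDr lerDl.
      exact: ltW.
    - move=> v vu; apply: contrapT => nvc; apply: nv; by exists v.
  exists v; split; last first.
    by have -> : r1 * q k.+1 = r1 * q k / 2 by rewrite (qS k); field.
  rewrite (le_trans (nrm_dist_trans u _ _)) //.
  move: uu0 vu; rewrite (qS k) => h1 h2.
  have -> : 2 * A * r1 * (1 - q k.+1) = A * (r1 * (2 * q k.+1)) +
     2 * A * r1 * (1 - 2 * q k.+1) by ring.
  exact: lerD.
have [k kP] := half_pow_small (divr_gt0 s0 r10).
have [u [uu0]] := step k; apply=> v vu.
apply: sP.
  rewrite (le_trans uu0) // (le_trans _ Ar) // -[leRHS]mulr1 ler_wpM2l //.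
  rewrite lerBlDr lerDl; exact: ltW.
rewrite (le_trans vu) // mulrC -ler_pdivlMr //; exact: ltW.
Qed.

Section Rescaling.
Variables (I : Type) (F_ : I -> V -> N) (u0 : V) (rho : R).
Hypothesis rho0 : 0 < rho.
Hypothesis hF : forall k u, nrm (u - u0) < rho -> hol_into (F_ k) u.
Hypothesis notequi : exists2 e : R, 0 < e & forall tau : R, 0 < tau ->
  exists k x, nrm (x - u0) < tau /\ e <= d (F_ k u0) (F_ k x).

Let g_ (k_ : nat -> I) (u_ : nat -> V) (r_ : nat -> R) j w :=
  F_ (k_ j) (u_ j + (r_ j)%:C%C *: w).

(** At every scale some map is not calm at [u0], otherwise
    [oscillation_control] would make them equicontinuous there.  Moving to the
    points given by [doubling] and dilating by the scale found, the maps become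
    calm with radius [1 / 2] on large balls, hence equicontinuous there, but not
    calm with radius [1] at the origin. *)
Lemma rescale : exists (k_ : nat -> I) (u_ : nat -> V) (r_ : nat -> R) (osc : R),
  [/\ 0 < osc,
    forall j, [/\ 0 < r_ j, r_ j <= rho / j.+1%:R, nrm (u_ j - u0) <= rho / j.+1%:R &
      forall w, nrm w <= j.+1%:R -> nrm (u_ j + (r_ j)%:C%C *: w - u0) < rho],
    forall e : R, 0 < e -> exists2 tau : R, 0 < tau & forall j w w',
      nrm w <= j.+1%:R -> nrm (w' - w) < tau -> d (g_ k_ u_ r_ j w) (g_ k_ u_ r_ j w') < e &
    forall j, exists w, nrm w <= 1 /\ osc < d (g_ k_ u_ r_ j 0) (g_ k_ u_ r_ j w)].
Proof.
have [del del0 delP] := oscillation_control dd cN.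
pose osc := del / 2; have osc0 : 0 < osc by rewrite divr_gt0.
have bad r : 0 < r -> r < rho -> exists k, ~ calm osc (F_ k) u0 r.
  move=> r0 rr; apply: contrapT => allcalm.
  have [e e0 eP] := notequi.
  have [tau [t0 t1 tP]] := delP e e0.
  have [|k [x [xt ex]]] := eP (tau * r); first by rewrite mulr_gt0.
  have : d (F_ k u0) (F_ k x) < e.
    apply: (tP _ (F_ k) u0 r r0 _ x xt) => v vr; split; first by apply: hF; lra.
    have kc : calm osc (F_ k) u0 r by apply: contrapT => nk; apply: allcalm; exists k.
    by have := kc v (ltW vr); rewrite /osc; lra.
  by rewrite ltNge ex.
pose J (j : nat) : R := j.+1%:R.
have J1 j : 1 <= J j by rewrite ler1n.
have J0 j : 0 < J j by rewrite (lt_le_trans ltr01).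
(* small enough for the doubling points and the balls of radius [j + 1] around
   them, after rescaling, to stay within [rho] *)
pose r1 j := rho / (8 * J j ^+ 2).
have r10 j : 0 < r1 j by rewrite divr_gt0 // mulr_gt0 // exprn_gt0.
have r1E j : 2 * J j * r1 j = rho / J j / 4.
  by rewrite /r1; field; rewrite gt_eqF.
have rJ j : 0 < rho / J j by rewrite divr_gt0.
have rJ1 j : rho / J j <= rho by rewrite ler_pdivrMr // ler_peMr // ltW.
have r1le j : r1 j <= rho / J j / 8.
  have -> : rho / J j / 8 = J j * r1 j by rewrite /r1; field; rewrite gt_eqF.
  by rewrite ler_peMl // ltW.
have sel j : exists p : I * V * R, let: (k, u, r) := p in
    [/\ 0 < r, r <= r1 j, nrm (u - u0) <= rho / J j / 4, ~ calm osc (F_ k) u r &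
      forall v, nrm (v - u) <= J j * r -> calm osc (F_ k) v (r / 2)].
  have [|k nk] := bad (r1 j) (r10 j).
    by move: (r1le j) (rJ1 j) (rJ j); move: (rho / J j) => X; lra.
  have [|u [r [h1 h2 h3 h4 h5]]] := doubling osc0 (ltW (J0 j)) (r10 j) (lexx _) _ nk.
    move=> u; rewrite r1E => hu.
    have [] // : hol_into (F_ k) u.
    by apply: hF; move: (rJ1 j) (rJ j) hu; move: (rho / J j) => X; lra.
  by exists (k, u, r); split; rewrite // -r1E.
have [s sP] := choice sel.
pose k_ j := (s j).1.1; pose u_ j := (s j).1.2; pose r_ j := (s j).2.
have sP' j : [/\ 0 < r_ j, r_ j <= r1 j, nrm (u_ j - u0) <= rho / J j / 4,
    ~ calm osc (F_ (k_ j)) (u_ j) (r_ j) &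
      forall v, nrm (v - u_ j) <= J j * r_ j -> calm osc (F_ (k_ j)) v (r_ j / 2)].
  by have := sP j; rewrite /k_ /u_ /r_; case: (s j) => [[]].
have rnrm j (w : V) : nrm ((r_ j)%:C%C *: w) = r_ j * nrm w.
  by have [h _ _ _ _] := sP' j; rewrite nrmZ nrmC ger0_norm // ltW.
have inb j w : nrm w <= 2 * J j -> nrm (u_ j + (r_ j)%:C%C *: w - u0) < rho.
  have [h1 h2 h3 _ _] := sP' j => wJ.
  rewrite addrAC (le_lt_trans (nrmD _ _)) // rnrm.
  have : r_ j * nrm w <= r1 j * (2 * J j) by apply: ler_pM => //; [exact: ltW|exact: nrm_ge0].
  by move: (r1E j) (rJ j) (rJ1 j) h3; move: (rho / J j) => X; lra.
have aff j (w : V) : differentiable (fun w : V => u_ j + (r_ j)%:C%C *: w) w.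
  apply: differentiableD; first exact: differentiable_cst.
  by apply: (@differentiableZ _ _ _ idfun).
exists k_, u_, r_, osc; split=> //.
- move=> j; have [h1 h2 h3 _ _] := sP' j; have := r1le j; have := rJ j => h4 h5.
  split=> //; rewrite -?/(J j); try (by move: h2 h3 h4 h5; move: (rho / J j) => X; lra).
  by move=> w wj; apply: inb; rewrite (le_trans wj) // -/(J j); have := J0 j; lra.
- move=> e e0; have [tau [t0 t1 tP]] := delP e e0.
  exists (tau * (1 / 2)); first by rewrite mulr_gt0.
  move=> j w w' wj; have [h1 h2 h3 _ h5] := sP' j.
  apply: (tP _ (g_ k_ u_ r_ j) w (1 / 2)) => // v vw; split.
    apply: (@hol_into_comp _ _ _ _ _ (F_ (k_ j)) (fun w : V => u_ j + (r_ j)%:C%C *: w)).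
      exact: aff.
    apply: hF; apply: inb; rewrite -[v](subrK w) (le_trans (nrmD _ _)) //.
    by move: wj; rewrite -/(J j); have := J1 j; lra.
  suff : d (g_ k_ u_ r_ j w) (g_ k_ u_ r_ j v) <= osc by rewrite /osc; lra.
  apply: h5; rewrite /g_.
    by rewrite addrC addKr rnrm mulrC ler_pM2r.
  rewrite opprD addrACA subrr add0r -scalerBr rnrm ler_pM2l //.
  by move: vw; lra.
- move=> j; have [h1 h2 h3 h4 _] := sP' j.
  have [v [v1 v2]] : exists v, nrm (v - u_ j) <= r_ j /\ osc < d (F_ (k_ j) (u_ j)) (F_ (k_ j) v).
    apply: contrapT => nv; apply: h4 => v vr; rewrite leNgt; apply/negP => ov.
    by apply: nv; exists v.
  have rn0 : (r_ j)%:C%C != 0 :> R[i] by rewrite eq_complex /= eqxx andbT gt_eqF.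
  exists ((r_ j)%:C%C^-1 *: (v - u_ j)); split.
    rewrite nrmZ nrmV nrmC ger0_norm ?(ltW h1) // mulrC ler_pdivrMr //.
    by rewrite mul1r.
  by rewrite /g_ scaler0 addr0 scalerA divff // scale1r addrC subrK.
Qed.

End Rescaling.

End Zalcman.

Section ZalcmanLimit.
Context {R : realType} {m n : nat} {N : complexManifoldType R n}.
Variable d : N -> N -> R.
Hypothesis dd : is_distance d.
Hypothesis cN : compact [set: N].
Local Notation V := ('rV[R[i]]_m).

Let dsym := dist_sym dd.
Let dtri := dist_trans dd.

Lemma nat_above (B : R) : exists k, forall j, (k <= j)%N -> B <= j%:R.
Proof.
have [k _ kP] := @nbhs_infty_ger R B; exists k => j kj; exact: kP.
Qed.

Lemma nat_inv_small (e : R) : 0 < e -> exists k, forall j, (k <= j)%N -> j.+1%:R^-1 < e.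
Proof.
move=> e0; have [k kP] := nat_above e^-1; exists k => j /kP je.
rewrite -[e]invrK ltf_pV2 ?posrE ?invr_gt0 ?ltr0Sn //.
by rewrite (le_lt_trans je) // ltr_nat.
Qed.

(** A diagonal form of Ascoli's theorem, for maps whose domains of control exhaust
    the space.  The limit is taken pointwise along an ultrafilter; compactness of
    balls then yields an index good on the [k]-th ball for each [k]. *)
Lemma equicontinuous_limit (g_ : nat -> V -> N) :
  (forall e : R, 0 < e -> exists2 tau : R, 0 < tau & forall j w w',
      nrm w <= j.+1%:R -> nrm (w' - w) < tau -> d (g_ j w) (g_ j w') < e) ->
  exists (h : V -> N) (j_ : nat -> nat),
  [/\ forall k, (k <= j_ k)%N,
    forall k w, nrm w <= k%:R -> d (h w) (g_ (j_ k) w) < k.+1%:R^-1 &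
    forall e : R, 0 < e -> exists2 tau : R, 0 < tau &
      forall w w', nrm (w' - w) < tau -> d (h w) (h w') < e].
Proof.
move=> equi; have [U [UU infU]] := ultraFilterLemma (eventually_filter : ProperFilter \oo).
have PU : ProperFilter U by exact: ultra_proper.
have [h hP] := choice (fun w => ultra_limit (g_ ^~ w) UU cN).
have hU w (e : R) : 0 < e -> U [set j | d (h w) (g_ j w) < e].
  by move=> e0; exact: (proj1 (dist_cvg dd _ (fun j => g_ j w) (h w)) (hP w) e e0).
have Uge (B : R) : U [set j | B <= j.+1%:R].
  have [k kP] := nat_above B; apply: infU; exists k => // j /= kj.
  by rewrite (le_trans (kP j kj)) // ler_nat.
have hUC (e : R) : 0 < e -> exists2 tau : R, 0 < tau &
    forall w w', nrm (w' - w) < tau -> d (h w) (h w') < e.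
  move=> e0; have e3 : 0 < e / 3 by rewrite divr_gt0.
  have [tau tau0 tP] := equi _ e3; exists tau => // w w' ww.
  have [j [[j1 j2] j3]] := filter_ex (filterI (filterI (hU w _ e3) (hU w' _ e3)) (Uge (nrm w))).
  have := tP j w w' j3 ww => k.
  rewrite (le_lt_trans (dtri (g_ j w) _ _)) //.
  have := dtri (g_ j w') (g_ j w) (h w'); rewrite (dsym (g_ j w') (h w')).
  move: j1 j2 => /=; lra.
have sel k : exists j, (k <= j)%N /\ forall w, nrm w <= k%:R -> d (h w) (g_ j w) < k.+1%:R^-1.
  pose e : R := k.+1%:R^-1; have e0 : 0 < e by rewrite invr_gt0 ltr0Sn.
  have e3 : 0 < e / 3 by rewrite divr_gt0.
  have H : U [set j | [set w : V | nrm (w - 0) <= k%:R] `<=` (fun w => d (h w) (g_ j w) < e)].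
    apply: (proj1 (compact_near_coveringP _) (@ball_rV_compact _ _ (0 : V) k%:R)) => w _.
    have [t1 t10 t1P] := equi _ e3; have [t2 t20 t2P] := hUC _ e3.
    have h1 : \forall w' \near w, nrm (w' - w) < Num.min t1 t2.
      by apply/nbhs_nrmP; exists (Num.min t1 t2) => //; rewrite lt_min t10.
    have h2 := filterI (hU w _ e3) (Uge (nrm w)).
    exists ([set w' | nrm (w' - w) < Num.min t1 t2],
      [set j | d (h w) (g_ j w) < e / 3] `&` [set j | nrm w <= j.+1%:R]).
      by split; [exact: h1|exact: h2].
    move=> [w' j] /= [+ [j1 j2]]; rewrite lt_min => /andP[w1 w2].
    have := t1P _ _ _ j2 w1; have := t2P _ _ w2 => k1 k2.
    rewrite (le_lt_trans (dtri (h w) _ _)) // (dsym (h w')).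
    have := dtri (g_ j w) (h w) (g_ j w'); lra.
  have Uk : U [set j | (k <= j)%N] by apply: infU; exists k.
  have [j [j1 j2]] := filter_ex (filterI H Uk).
  by exists j; split=> // w wk; apply: j1; rewrite /= subr0.
have [j_ jP] := choice sel.
by exists h, j_; split=> // k; have [] := jP k.
Qed.

(** Equicontinuity keeps the values near [w0] in one chart, where Weierstrass's
    theorem applies. *)
Lemma hol_into_limit (g_ : nat -> V -> N) (h : V -> N) (w0 : V) :
  (forall e : R, 0 < e -> exists2 tau : R, 0 < tau & \forall j \near \oo, forall w,
     nrm (w - w0) < tau -> d (g_ j w0) (g_ j w) < e) ->
  (exists2 s : R, 0 < s & \forall j \near \oo, forall w, nrm (w - w0) < s -> hol_into (g_ j) w) ->
  (exists2 s : R, 0 < s & forall w, nrm (w - w0) < s -> forall e : R, 0 < e ->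
     \forall j \near \oo, d (h w) (g_ j w) < e) ->
  {for w0, continuous h} -> hol_into h w0.
Proof.
move=> equi [s1 s10 hol] [s2 s20 cvg] ch; split=> // y yh.
have [del del0 delP] := chart_near dd yh ltr01.
have del2 : 0 < del / 2 by rewrite divr_gt0.
have [t t0 tP] := equi _ del2.
have /nbhs_nrmP[s3 s30 s3P] : nbhs w0 [set w | d (h w0) (h w) < del].
  by apply: (ch [set b | d (h w0) b < del]); apply/(dist_nbhs dd); exists del.
pose s := Num.min (Num.min s1 s2) (Num.min t s3).
have s0 : 0 < s by rewrite !lt_min s10 s20 t0.
have ws w : nrm (w - w0) < s -> [/\ nrm (w - w0) < s1, nrm (w - w0) < s2,
    nrm (w - w0) < t & nrm (w - w0) < s3].
  by rewrite !lt_min => /andP[/andP[a b] /andP[c e]].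
have w00 : nrm (w0 - w0) < s2 by rewrite subrr nrm0.
have [k _ kP] := filterI (filterI hol tP) (cvg w0 w00 _ del2).
apply: (@weierstrass R m n (fun j => chart_at y \o g_ (k + j)%N) _ w0 s
  (nrm (chart_at y (h w0)) + 1)) => //.
- move=> j w /ws[w1 w2 w3 w4].
  have [[/= holj equij] cvgj] := kP (k + j)%N (leq_addr _ _).
  have hg : d (h w0) (g_ (k + j)%N w) < del.
    rewrite (le_lt_trans (dtri (g_ (k + j)%N w0) _ _)) //.
    have := equij w w3; move: cvgj => /=; lra.
  have [yg yb] := delP _ hg; split.
    by have [_] := holj w w1; apply.
  rewrite /= -(subrK (chart_at y (h w0)) (chart_at y _)) addrC.
  by rewrite (le_trans (nrmD _ _)) // lerD2l ltW.
- move=> w /ws[w1 w2 w3 w4] e e0.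
  have [yw _] := delP _ (s3P w w4).
  have [del' del'0 del'P] := chart_near dd yw e0.
  have [k' _ k'P] := cvg w w2 _ del'0.
  exists k' => j kj /=.
  have [] // := del'P (g_ (k + j)%N w).
  by apply: k'P => /=; rewrite (leq_trans kj) // leq_addl.
Qed.

(** The limit of the rescaled maps is nonconstant because each of them moves by
    more than [osc] within the unit ball. *)
Lemma zalcman (I : Type) (F_ : I -> V -> N) (u0 : V) (rho : R) : 0 < rho ->
  (forall k u, nrm (u - u0) < rho -> hol_into (F_ k) u) ->
  (exists2 e : R, 0 < e & forall tau : R, 0 < tau ->
    exists k x, nrm (x - u0) < tau /\ e <= d (F_ k u0) (F_ k x)) ->
  exists (k_ : nat -> I) (u_ : nat -> V) (r_ : nat -> R) (h : V -> N),
  [/\ (forall j, 0 < r_ j) /\ (forall e : R, 0 < e -> \forall j \near \oo, r_ j < e),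
    (forall j, nrm (u_ j - u0) < rho) /\
      (forall e : R, 0 < e -> \forall j \near \oo, nrm (u_ j - u0) < e),
    forall B e : R, 0 < e -> \forall j \near \oo, forall w, nrm w <= B ->
      d (h w) (F_ (k_ j) (u_ j + (r_ j)%:C%C *: w)) < e,
    forall e : R, 0 < e -> exists2 tau : R, 0 < tau &
      forall w w', nrm (w' - w) < tau -> d (h w) (h w') < e &
    (forall w, hol_into h w) /\ exists w, h w <> h 0].
Proof.
move=> rho0 hF ne.
have [k_ [u_ [r_ [osc [osc0 scale equi far]]]]] := rescale dd cN rho0 hF ne.
have [h [j_ [jk hj hUC]]] := equicontinuous_limit equi.
pose g_ k w := F_ (k_ (j_ k)) (u_ (j_ k) + (r_ (j_ k))%:C%C *: w).
have jkR k : k.+1%:R <= (j_ k).+1%:R :> R by rewrite ler_nat ltnS.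
have small (e : R) : 0 < e -> \forall j \near \oo, rho / (j_ j).+1%:R < e.
  move=> e0; have [k kP] := nat_inv_small (divr_gt0 e0 rho0).
  exists k => // j /= kj; rewrite mulrC -ltr_pdivlMr //.
  by apply: kP; rewrite (leq_trans kj).
have cvg (B e : R) : 0 < e -> \forall j \near \oo, forall w, nrm w <= B -> d (h w) (g_ j w) < e.
  move=> e0; have [k1 k1P] := nat_above B; have [k2 k2P] := nat_inv_small e0.
  exists (maxn k1 k2) => // j /=; rewrite geq_max => /andP[j1 j2] w wB.
  rewrite (lt_trans (hj j w _)) ?k2P //.
  by rewrite (le_trans wB) ?k1P.
exists (k_ \o j_), (u_ \o j_), (r_ \o j_), h; split=> //.
- split=> [j|e e0]; first by have [] := scale (j_ j).
  have [k _ kP] := small e e0; exists k => // j /kP /=.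
  by have [_ + _ _] := scale (j_ j); exact: le_lt_trans.
- split=> [j|e e0].
    have [_ _ _ inb] := scale (j_ j).
    by have := inb 0; rewrite nrm0 scaler0 addr0; apply.
  have [k _ kP] := small e e0; exists k => // j /kP /=.
  by have [_ _ + _] := scale (j_ j); exact: le_lt_trans.
split.
  move=> w0; apply: (@hol_into_limit g_).
  - move=> e e0; have [tau tau0 tP] := equi e e0; exists tau => //.
    have [k kP] := nat_above (nrm w0); exists k => // j /kP jw w ww.
    by apply: tP => //; rewrite (le_trans jw) // (le_trans _ (jkR j)) // ler_nat.
  - exists 1 => //; have [k kP] := nat_above (nrm w0); exists k => // j /kP jw w ww.
    have [_ _ _ inb] := scale (j_ j).
    apply: (@hol_into_comp _ _ _ _ _ (F_ (k_ (j_ j)))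
      (fun w : V => u_ (j_ j) + (r_ (j_ j))%:C%C *: w)).
      apply: differentiableD; first exact: differentiable_cst.
      by apply: (@differentiableZ _ _ _ idfun).
    apply: hF; apply: inb; rewrite (le_trans _ (jkR j)) // -[w](subrK w0).
    by rewrite (le_trans (nrmD _ _)) // -natr1; lra.
  - exists 1 => // w _ e e0.
    have [k _ kP] := cvg (nrm w) e e0; exists k => // j kj; exact: kP.
  - move=> A /(dist_nbhs dd)[e e0 eA]; have [tau tau0 tP] := hUC e e0.
    by apply/nbhs_nrmP; exists tau => // w ww; apply: eA; exact: tP.
apply: contrapT => hcst.
have hc w : h w = h 0 by apply: contrapT => hw; apply: hcst; exists w.
have osc2 : 0 < osc / 2 by rewrite divr_gt0.
have [k _ kP] := cvg 1 _ osc2.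
have [w [w1 w2]] := far (j_ k).
have h0 := kP k (leqnn k) 0; rewrite nrm0 ler01 in h0.
have hw := kP k (leqnn k) w w1; rewrite hc in hw.
have := dtri (h 0) (g_ k 0) (g_ k w); rewrite (dsym (g_ k 0) (h 0)).
move: w2 (h0 isT) hw; rewrite -/(g_ k 0) -/(g_ k w); lra.
Qed.

End ZalcmanLimit.

(** * Calculus on complex manifolds *)

Section NearDifferentiable.
Context {R : realType} {V W : normedModType R[i]}.

Lemma near_eq_diff (f g : V -> W) (a : V) : (\forall x \near a, f x = g x) ->
  differentiable f a -> differentiable g a /\ ('d g a = 'd f a :> (V -> W)).
Proof.
move=> fg df; apply: nrm_diff; first exact: diff_continuous.
move=> e e0; have [del del0 dP] := diff_nrm df e0.
have /nbhs_nrmP[s s0 sP] := fg.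
exists (Num.min del s); first by rewrite lt_min del0.
move=> x; rewrite lt_min => /andP[xd xs].
by rewrite -(sP _ xs) -(nbhs_singleton fg); exact: dP.
Qed.

Lemma diff_id_eq (a : V) : 'd (@idfun V) a = idfun :> (V -> V).
Proof. exact: diff_val. Qed.

End NearDifferentiable.

Section ChainRule.
Context {R : realType} {V1 V2 V3 V4 : normedModType R[i]}.

Lemma chain2 (f : V1 -> V2) (g : V2 -> V3) x y : f x = y ->
  differentiable f x -> differentiable g y ->
  differentiable (g \o f) x /\ forall v, 'd (g \o f) x v = 'd g y ('d f x v).
Proof.
move=> <- df dg; split; first exact: differentiable_comp.
by move=> v; rewrite diff_comp.
Qed.

End ChainRule.

Section ChainRule3.
Context {R : realType} {V1 V2 V3 V4 : normedModType R[i]}.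

Lemma chain3 (f : V1 -> V2) (g : V2 -> V3) (h : V3 -> V4) x y z : f x = y -> g y = z ->
  differentiable f x -> differentiable g y -> differentiable h z ->
  differentiable (h \o g \o f) x /\
  forall v, 'd (h \o g \o f) x v = 'd h z ('d g y ('d f x v)).
Proof.
move=> fx gy df dg dh; have [d1 e1] := chain2 gy dg dh.
have [d2 e2] := chain2 fx df d1.
by split=> // v; rewrite e2 e1.
Qed.

End ChainRule3.

Section ManifoldCalculus.
Context {R : realType}.

Section OneChart.
Context {E : normedModType R[i]} {M : chartedType E}.
Implicit Types (x p : M).

Lemma chart_inv_at p x : chart_dom (chart_at p) x ->
  {for chart_at p x, continuous (chart_inv (chart_at p))}.
Proof. by move=> px; apply: chart_inv_continuous; exact: chart_map_img. Qed.

Lemma near_chart_inv p x (A : set M) : chart_dom (chart_at p) x -> nbhs x A ->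
  \forall u \near chart_at p x, A (chart_inv (chart_at p) u).
Proof.
move=> px Ax; have ci := chart_inv_at px.
by apply: ci; rewrite chart_mapK.
Qed.

Lemma near_chart_dom p x : chart_dom (chart_at p) x -> \forall y \near x, chart_dom (chart_at p) y.
Proof.
by move=> px; apply: open_nbhs_nbhs; split=> //; exact: chart_dom_open.
Qed.

Lemma near_chart_img p x : chart_dom (chart_at p) x -> \forall u \near chart_at p x, chart_img (chart_at p) u.
Proof.
move=> px; apply: open_nbhs_nbhs; split; first exact: chart_img_open.
exact: chart_map_img.
Qed.

Lemma transition_differentiable p p' x : chart_dom (chart_at p) x ->
  chart_dom (chart_at p') x ->
  differentiable (chart_at p' \o chart_inv (chart_at p)) (chart_at p x).
Proof.
move=> px p'x; apply: chart_at_transition; first exact: chart_map_img.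
by rewrite chart_mapK.
Qed.

End OneChart.

Section OneMap.
Context {E E' : normedModType R[i]} {M : chartedType E} {N : chartedType E'}.
Implicit Types (f : M -> N) (x p : M) (q : N).

Definition expr_in (p : M) (q : N) (f : M -> N) : E -> E' :=
  chart_at q \o f \o chart_inv (chart_at p).

(** The coordinate expression of a map differs from its expression in other
    charts by transition maps. *)
Lemma change_charts f x p q p' q' : {for x, continuous f} ->
  chart_dom (chart_at p) x -> chart_dom (chart_at p') x ->
  chart_dom (chart_at q) (f x) -> chart_dom (chart_at q') (f x) ->
  \forall u \near chart_at p' x,
    ((chart_at q' \o chart_inv (chart_at q)) \o expr_in p q f \o
      (chart_at p \o chart_inv (chart_at p'))) u = expr_in p' q' f u.
Proof.
move=> cf px p'x qx q'x.
have h1 := near_chart_inv p'x (near_chart_dom px).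
have h2 := near_chart_inv p'x (cf _ (near_chart_dom qx)).
near=> u; rewrite /expr_in /=.
have u1 : chart_dom (chart_at p) (chart_inv (chart_at p') u) by near: u.
have u2 : chart_dom (chart_at q) (f (chart_inv (chart_at p') u)) by near: u.
by rewrite (chart_mapK u1) (chart_mapK u2).
Unshelve. all: by end_near. Qed.

Lemma expr_in_differentiable f x p q : holomorphic_at f x ->
  chart_dom (chart_at p) x -> chart_dom (chart_at q) (f x) ->
  differentiable (expr_in p q f) (chart_at p x) /\
  forall v, 'd (expr_in p q f) (chart_at p x) v =
    'd (chart_at q \o chart_inv (chart_at (f x))) (chart_at (f x) (f x))
     (differential f (x := x) ('d (chart_at x \o chart_inv (chart_at p)) (chart_at p x) v)).
Proof.
move=> [cf df] px qx.
have dx := chart_at_dom x; have dfx := chart_at_dom (f x).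
have d1 := transition_differentiable px dx.
have d3 := transition_differentiable dfx qx.
have e1 : (chart_at x \o chart_inv (chart_at p)) (chart_at p x) = chart_at x x.
  by rewrite /= chart_mapK.
have e2 : local_expr f x (chart_at x x) = chart_at (f x) (f x).
  by rewrite /local_expr /= chart_mapK.
have [d dE] := chain3 e1 e2 d1 df d3.
have [h1 h2] := @near_eq_diff _ _ _ _ (expr_in p q f) _ (change_charts cf dx px dfx qx) d.
split; first exact: h1.
by move=> v; exact: (etrans (congr1 (fun L => L v) h2) (dE v)).
Qed.

Lemma holomorphic_at_expr f x p q : {for x, continuous f} ->
  chart_dom (chart_at p) x -> chart_dom (chart_at q) (f x) ->
  differentiable (expr_in p q f) (chart_at p x) -> holomorphic_at f x.
Proof.
move=> cf px qx df; split=> //.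
have dx := chart_at_dom x; have dfx := chart_at_dom (f x).
have d1 := transition_differentiable dx px.
have d3 := transition_differentiable qx dfx.
have e1 : (chart_at p \o chart_inv (chart_at x)) (chart_at x x) = chart_at p x.
  by rewrite /= chart_mapK.
have e2 : expr_in p q f (chart_at p x) = chart_at q (f x).
  by rewrite /expr_in /= chart_mapK.
have [d _] := chain3 e1 e2 d1 df d3.
exact: (proj1 (@near_eq_diff _ _ _ _ (expr_in x (f x) f) _ (change_charts cf px dx qx dfx) d)).
Qed.

Lemma holomorphic_at_cst (c : N) x : holomorphic_at (fun=> c : N) x.
Proof. by split; [exact: cvg_cst|exact: differentiable_cst]. Qed.

Lemma differential_cst (c : N) x v : differential (fun=> c : N) (x := x) v = 0.
Proof.
rewrite /differential (_ : local_expr _ _ = cst (chart_at c c)) //.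
by rewrite diff_cst.
Qed.

End OneMap.

Lemma holomorphic_at_id {E : normedModType R[i]} {M : chartedType E} (x : M) :
  holomorphic_at (fun y : M => y) x /\
  forall v, differential (fun y : M => y) (x := x) v = v.
Proof.
have h : \forall u \near chart_at x x, u = local_expr (fun y : M => y) x u.
  near=> u; rewrite /local_expr /= chart_invK //; near: u.
  exact: near_chart_img (chart_at_dom x).
have [h1 h2] := near_eq_diff h (@ex_diff _ _ _ _ _ _ _ (is_diff_id _)).
split; first by split; [exact: cvg_id|].
by move=> v; rewrite /differential h2 diff_id_eq.
Unshelve. all: by end_near. Qed.

Section Comp.
Context {E1 E2 E3 : normedModType R[i]}
  {M1 : chartedType E1} {M2 : chartedType E2} {M3 : chartedType E3}.

Lemma holomorphic_at_comp (f : M1 -> M2) (g : M2 -> M3) (x : M1) :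
  holomorphic_at f x -> holomorphic_at g (f x) ->
  holomorphic_at (fun y => g (f y)) x /\
  forall v, differential (fun y => g (f y)) (x := x) v =
    differential g (x := f x) (differential f (x := x) v).
Proof.
move=> [cf df] [cg dg].
have e : local_expr f x (chart_at x x) = chart_at (f x) (f x).
  by rewrite /local_expr /= chart_mapK //; exact: chart_at_dom.
have h : \forall u \near chart_at x x,
    (local_expr g (f x) \o local_expr f x) u = local_expr (fun y => g (f y)) x u.
  have h1 := near_chart_inv (chart_at_dom x) (cf _ (near_chart_dom (chart_at_dom (f x)))).
  near=> u; rewrite /local_expr /= chart_mapK //.
  by near: u.
have [d dE] := chain2 e df dg.
have [h1 h2] := @near_eq_diff _ _ _ _ (local_expr (fun y => g (f y)) x) _ h d.
split.
  split; [by apply: continuous_comp cg|exact: h1].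
by move=> v; exact: (etrans (congr1 (fun L => L v) h2) (dE v)).
Unshelve. all: by end_near. Qed.

Lemma holomorphic_at_pair (f : M1 -> M2) (g : M1 -> M3) (x : M1) :
  holomorphic_at f x -> holomorphic_at g x ->
  holomorphic_at (fun y => (f y, g y) : M2 * M3) x /\
  forall v, differential (fun y => (f y, g y) : M2 * M3) (x := x) v =
    (differential f (x := x) v, differential g (x := x) v).
Proof.
move=> [cf df] [cg dg].
have e : local_expr (fun y => (f y, g y) : M2 * M3) x =
  (fun u => (local_expr f x u, local_expr g x u)) by [].
split.
  split; first by apply: cvg_pair.
  by rewrite e; exact: differentiable_pair.
by move=> v; rewrite /differential e diff_pair.
Qed.

End Comp.

End ManifoldCalculus.

(** * Linearization of squaring near the identity *)

Section Halving.
Context {R : realType}.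

Definition half (k : nat) : R := 2^-1 ^+ k.

Lemma half_gt0 k : 0 < half k.
Proof. by rewrite exprn_gt0 ?invr_gt0. Qed.

Lemma halfS k : half k = 2 * half k.+1.
Proof. by rewrite /half exprS mulrA divff ?mul1r // pnatr_eq0. Qed.

Lemma half0 : half 0 = 1.
Proof. by rewrite /half expr0. Qed.

Lemma half_le1 k : half k <= 1.
Proof. by rewrite exprn_ile1 // ?invr_ge0 // invf_le1 // ler1n. Qed.

Lemma half_pow k : 2 ^+ k * half k = 1.
Proof. by rewrite /half exprVn divff // expf_neq0 // pnatr_eq0. Qed.

Lemma halfD k l : half (k + l) = half k * half l.
Proof. by rewrite /half exprD. Qed.

Lemma le0_half (a b : R) : 0 <= b -> (forall k, a <= b * half k) -> a <= 0.
Proof.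
move=> b0 ab; apply/ler_addgt0Pl => e e0; rewrite addr0.
have b1 : 0 < b + 1 by rewrite ltr_wpDl.
have [k kP] := half_pow_small (divr_gt0 e0 b1).
rewrite (le_trans (ab k)) // (@le_trans _ _ ((b + 1) * half k)) //.
  by rewrite ler_wpM2r ?lerDl // ltW // half_gt0.
by rewrite mulrC -ler_pdivlMr // ltW.
Qed.

Lemma eq_of_half (V : normedModType R[i]) (x y : V) (b : R) : 0 <= b ->
  (forall k, nrm (x - y) <= b * half k) -> x = y.
Proof.
move=> b0 h; apply/subr0_eq/nrm_eq0/le_anti.
by rewrite nrm_ge0 andbT (le0_half b0).
Qed.

End Halving.

(** Here [mu] is a product near [0] with [mu 0 0 = 0], approximated by addition
    as a group law is in coordinates.  Squaring is then a perturbation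
    of doubling, and as in Koenigs' linearization theorem [S ^ k (xi / 2 ^ k)]
    converges to a map that conjugates doubling to squaring: the exponential.
    The constant [c] bounds the quadratic error of squaring, and [32 c rho <= 1]
    keeps the accumulated distortion of its iterates below [2]. *)
Section Koenigs.
Context {R : realType} {m : nat}.
Local Notation V := ('rV[R[i]]_m).
Variables (mu : V -> V -> V) (K r rho : R).
Hypotheses (K0 : 0 < K) (r0 : 0 < r) (mu00 : mu 0 0 = 0).
Hypothesis mu_strict : forall x y x' y' : V,
  nrm x < r -> nrm y < r -> nrm x' < r -> nrm y' < r ->
  nrm (mu x y - mu x' y' - ((x - x') + (y - y'))) <=
    K * (nrm x + nrm y + nrm x' + nrm y') * (nrm (x - x') + nrm (y - y')).
Let c := 4 * K.
Hypotheses (rho0 : 0 < rho) (rhor : 4 * rho < r) (rhoc : 32 * c * rho <= 1).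

Let c0 : 0 < c. Proof. by rewrite mulr_gt0. Qed.

Let rho2 (x : R) : x <= rho -> x <= 2 * rho.
Proof. by move=> h; rewrite (le_trans h) // mulr_natl mulr2n lerDl ltW. Qed.

Let rho_r (x : R) : x <= rho -> 2 * x < r.
Proof.
move=> h; rewrite (le_lt_trans _ rhor) //.
have h' := rho2 h; have -> : 4 * rho = 2 * (2 * rho) by ring.
by rewrite ler_pM2l.
Qed.

Definition squaring (x : V) := mu x x.
Local Notation S := squaring.

Lemma squaring_strict (x y : V) : nrm x < r -> nrm y < r ->
  nrm (S x - S y - ((x - y) + (x - y))) <= c * (nrm x + nrm y) * nrm (x - y).
Proof.
move=> xr yr; rewrite (le_trans (mu_strict xr xr yr yr)) //.
by rewrite le_eqVlt; apply/orP; left; apply/eqP; rewrite /c; ring.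
Qed.

Lemma squaring0 : S 0 = 0. Proof. exact: mu00. Qed.

Lemma squaring_lip (x y : V) : nrm x < r -> nrm y < r ->
  nrm (S x - S y) <= (2 + c * (nrm x + nrm y)) * nrm (x - y).
Proof.
move=> xr yr; have := squaring_strict xr yr => h.
rewrite -(subrK ((x - y) + (x - y)) (S x - S y)).
rewrite (le_trans (nrmD _ _)) // addrC mulrDl lerD //.
by rewrite (le_trans (nrmD _ _)) // mulr_natl mulr2n.
Qed.

Lemma squaring_quad (x : V) : nrm x < r -> nrm (S x - (x + x)) <= c * nrm x ^+ 2.
Proof.
move=> xr; have := @squaring_strict x 0 xr.
rewrite nrm0 squaring0 !subr0 addr0 => /(_ r0) /le_trans; apply.
by rewrite expr2 mulrA.
Qed.

(** Near the origin squaring is doubling up to a quadratic error, so as long as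
    the iterates stay small its [i]-th iterate expands distances by a factor
    at most [2 * 2 ^ i]. *)
Lemma iter_squaring_lip (s : R) k : 0 <= s -> 2 ^+ k * s <= 2 * rho ->
  forall i, (i <= k)%N -> forall x y, nrm x <= s -> nrm y <= s ->
  nrm (iter i S x - iter i S y) <= 2 * 2 ^+ i * nrm (x - y) /\
  nrm (iter i S x) <= 4 * rho.
Proof.
move=> s0 ks.
(* the distortion accumulated after [i] steps; it is below [2] up to step [k] *)
pose b i : R := 1 + 4 * c * s * 2 ^+ i.
have p0 i : 0 < 2 ^+ i :> R by rewrite exprn_gt0.
have small i : (i <= k)%N -> 2 ^+ i * s <= 2 * rho.
  move=> ik; rewrite (le_trans _ ks) // ler_wpM2r // ler_eXn2l // ltr1n //.
have csmall i : (i <= k)%N -> 16 * c * s * 2 ^+ i <= 1.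
  move=> /small ik; rewrite (le_trans _ rhoc) //.
  have -> : 16 * c * s * 2 ^+ i = 16 * c * (2 ^+ i * s) by ring.
  have -> : 32 * c * rho = 16 * c * (2 * rho) by ring.
  by rewrite ler_wpM2l // mulr_ge0 // ltW.
have b0 i : 0 <= b i by rewrite addr_ge0 // !mulr_ge0 // ltW.
have b2 i : (i <= k)%N -> b i <= 2 by move=> /csmall; rewrite /b; lra.
have iter0 i : iter i S 0 = 0.
  by elim: i => [//|i IH]; rewrite iterS IH squaring0.
suff H i : (i <= k)%N -> forall x y, nrm x <= s -> nrm y <= s ->
    nrm (iter i S x - iter i S y) <= 2 ^+ i * b i * nrm (x - y) /\
    nrm (iter i S x) <= 2 ^+ i * b i * s.
  move=> i ik x y xs ys; have [h1 h2] := H i ik x y xs ys; split.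
    by rewrite (le_trans h1) // ler_wpM2r ?nrm_ge0 // mulrC ler_pM2r // b2.
  rewrite (le_trans h2) // mulrAC.
  have -> : 4 * rho = (2 * rho) * 2 by ring.
  by rewrite ler_pM ?b2 ?small // mulr_ge0 // ltW.
elim: i => [|i IH] ik x y xs ys.
  rewrite /= expr0 mul1r; have b1 : 1 <= b 0%N.
    by rewrite lerDl !mulr_ge0 // ltW.
  split; first by rewrite -[leLHS]mul1r ler_wpM2r ?nrm_ge0.
  by rewrite (le_trans xs) // -[leLHS]mul1r ler_wpM2r.
have ik' := ltnW ik.
have bound z : nrm z <= s -> nrm (iter i S z) <= 2 * (2 ^+ i * s).
  move=> zs; have [_ h] := IH ik' z z zs zs.
  rewrite (le_trans h) // mulrAC mulrC ler_wpM2r ?b2 // mulr_ge0 // ltW.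
have bound' z : nrm z <= s -> nrm (iter i S z) < r.
  move=> /bound h; rewrite (le_lt_trans h) // (le_lt_trans _ rhor) //.
  by have := small i ik'; lra.
have step x' y' : nrm x' <= s -> nrm y' <= s ->
    nrm (iter i.+1 S x' - iter i.+1 S y') <= 2 ^+ i.+1 * b i.+1 * nrm (x' - y').
  move=> xs' ys'; rewrite !iterS.
  rewrite (le_trans (squaring_lip (bound' x' xs') (bound' y' ys'))) //.
  have [h _] := IH ik' x' y' xs' ys'.
  rewrite (@le_trans _ _ ((2 + c * (4 * (2 ^+ i * s))) * (2 ^+ i * b i * nrm (x' - y')))) //.
    apply: ler_pM => //.
    - by rewrite addr_ge0 // mulr_ge0 ?(ltW c0) // addr_ge0 ?nrm_ge0.
    - exact: nrm_ge0.
    - rewrite lerD2l ler_wpM2l ?(ltW c0) //.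
      by have := bound x' xs'; have := bound y' ys'; lra.
  rewrite mulrA ler_wpM2r ?nrm_ge0 //.
  have -> : (2 + c * (4 * (2 ^+ i * s))) * (2 ^+ i * b i) =
    2 ^+ i * ((2 + c * (4 * (2 ^+ i * s))) * b i) by ring.
  have -> : 2 ^+ i.+1 * b i.+1 = 2 ^+ i * (2 * b i.+1) by rewrite exprS; ring.
  rewrite ler_wpM2l ?(ltW (p0 i)) // /b exprS.
  have := csmall i ik'; have : 0 <= c * s * 2 ^+ i by rewrite !mulr_ge0 // ltW.
  move: (2 ^+ i) => t.
  have -> : c * (4 * (t * s)) = 4 * (c * s * t) by ring.
  have -> : 4 * c * s * t = 4 * (c * s * t) by ring.
  have -> : 4 * c * s * (2 * t) = 8 * (c * s * t) by ring.
  have -> : 16 * c * s * t = 16 * (c * s * t) by ring.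
  move: (c * s * t) => w w0 w1; nra.
split; first exact: step.
have := step x 0 xs; rewrite nrm0 iter0 !subr0 => /(_ s0) /le_trans; apply.
by rewrite ler_wpM2l // mulr_ge0 // ltW.
Qed.

Definition approx_exp k (xi : V) : V := iter k S ((half k)%:C%C *: xi).

Lemma nrm_halfZ k (xi : V) : nrm ((half k)%:C%C *: xi) = half k * nrm xi.
Proof. by rewrite nrmZ nrmC ger0_norm // ltW // half_gt0. Qed.

Let scale_ok k : 2 ^+ k * (2 * rho * half k) <= 2 * rho.
Proof. by rewrite mulrCA half_pow mulr1. Qed.

Let scale_ge0 k : 0 <= 2 * rho * half k.
Proof. by rewrite !mulr_ge0 // ?(ltW rho0) // ltW // half_gt0. Qed.

Lemma nrm_halfZ_le k (xi : V) : nrm xi <= 2 * rho -> nrm ((half k)%:C%C *: xi) <= 2 * rho * half k.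
Proof.
move=> h; rewrite nrm_halfZ mulrC ler_wpM2r //; exact/ltW/half_gt0.
Qed.

Lemma approx_exp_step (xi : V) k : nrm xi <= rho ->
  nrm (approx_exp k.+1 xi - approx_exp k xi) <= (c / 2 * nrm xi ^+ 2) * half k.
Proof.
move=> xr; pose y : V := (half k.+1)%:C%C *: xi.
have y2 : (half k)%:C%C *: xi = y + y.
  by rewrite /y -scalerDl -rmorphD; congr (_%:C%C *: _); rewrite (halfS k); ring.
have yE : nrm y = half k.+1 * nrm xi by exact: nrm_halfZ.
have h1 := half_gt0 k.+1 : 0 < half k.+1 :> R.
have h11 := half_le1 k.+1 : half k.+1 <= 1 :> R.
have x0 := nrm_ge0 xi.
have yrho : nrm y <= rho * half k.+1 by rewrite yE mulrC ler_wpM2r // ltW.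
have yr : nrm y < r.
  rewrite (le_lt_trans yrho) // (le_lt_trans _ rhor) //; nra.
have cy : c * nrm y <= 1.
  rewrite (le_trans _ rhoc) //.
  have : c * nrm y <= c * rho by rewrite ler_wpM2l ?(ltW c0) // (le_trans yrho) //; nra.
  have : 0 <= c * rho by rewrite mulr_ge0 // ltW.
  lra.
have Sy : nrm (S y) <= 2 * rho * half k.
  rewrite -[S y](subrK (y + y)) (le_trans (nrmD _ _)) //.
  have := squaring_quad yr; have := nrmD y y; have := nrm_ge0 y.
  rewrite (halfS k) => k1 k2 k3.
  have : c * nrm y ^+ 2 <= nrm y by rewrite expr2 mulrA -[leRHS]mul1r ler_wpM2r.
  lra.
have hx2 : nrm xi <= 2 * rho by exact: rho2.
have := nrm_halfZ_le k hx2 => h2.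
have [+ _] := iter_squaring_lip (scale_ge0 k) (scale_ok k) (leqnn k) Sy h2.
rewrite /approx_exp iterSr -/y y2 => /le_trans; apply.
rewrite (@le_trans _ _ (2 * 2 ^+ k * (c * nrm y ^+ 2))) //.
  by rewrite ler_wpM2l ?squaring_quad // mulr_ge0 // exprn_ge0.
have -> : 2 * 2 ^+ k * (c * nrm y ^+ 2) =
  (2 ^+ k * (2 * half k.+1)) * (c * nrm xi ^+ 2 * half k.+1) by rewrite yE; ring.
rewrite -halfS half_pow mul1r (halfS k) le_eqVlt; apply/orP; left; apply/eqP.
by field.
Qed.

(** Consecutive approximations start from [S y] and [2 y] with
    [y = xi / 2 ^ (k + 1)], which differ by [O(4 ^- k)]; iterating [k] times
    multiplies this by [2 ^ k] only, so the differences form a geometric series. *)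
Lemma approx_exp_cvg : exists E : V -> V, forall xi, nrm xi <= rho ->
  forall k, nrm (approx_exp k xi - E xi) <= c * nrm xi ^+ 2 * half k.
Proof.
suff H xi : exists y, nrm xi <= rho ->
    forall k, nrm (approx_exp k xi - y) <= c * nrm xi ^+ 2 * half k.
  by have [E EP] := choice H; exists E.
have [xr|xr] := pselect (nrm xi <= rho); last by exists 0 => /xr.
have b0 : 0 <= c / 2 * nrm xi ^+ 2.
  by apply: mulr_ge0; [apply: divr_ge0 => //; exact: ltW|exact: exprn_ge0 (nrm_ge0 _)].
have [y yP] := geometric_seq_limit b0 (fun k => approx_exp_step k xr).
exists y => _ k; rewrite (le_trans (yP k)) // le_eqVlt; apply/orP; left; apply/eqP.
by rewrite /half; field.
Qed.

Section Exponential.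
Variable E : V -> V.
Hypothesis EP : forall xi : V, nrm xi <= rho ->
  forall k, nrm (approx_exp k xi - E xi) <= c * nrm xi ^+ 2 * half k.

Lemma koenigs_quad (xi : V) : nrm xi <= rho -> nrm (E xi - xi) <= c * nrm xi ^+ 2.
Proof.
move=> /EP/(_ 0%N); rewrite /approx_exp half0 /= scale1r mulr1.
by rewrite nrm_distC.
Qed.

Lemma csq_ge0 (t : R) : 0 <= c * t ^+ 2.
Proof. by rewrite mulr_ge0 ?sqr_ge0 // ltW. Qed.

Lemma koenigs_le (xi : V) : nrm xi <= rho -> nrm (E xi) <= 2 * nrm xi.
Proof.
move=> xr; rewrite -(subrK xi (E xi)) (le_trans (nrmD _ _)) //.
have := koenigs_quad xr; have x0 := nrm_ge0 xi.
have : c * nrm xi ^+ 2 <= nrm xi.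
  rewrite expr2 mulrA -[leRHS]mul1r ler_wpM2r //.
  rewrite (le_trans _ rhoc) //.
  have : c * nrm xi <= c * rho by rewrite ler_wpM2l // ltW.
  have : 0 <= c * rho by rewrite mulr_ge0 // ltW.
  lra.
lra.
Qed.

Lemma koenigs_lip (xi eta : V) : nrm xi <= rho -> nrm eta <= rho ->
  nrm (E xi - E eta) <= 2 * nrm (xi - eta).
Proof.
move=> xr yr; rewrite -subr_le0.
apply: (@le0_half _ _ (c * nrm xi ^+ 2 + c * nrm eta ^+ 2)).
  by rewrite addr_ge0 ?csq_ge0.
move=> k; rewrite lerBlDr.
have hx2 : nrm xi <= 2 * rho by exact: rho2.
have hy2 : nrm eta <= 2 * rho by exact: rho2.
have [h _] := iter_squaring_lip (scale_ge0 k) (scale_ok k) (leqnn k)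
  (nrm_halfZ_le k hx2) (nrm_halfZ_le k hy2).
have {}h : nrm (approx_exp k xi - approx_exp k eta) <= 2 * nrm (xi - eta).
  rewrite (le_trans h) // -scalerBr nrm_halfZ.
  by rewrite -mulrA [X in _ * X]mulrA half_pow mul1r.
have := EP xr k; rewrite nrm_distC => h1; have h2 := EP yr k.
rewrite (le_trans (nrm_dist_trans (approx_exp k xi) _ _)) //.
rewrite (le_trans (lerD (lexx _) (nrm_dist_trans (approx_exp k eta) _ _))) //.
lra.
Qed.

(** Any sequence tangent to [half k *: xi] up to an error of order [4 ^- k] may
    be used to compute [E xi]. *)
Lemma koenigs_stable (xi : V) (x_ : nat -> V) (D : R) y : nrm xi <= rho -> 0 <= D ->
  (forall k, nrm (x_ k) <= 2 * rho * half k) ->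
  (forall k, nrm (x_ k - (half k)%:C%C *: xi) <= D * half k ^+ 2) ->
  (forall k, iter k S (x_ k) = y) -> y = E xi.
Proof.
move=> xr D0 xs xD xy; apply: (@eq_of_half _ _ _ _ (2 * D + c * nrm xi ^+ 2)).
  by rewrite addr_ge0 ?csq_ge0 // mulr_ge0.
move=> k; have hx2 : nrm xi <= 2 * rho by exact: rho2.
have [h _] := iter_squaring_lip (scale_ge0 k) (scale_ok k) (leqnn k)
  (xs k) (nrm_halfZ_le k hx2).
rewrite xy -/(approx_exp k xi) in h.
rewrite (le_trans (nrm_dist_trans (approx_exp k xi) _ _)) // mulrDl lerD ?EP //.
rewrite (le_trans h) // (@le_trans _ _ (2 * 2 ^+ k * (D * half k ^+ 2))) //.
  by rewrite ler_wpM2l // mulr_ge0 // exprn_ge0.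
have -> : 2 * 2 ^+ k * (D * half k ^+ 2) = 2 ^+ k * half k * (2 * D * half k) by ring.
by rewrite half_pow mul1r.
Qed.

Lemma koenigs_lt_r (xi : V) : nrm xi <= rho -> nrm (E xi) < r.
Proof. by move=> /[dup] /koenigs_le h xr; rewrite (le_lt_trans h) // rho_r. Qed.

Lemma approx_exp_lt_r k (xi : V) : nrm xi <= rho -> nrm (approx_exp k xi) < r.
Proof.
move=> xr; have hx2 : nrm xi <= 2 * rho by exact: rho2.
have [_ h] := iter_squaring_lip (scale_ge0 k) (scale_ok k) (leqnn k)
  (nrm_halfZ_le k hx2) (nrm_halfZ_le k hx2).
exact: le_lt_trans h rhor.
Qed.

Lemma koenigs_double (xi : V) : nrm (xi + xi) <= rho -> E (xi + xi) = S (E xi).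
Proof.
move=> xxr; have xr : nrm xi <= rho.
  have : nrm (xi + xi) = 2 * nrm xi.
    by rewrite -mulr2n -scaler_nat nrmZ -(rmorph_nat (real_complex R)) nrmC ger0_norm.
  have := nrm_ge0 xi; lra.
apply: (@eq_of_half _ _ _ _ (c * nrm (xi + xi) ^+ 2 + (2 + 2 * c * r) * (c * nrm xi ^+ 2))).
  rewrite addr_ge0 ?csq_ge0 // mulr_ge0 ?csq_ge0 // addr_ge0 // !mulr_ge0 // ltW //.
move=> k.
have e : approx_exp k.+1 (xi + xi) = S (approx_exp k xi).
  rewrite /approx_exp iterS; congr (S (iter _ _ _)).
  by rewrite scalerDr -scalerDl -rmorphD; congr (_%:C%C *: _); rewrite (halfS k); ring.
have h1 := EP xxr k.+1; rewrite e nrm_distC in h1.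
have l1 := approx_exp_lt_r k xr; have l2 := koenigs_lt_r xr.
have h2 := squaring_lip l1 l2; have h3 := EP xr k.
rewrite (le_trans (nrm_dist_trans (S (approx_exp k xi)) _ _)) // mulrDl lerD //.
  rewrite (le_trans h1) // ler_wpM2l ?csq_ge0 // (halfS k).
  have := half_gt0 k.+1 : 0 < half k.+1 :> R; lra.
rewrite (le_trans h2) // -mulrA ler_pM ?nrm_ge0 //.
  by rewrite addr_ge0 // mulr_ge0 ?addr_ge0 ?nrm_ge0 // ltW.
have -> : 2 * c * r = c * (r + r) by ring.
by rewrite lerD2l ler_pM2l // lerD // ltW.
Qed.

Lemma koenigs0 : E 0 = 0.
Proof.
have h : nrm (0 : V) <= rho by rewrite nrm0 ltW.
by apply: nrm_eq0; have := koenigs_le h; rewrite nrm0 mulr0 => h'; apply: le_anti;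
  rewrite h' nrm_ge0.
Qed.

Hypothesis S_diff : forall x, nrm x < r -> differentiable S x.

(** Locally uniform limit of bounded holomorphic maps. *)
Lemma koenigs_differentiable (xi : V) : nrm xi < rho -> differentiable E xi.
Proof.
move=> xr; have s0 : 0 < rho - nrm xi by rewrite subr_gt0.
have inb u : nrm (u - xi) < rho - nrm xi -> nrm u <= rho.
  move=> ur; rewrite -(subrK xi u) (le_trans (nrmD _ _)) //; lra.
apply: (@weierstrass R m m approx_exp E xi (rho - nrm xi) r s0).
- move=> k u /inb ur; split; last exact/ltW/approx_exp_lt_r.
  have hx2 : nrm u <= 2 * rho by exact: rho2.
  suff H i : (i <= k)%N -> differentiable (fun u => iter i S ((half k)%:C%C *: u)) u.
    exact: H (leqnn k).
  elim: i => [|i IH] ik.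
    by apply: (@differentiableZ _ _ _ idfun).
  apply: (@differentiable_comp _ _ _ _ (fun u => iter i S ((half k)%:C%C *: u)) S).
    exact: IH (ltnW ik).
  apply: S_diff.
  have [_ h] := iter_squaring_lip (scale_ge0 k) (scale_ok k) (ltnW ik)
    (nrm_halfZ_le k hx2) (nrm_halfZ_le k hx2).
  exact: le_lt_trans h rhor.
- move=> u /inb ur e e0.
  have b1 : 0 < c * nrm u ^+ 2 + 1 by rewrite ltr_wpDl ?csq_ge0.
  have [k kP] := half_pow_small (divr_gt0 e0 b1).
  exists k => j kj; rewrite (le_lt_trans (EP ur j)) //.
  have hj : half j <= half k :> R.
    rewrite -(subnKC kj) halfD -[leRHS]mulr1 ler_wpM2l ?half_le1 //.
    exact/ltW/half_gt0.
  rewrite (@le_lt_trans _ _ ((c * nrm u ^+ 2 + 1) * half k)) //.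
    by rewrite ler_pM ?csq_ge0 ?lerDl // ltW // half_gt0.
  by rewrite mulrC -ltr_pdivlMr.
Qed.

End Exponential.

End Koenigs.

(** * One-parameter subgroups in coordinates *)

Lemma subr_shuffle (W : zmodType) (x y z w : W) : x - y - z + w = (x - z) - (y - w).
Proof. by rewrite opprB (addrC w) addrA (addrAC x (- y)). Qed.

Section LocalExponential.
Context {R : realType} {m : nat}.
Local Notation V := ('rV[R[i]]_m).

(** The local data of a group in coordinates centred at the identity: [iota]
    parametrizes a neighbourhood of [1] and [mu] is the product read through
    [iota]. *)
Section Coordinates.
Variables (G : groupType) (iota : V -> G) (mu : V -> V -> V) (K r rho : R).
Hypotheses (K0 : 0 < K) (r0 : 0 < r) (mu00 : mu 0 0 = 0).
Hypothesis mu_strict : forall x y x' y' : V,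
  nrm x < r -> nrm y < r -> nrm x' < r -> nrm y' < r ->
  nrm (mu x y - mu x' y' - ((x - x') + (y - y'))) <=
    K * (nrm x + nrm y + nrm x' + nrm y') * (nrm (x - x') + nrm (y - y')).
Let c := 4 * K.
Hypotheses (rho0 : 0 < rho) (rhor : 4 * rho < r) (rhoc : 32 * c * rho <= 1).
Hypothesis iota_mul : forall x y : V, nrm x < r -> nrm y < r ->
  iota (mu x y) = (iota x * iota y)%g.
Hypothesis iota_inj : forall x y : V, nrm x < r -> nrm y < r -> iota x = iota y -> x = y.
Variable E : V -> V.
Hypothesis EP : forall xi : V, nrm xi <= rho ->
  forall k, nrm (approx_exp mu k xi - E xi) <= c * nrm xi ^+ 2 * half k.

Let c0 : 0 < c. Proof. by rewrite mulr_gt0. Qed.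
Local Notation S := (squaring mu).
Let Equad := koenigs_quad EP.
Let Ele := koenigs_le K0 rho0 rhoc EP.
Let Elip := koenigs_lip K0 mu00 mu_strict rho0 rhor rhoc EP.
Let Elt := koenigs_lt_r K0 rho0 rhor rhoc EP.
Let Edouble := koenigs_double K0 r0 mu00 mu_strict rho0 rhor rhoc EP.

Lemma halfZ_le k (x : V) (b : R) : nrm x <= b -> nrm ((half k)%:C%C *: x) <= b * half k.
Proof. by move=> h; rewrite nrm_halfZ mulrC ler_wpM2r // ltW // half_gt0. Qed.

Lemma halfZ_le' k (x : V) (b : R) : nrm x <= b -> nrm ((half k)%:C%C *: x) <= b.
Proof.
move=> h; rewrite (le_trans _ h) // nrm_halfZ -[leRHS]mul1r ler_wpM2r ?nrm_ge0 //.
exact: half_le1.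
Qed.

Lemma half_double k (x : V) :
  (half k.+1)%:C%C *: x + (half k.+1)%:C%C *: x = (half k)%:C%C *: x.
Proof.
by rewrite -scalerDl -rmorphD; congr (_%:C%C *: _); rewrite (halfS k); ring.
Qed.

Lemma iter_squaring_iota k (x : V) : nrm x <= 2 * rho * half k ->
  forall i, (i <= k)%N -> iota (iter i S x) = (iota x ^+ (2 ^ i))%g /\ nrm (iter i S x) < r.
Proof.
move=> xs.
have s0 : 0 <= 2 * rho * half k by exact: le_trans (nrm_ge0 _) xs.
have ks : 2 ^+ k * (2 * rho * half k) <= 2 * rho.
  by rewrite mulrCA half_pow mulr1.
have lt i : (i <= k)%N -> nrm (iter i S x) < r.
  move=> ik.
  have [_ h] := iter_squaring_lip K0 mu00 mu_strict rhor rhoc s0 ks ik xs xs.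
  exact: le_lt_trans h rhor.
elim=> [|i IH] ik; split; try exact: lt.
  by rewrite /= expn0 expg1.
rewrite iterS /squaring iota_mul ?lt 1?ltnW //.
have [-> _] := IH (ltnW ik).
by rewrite expnS mul2n -addnn expgnDr.
Qed.

Lemma koenigs_iter k (xi : V) : nrm xi <= rho -> iter k S (E ((half k)%:C%C *: xi)) = E xi.
Proof.
move=> xr; elim: k => [|k IH]; first by rewrite half0 scale1r.
by rewrite iterSr -Edouble half_double // halfZ_le'.
Qed.

Lemma koenigs_small k (xi : V) : nrm xi <= rho ->
  nrm (E ((half k)%:C%C *: xi)) <= 2 * rho * half k.
Proof.
move=> xr; rewrite (le_trans (Ele (halfZ_le' k xr))) // -mulrA ler_pM2l //.
exact: halfZ_le.
Qed.

Lemma koenigs_pow k (xi : V) : nrm xi <= rho ->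
  iota (E xi) = (iota (E ((half k)%:C%C *: xi)) ^+ (2 ^ k))%g.
Proof.
move=> xr; have [<- _] := iter_squaring_iota (koenigs_small k xr) (leqnn k).
by rewrite koenigs_iter.
Qed.

(** The products of the dyadic parts of [E xi] and [E eta] have the product of
    [E xi] and [E eta] as [2 ^ k]-th power, because these parts commute, and they
    are tangent to the dyadic parts of [xi + eta]; [koenigs_stable] applies. *)
Lemma koenigs_add (xi eta : V) : nrm xi + nrm eta <= rho ->
  (forall k, commute (iota (E ((half k)%:C%C *: xi))) (iota (E ((half k)%:C%C *: eta)))) ->
  mu (E xi) (E eta) = E (xi + eta).
Proof.
move=> tr com; set t := nrm xi + nrm eta in tr.
have x0 := nrm_ge0 xi; have y0 := nrm_ge0 eta.
have t0 : 0 <= t by rewrite addr_ge0.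
have xr : nrm xi <= rho by rewrite (le_trans _ tr) // lerDl.
have yr : nrm eta <= rho by rewrite (le_trans _ tr) // lerDr.
have xyr : nrm (xi + eta) <= rho by rewrite (le_trans (nrmD _ _)).
pose a k := E ((half k)%:C%C *: xi); pose b k := E ((half k)%:C%C *: eta).
have ct2 : c * t <= 1 / 32.
  have : c * t <= c * rho by rewrite ler_pM2l.
  have e : 32 * c * rho = 32 * (c * rho) by ring.
  by move: rhoc; rewrite e; lra.
have near k : nrm (mu (a k) (b k) - (half k)%:C%C *: (xi + eta)) <= 2 * c * t ^+ 2 * half k ^+ 2.
  have h0 := half_gt0 k : 0 < half k :> R.
  have xk := halfZ_le' k xr; have yk := halfZ_le' k yr.
  have h1 := @mu_strict (a k) (b k) 0 0 (Elt xk) (Elt yk).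
  rewrite nrm0 mu00 !subr0 !addr0 in h1; have {}h1 := h1 r0 r0.
  have h2 := Equad xk; have h3 := Equad yk.
  have h4 := Ele xk; have h5 := Ele yk.
  have a0 := nrm_ge0 (a k); have b0 := nrm_ge0 (b k).
  rewrite -/(a k) -/(b k) !nrm_halfZ in h2 h3 h4 h5.
  have h6 : K * (nrm (a k) + nrm (b k)) * (nrm (a k) + nrm (b k)) <= c * t ^+ 2 * half k ^+ 2.
    have s1 : nrm (a k) + nrm (b k) <= 2 * (half k * t) by rewrite /t; lra.
    have s2 : (nrm (a k) + nrm (b k)) ^+ 2 <= (2 * (half k * t)) ^+ 2.
      by rewrite ler_pXn2r ?nnegrE ?addr_ge0 // mulr_ge0 // mulr_ge0 // ltW.
    have -> : c * t ^+ 2 * half k ^+ 2 = K * (2 * (half k * t)) ^+ 2 by rewrite /c; ring.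
    by rewrite -mulrA -expr2 ler_pM2l.
  have h7 : nrm xi ^+ 2 + nrm eta ^+ 2 <= t ^+ 2 by rewrite /t; nra.
  have h8 : c * (half k * nrm xi) ^+ 2 + c * (half k * nrm eta) ^+ 2 <= c * t ^+ 2 * half k ^+ 2.
    have -> : c * (half k * nrm xi) ^+ 2 + c * (half k * nrm eta) ^+ 2 =
      c * half k ^+ 2 * (nrm xi ^+ 2 + nrm eta ^+ 2) by ring.
    have -> : c * t ^+ 2 * half k ^+ 2 = c * half k ^+ 2 * t ^+ 2 by ring.
    by rewrite ler_pM2l // mulr_gt0 // exprn_gt0.
  have -> : mu (a k) (b k) - (half k)%:C%C *: (xi + eta) = (mu (a k) (b k) - (a k + b k)) +
     ((a k - (half k)%:C%C *: xi) + (b k - (half k)%:C%C *: eta)).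
    have -> : (a k - (half k)%:C%C *: xi) + (b k - (half k)%:C%C *: eta) =
        (a k + b k) - ((half k)%:C%C *: xi + (half k)%:C%C *: eta).
      by rewrite opprD addrACA.
    by rewrite scalerDr addrA subrK.
  rewrite (le_trans (nrmD _ _)) // (le_trans (lerD (lexx _) (nrmD _ _))) //.
  have -> : 2 * c * t ^+ 2 * half k ^+ 2 = c * t ^+ 2 * half k ^+ 2 + c * t ^+ 2 * half k ^+ 2 by ring.
  by apply: lerD; [exact: le_trans h1 h6|apply: le_trans h8; exact: lerD].
have small k : nrm (mu (a k) (b k)) <= 2 * rho * half k.
  have h0 := half_gt0 k : 0 < half k :> R; have h1 := half_le1 k : half k <= 1 :> R.
  rewrite -(subrK ((half k)%:C%C *: (xi + eta)) (mu _ _)) (le_trans (nrmD _ _)) //.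
  have k1 := near k; have k2 := halfZ_le k (nrmD xi eta); rewrite -/t in k2.
  have k3 : 2 * c * t ^+ 2 * half k ^+ 2 <= t * half k.
    have -> : 2 * c * t ^+ 2 * half k ^+ 2 = (2 * (c * t) * half k) * (t * half k) by ring.
    rewrite -[leRHS]mul1r ler_wpM2r ?mulr_ge0 ?(ltW h0) //.
    have : 0 <= c * t by rewrite mulr_ge0 // ltW.
    move: ct2; move: (c * t) => w; nra.
  have k4 : t * half k <= rho * half k by rewrite ler_pM2r.
  have -> : 2 * rho * half k = rho * half k + rho * half k by ring.
  by apply: lerD; [exact: le_trans (le_trans k1 k3) k4|exact: le_trans k2 k4].
have mulr : nrm (mu (E xi) (E eta)) < r.
  have := small 0%N; rewrite /a /b half0 !scale1r mulr1 => h.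
  by rewrite (le_lt_trans h) // (le_lt_trans _ rhor) // ler_pM2r // ler_nat.
apply: (@koenigs_stable R m mu K r rho K0 mu00 mu_strict rho0 rhor rhoc E EP
  (xi + eta) (fun k => mu (a k) (b k)) (2 * c * t ^+ 2)) => //.
  by rewrite mulr_ge0 ?sqr_ge0 // mulr_ge0 // ltW.
move=> k; have [i1 i2] := iter_squaring_iota (small k) (leqnn k).
apply: (iota_inj i2 mulr).
have ea : nrm (a k) < r by apply: Elt; exact: halfZ_le'.
have eb : nrm (b k) < r by apply: Elt; exact: halfZ_le'.
rewrite i1 iota_mul // iota_mul; [|exact: Elt|exact: Elt].
by rewrite (koenigs_pow k xr) (koenigs_pow k yr) expgMn; last exact: com.
Qed.

Lemma natZ_le (p : nat) (eta : V) : nrm (p%:R *: eta) = p%:R * nrm eta.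
Proof. by rewrite nrmZ -(rmorph_nat (real_complex R)) nrmC ger0_norm. Qed.

Lemma koenigs_expg (p : nat) (eta : V) : p%:R * nrm eta <= rho ->
  iota (E (p%:R *: eta)) = (iota (E eta) ^+ p)%g.
Proof.
elim: p eta => [|p IH] eta pr.
  have i0 : iota 0 = 1%g.
    have h0 : nrm (0 : V) < r by rewrite nrm0.
    have := iota_mul h0 h0; rewrite mu00 => h.
    by apply: (mulIg (iota 0)); rewrite mul1g -h.
  by rewrite scale0r (koenigs0 K0 rho0 rhoc EP) i0 expg0.
have e0 := nrm_ge0 eta.
have pr' : p%:R * nrm eta + nrm eta <= rho by move: pr; rewrite -natr1 mulrDl mul1r.
have pp : p%:R * nrm eta <= rho by rewrite (le_trans _ pr') // lerDl.
have p1 : nrm eta <= rho by rewrite (le_trans _ pr') // lerDr mulr_ge0.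
rewrite -natr1 scalerDl scale1r -koenigs_add.
- rewrite iota_mul; [|by apply: Elt; rewrite natZ_le|exact: Elt].
  by rewrite IH // expgSr.
- by rewrite natZ_le.
move=> k; rewrite scalerA mulrC -scalerA IH.
  by apply: commute_sym; apply: commuteX.
rewrite nrm_halfZ mulrCA (le_trans _ pp) // -[leRHS]mul1r ler_wpM2r ?mulr_ge0 //.
exact: half_le1.
Qed.

Lemma koenigs_add_dyadic k (p l : nat) (xi : V) :
  (p%:R + l%:R) * half k * nrm xi <= rho ->
  mu (E ((p%:R * half k)%:C%C *: xi)) (E ((l%:R * half k)%:C%C *: xi)) =
    E (((p%:R + l%:R) * half k)%:C%C *: xi).
Proof.
move=> plr; have x0 := nrm_ge0 xi; have h0 := half_gt0 k : 0 < half k :> R.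
have e (q : nat) : (q%:R * half k)%:C%C *: xi = q%:R *: ((half k)%:C%C *: xi).
  by rewrite scalerA rmorphM rmorph_nat.
have w0 : 0 <= half k * nrm xi by rewrite mulr_ge0 // ltW.
have plr' : p%:R * (half k * nrm xi) + l%:R * (half k * nrm xi) <= rho.
  by move: plr; rewrite -mulrDl mulrA.
have l0 : 0 <= l%:R * (half k * nrm xi) by rewrite mulr_ge0.
have p0 : 0 <= p%:R * (half k * nrm xi) by rewrite mulr_ge0.
have h j (q : nat) : q%:R * (half k * nrm xi) <= rho ->
    iota (E ((half j)%:C%C *: (q%:R *: ((half k)%:C%C *: xi)))) =
    (iota (E ((half j)%:C%C *: ((half k)%:C%C *: xi))) ^+ q)%g.
  move=> qr; rewrite scalerA mulrC -scalerA koenigs_expg //.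
  rewrite !nrm_halfZ mulrCA (le_trans _ qr) // -[leRHS]mul1r.
  by apply: ler_wpM2r; [apply: mulr_ge0|exact: half_le1].
rewrite -natrD !e natrD scalerDl; apply: koenigs_add.
  by rewrite !natZ_le nrm_halfZ.
move=> j; rewrite !h; first by apply: commuteX2; exact: commute_refl.
- by rewrite (le_trans _ plr') // lerDr.
- by rewrite (le_trans _ plr') // lerDl.
Qed.

(** One-parameter subgroup law along real rays: dyadic parameters, then a limit. *)
Lemma koenigs_add_real (s t : R) (xi : V) : 0 <= s -> 0 <= t -> (s + t) * nrm xi <= rho ->
  mu (E (s%:C%C *: xi)) (E (t%:C%C *: xi)) = E ((s + t)%:C%C *: xi).
Proof.
move=> s0 t0 str; have x0 := nrm_ge0 xi.
have nZ (a : R) : 0 <= a -> nrm (a%:C%C *: xi) = a * nrm xi.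
  by move=> a0; rewrite nrmZ nrmC ger0_norm.
have sr : s * nrm xi <= rho by rewrite (le_trans _ str) // ler_wpM2r // lerDl.
have tr : t * nrm xi <= rho by rewrite (le_trans _ str) // ler_wpM2r // lerDr.
have dyad (a : R) k : 0 <= a -> exists p : nat, p%:R * half k <= a /\ a - p%:R * half k <= half k.
  move=> a0; have h0 := half_gt0 k : 0 < half k :> R.
  have p0 : 0 < 2 ^+ k :> R by rewrite exprn_gt0.
  have := truncn_itv (mulr_ge0 a0 (ltW p0)); set p := Num.trunc _ => /andP[l1 l2].
  have ea : a = a * 2 ^+ k * half k by rewrite -mulrA half_pow mulr1.
  exists p; split; first by rewrite [leRHS]ea ler_pM2r.
  rewrite [X in X - _]ea -mulrBl -[leRHS]mul1r ler_pM2r //.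
  by move: l2; rewrite -natr1; lra.
pose B := (2 + K * (4 * r) * 2) * (2 * nrm xi) * 2 + 4 * nrm xi.
have B0 : 0 <= B.
  have Kr : 0 <= K * (4 * r) by rewrite mulr_ge0 ?mulr_ge0 // ltW.
  rewrite /B; move: (K * (4 * r)) Kr => w w0.
  by have := mulr_ge0 w0 x0; lra.
apply: (@eq_of_half _ _ _ _ B B0) => k; have h0 := half_gt0 k : 0 < half k :> R.
have [p [p1 p2]] := dyad s k s0; have [l [l1 l2]] := dyad t k t0.
set s' := p%:R * half k in p1 p2; set t' := l%:R * half k in l1 l2.
have s'0 : 0 <= s' by rewrite mulr_ge0 // ltW.
have t'0 : 0 <= t' by rewrite mulr_ge0 // ltW.
have s'r : s' * nrm xi <= rho by rewrite (le_trans _ sr) // ler_wpM2r.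
have t'r : t' * nrm xi <= rho by rewrite (le_trans _ tr) // ler_wpM2r.
have st'r : (s' + t') * nrm xi <= rho by rewrite (le_trans _ str) // ler_wpM2r // lerD.
have eqd : mu (E (s'%:C%C *: xi)) (E (t'%:C%C *: xi)) = E ((s' + t')%:C%C *: xi).
  rewrite /s' /t' -mulrDl; apply: koenigs_add_dyadic.
  by rewrite mulrDl.
have dist (a a' : R) : 0 <= a -> 0 <= a' -> a' <= a -> a * nrm xi <= rho -> a' * nrm xi <= rho ->
    nrm (E (a%:C%C *: xi) - E (a'%:C%C *: xi)) <= 2 * ((a - a') * nrm xi).
  move=> a0 a'0 aa ar a'r; rewrite (le_trans (Elip _ _)) ?nZ //.
  by rewrite -scalerBl -rmorphB nZ ?subr_ge0.
have ds := dist s s' s0 s'0 p1 sr s'r; have dt := dist t t' t0 t'0 l1 tr t'r.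
have dst := dist (s + t) (s' + t') (addr_ge0 s0 t0) (addr_ge0 s'0 t'0) (lerD p1 l1) str st'r.
have ltE (a : R) : 0 <= a -> a * nrm xi <= rho -> nrm (E (a%:C%C *: xi)) < r.
  by move=> a0 ar; apply: Elt; rewrite nZ.
have m1 := mu_strict (ltE s s0 sr) (ltE t t0 tr) (ltE s' s'0 s'r) (ltE t' t'0 t'r).
rewrite -[X in nrm X](subrK (mu (E (s'%:C%C *: xi)) (E (t'%:C%C *: xi)))) [X in _ + X]eqd.
move: m1 ds dt dst (ltE s s0 sr) (ltE t t0 tr) (ltE s' s'0 s'r) (ltE t' t'0 t'r).
move: (E (s%:C%C *: xi)) (E (t%:C%C *: xi)) (E (s'%:C%C *: xi)) (E (t'%:C%C *: xi)).
move=> a b a' b' m1 ds dt dst ar br a'r b'r.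
have ds' : nrm (a - a') <= 2 * nrm xi * half k.
  rewrite (le_trans ds) // -mulrA ler_pM2l // mulrC ler_wpM2l //.
have dt' : nrm (b - b') <= 2 * nrm xi * half k.
  rewrite (le_trans dt) // -mulrA ler_pM2l // mulrC ler_wpM2l //.
have dst' : nrm (E ((s + t)%:C%C *: xi) - E ((s' + t')%:C%C *: xi)) <= 4 * nrm xi * half k.
  rewrite (le_trans dst) //.
  have -> : 4 * nrm xi * half k = 2 * ((2 * half k) * nrm xi) by ring.
  rewrite ler_pM2l // ler_wpM2r //.
  by move: p2 l2; lra.
have m2 : nrm (mu a b - mu a' b') <= (2 + K * (4 * r) * 2) * (2 * nrm xi) * 2 * half k.
  rewrite -(subrK ((a - a') + (b - b')) (mu a b - mu a' b')) (le_trans (nrmD _ _)) //.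
  have u0 := nrm_ge0 (a - a'); have v0 := nrm_ge0 (b - b').
  have m3 : K * (nrm a + nrm b + nrm a' + nrm b') * (nrm (a - a') + nrm (b - b')) <=
     K * (4 * r) * (2 * (2 * nrm xi * half k)).
    apply: ler_pM => //.
    - by rewrite mulr_ge0 ?(ltW K0) // !addr_ge0 ?nrm_ge0.
    - by rewrite addr_ge0.
    - by rewrite ler_pM2l //; lra.
    - by lra.
  have m4 := nrmD (a - a') (b - b').
  have w0 : 0 <= nrm xi * half k by rewrite mulr_ge0 // ltW.
  have Kr : 0 <= K * (4 * r) by rewrite mulr_ge0 ?mulr_ge0 // ltW.
  have -> : (2 + K * (4 * r) * 2) * (2 * nrm xi) * 2 * half k =
    K * (4 * r) * (2 * (2 * nrm xi * half k)) * 2 + 8 * (nrm xi * half k) by ring.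
  have e2 : 2 * nrm xi * half k = 2 * (nrm xi * half k) by ring.
  rewrite e2 in m3 ds' dt' *.
  have m5 : 0 <= K * (4 * r) * (2 * (2 * (nrm xi * half k))).
    by rewrite mulr_ge0 // mulr_ge0 // mulr_ge0.
  lra.
rewrite /B mulrDl.
have -> : mu a b - E ((s + t)%:C%C *: xi) - mu a' b' + E ((s' + t')%:C%C *: xi) =
   (mu a b - mu a' b') - (E ((s + t)%:C%C *: xi) - E ((s' + t')%:C%C *: xi)).
  exact: subr_shuffle.
by rewrite (le_trans (nrmB _ _)) // lerD.
Qed.

End Coordinates.

End LocalExponential.

(** * The local exponential of a complex Lie group *)

Section NearEqual.
Context {R : realType} {E E' : normedModType R[i]} {M : chartedType E} {N : chartedType E'}.

Lemma near_eq_holomorphic (f g : M -> N) (x : M) : (\forall y \near x, f y = g y) ->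
  holomorphic_at f x -> holomorphic_at g x /\
  forall v, differential g (x := x) v = differential f (x := x) v :> E'.
Proof.
move=> fg [cf df]; have fgx := nbhs_singleton fg.
have h : \forall u \near chart_at x x, local_expr f x u = local_expr g x u.
  have h1 := near_chart_inv (chart_at_dom x) fg.
  near=> u; rewrite /local_expr /= fgx; congr (chart_at _ _).
  by near: u.
have [h1 h2] := @near_eq_diff _ _ _ _ (local_expr g x) _ h df.
split; last by move=> v; exact: (congr1 (fun L => L v) h2).
split; last exact: h1.
move=> A gA; rewrite -fgx in gA.
by apply: filterS2 fg (cf A gA) => y fgy; rewrite /= fgy.
Unshelve. all: by end_near. Qed.

End NearEqual.

Section GroupMaps.
Context {R : realType} {m : nat} {G : complexLieGroupType R m}.

Lemma mulg_holomorphic_at (p : G * G) :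
  holomorphic_at (fun p : G * G => (p.1 * p.2)%g : G) p.
Proof. exact: (mulg_holomorphic p I). Qed.

Lemma invg_holomorphic_at (x : G) : holomorphic_at (fun p : G => p^-1%g : G) x.
Proof. exact: (invg_holomorphic x I). Qed.

End GroupMaps.

Section GroupCalculus.
Context {R : realType} {m : nat} {G : complexLieGroupType R m}.
Context {E : normedModType R[i]} {M : chartedType E}.
Implicit Types (f g : M -> G) (x : M).

Lemma holomorphic_mulg f g x : holomorphic_at f x -> holomorphic_at g x ->
  holomorphic_at (fun y => (f y * g y)%g) x /\
  forall v, differential (fun y => (f y * g y)%g : G) (x := x) v =
    differential (fun p : G * G => (p.1 * p.2)%g : G) (x := (f x, g x))
      (differential f (x := x) v, differential g (x := x) v).
Proof.
move=> hf hg; have [hp dp] := holomorphic_at_pair hf hg.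
have [h d] := holomorphic_at_comp hp (mulg_holomorphic_at (f x, g x)).
by split=> // v; rewrite d dp.
Qed.

Lemma holomorphic_invg f x : holomorphic_at f x ->
  holomorphic_at (fun y => (f y)^-1%g) x /\
  forall v, differential (fun y => (f y)^-1%g : G) (x := x) v =
    differential (fun p : G => p^-1%g : G) (x := f x) (differential f (x := x) v).
Proof. by move=> hf; exact: (holomorphic_at_comp hf (invg_holomorphic_at (f x))). Qed.

Lemma holomorphic_expg f x k : holomorphic_at f x -> holomorphic_at (fun y => (f y ^+ k)%g) x.
Proof.
move=> hf; elim: k => [|k IH].
  have -> : (fun y => (f y ^+ 0)%g) = (fun=> 1%g) by apply/funext => y; rewrite expg0.
  exact: holomorphic_at_cst.
have -> : (fun y => (f y ^+ k.+1)%g) = (fun y => (f y * f y ^+ k)%g).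
  by apply/funext => y; rewrite expgS.
by have [] := holomorphic_mulg hf IH.
Qed.

End GroupCalculus.

Section LeftTranslation.
Context {R : realType} {m : nat} {G : complexLieGroupType R m}.

Lemma holomorphic_left (g h : G) : holomorphic_at (fun k : G => (g * k)%g) h.
Proof.
have [hid _] := holomorphic_at_id h.
by have [] := holomorphic_mulg (holomorphic_at_cst g h) hid.
Qed.

Lemma holomorphic_mulL {E : normedModType R[i]} {M : chartedType E} (g : G)
    (f : M -> G) (x : M) : holomorphic_at f x ->
  holomorphic_at (fun y => (g * f y)%g) x /\
  forall v, differential (fun y => (g * f y)%g : G) (x := x) v =
    dL g (f x) (differential f (x := x) v).
Proof. by move=> hf; exact: (holomorphic_at_comp hf (holomorphic_left g (f x))). Qed.

Lemma dL_mulg (g h k : G) v : dL (g * h)%g k v = dL g (h * k)%g (dL h k v).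
Proof.
have [_ d] := holomorphic_mulL g (holomorphic_left h k).
rewrite -[RHS]d /dL; congr (differential _ v).
by apply/funext => l; rewrite mulgA.
Qed.

End LeftTranslation.

Section ProductNorm.
Context {R : realType} {V1 V2 : normedModType R[i]}.

Lemma nrm_prodE (p : V1 * V2) : nrm p = Num.max (nrm p.1) (nrm p.2).
Proof.
apply: complexI; rewrite -nrmE prod_normE !nrmE /Order.max ltcR.
by case: ifP.
Qed.

Lemma nrm_fst (p : V1 * V2) : nrm p.1 <= nrm p.
Proof. by rewrite nrm_prodE le_max lexx. Qed.

Lemma nrm_snd (p : V1 * V2) : nrm p.2 <= nrm p.
Proof. by rewrite nrm_prodE le_max lexx orbT. Qed.

Lemma nrm_prod_le (p : V1 * V2) : nrm p <= nrm p.1 + nrm p.2.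
Proof. by rewrite nrm_prodE ge_max lerDl lerDr !nrm_ge0. Qed.

Lemma nrm_prod_lt (p : V1 * V2) (r : R) : nrm p.1 < r -> nrm p.2 < r -> nrm p < r.
Proof. by rewrite nrm_prodE gt_max => -> ->. Qed.

End ProductNorm.

Section Inclusions.
Context {R : realType} {V W : normedModType R[i]}.

Lemma diff_incl1 (a v : V) : differentiable (fun x : V => (x, 0 : W)) a /\
  'd (fun x : V => (x, 0 : W)) a v = (v, 0).
Proof.
have d1 : differentiable (@idfun V) a by exact: (@ex_diff _ _ _ _ _ _ _ (is_diff_id a)).
have d2 : differentiable (cst (0 : W) : V -> W) a by exact: differentiable_cst.
split; first exact: (differentiable_pair d1 d2).
have := congr1 (fun L => L v) (diff_pair d1 d2).
by rewrite diff_id_eq diff_cst.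
Qed.

Lemma diff_slice (b : V) (a v : W) : differentiable (fun x : W => (b, x)) a /\
  'd (fun x : W => (b, x)) a v = (0, v).
Proof.
have d1 : differentiable (@idfun W) a by exact: (@ex_diff _ _ _ _ _ _ _ (is_diff_id a)).
have d2 : differentiable (cst b : W -> V) a by exact: differentiable_cst.
split; first exact: (differentiable_pair d2 d1).
have := congr1 (fun L => L v) (diff_pair d2 d1).
by rewrite diff_id_eq diff_cst.
Qed.

End Inclusions.

Section LocalGroup.
Context {R : realType} {m : nat} (G : complexLieGroupType R m).
Local Notation V := ('rV[R[i]]_m).
Local Notation psi := (chart_at (1%g : G)).
Local Notation o := (chart_at (1%g : G) (1%g : G)).

(** The coordinates of [chart_at 1] are translated so that [1] has coordinate [0]. *)
Definition chart_exp (x : V) : G := chart_inv psi (x + o).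
Local Notation iota := chart_exp.

Definition local_mul (x y : V) : V := psi (iota x * iota y)%g - o.
Local Notation mu := local_mul.

Lemma chart_exp0 : iota 0 = 1%g.
Proof. by rewrite /iota add0r chart_mapK //; exact: chart_at_dom. Qed.

Lemma local_mul0r x : chart_img psi (x + o) -> mu x 0 = x.
Proof. by move=> xi; rewrite /mu chart_exp0 mulg1 /iota chart_invK // addrK. Qed.

Lemma local_mul0l x : chart_img psi (x + o) -> mu 0 x = x.
Proof. by move=> xi; rewrite /mu chart_exp0 mul1g /iota chart_invK // addrK. Qed.

Lemma near_chart_img0 : exists2 r : R, 0 < r & forall x : V, nrm x < r -> chart_img psi (x + o).
Proof.
have /nbhs_nrmP[r r0 rP] := near_chart_img (chart_at_dom (1%g : G)).
by exists r => // x xr; apply: rP; rewrite addrK.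
Qed.

Lemma local_mul_near : exists2 r : R, 0 < r & forall x y : V, nrm x < r -> nrm y < r ->
  [/\ chart_img psi (x + o), chart_img psi (y + o), chart_dom psi (iota x * iota y)%g &
    differentiable (fun p : V * V => mu p.1 p.2) (x, y)].
Proof.
have [r1 r10 r1P] := near_chart_img0.
pose mul (p : G * G) : G := (p.1 * p.2)%g.
have cm : {for (1%g, 1%g), continuous mul} by have [] := mulg_holomorphic_at ((1%g, 1%g) : G * G).
have h : nbhs (1%g, 1%g) [set p | chart_dom psi (mul p)].
  by apply: cm; rewrite /mul /= mul1g; exact: near_chart_dom (chart_at_dom _).
have /nbhs_nrmP[r2 r20 r2P] := near_chart_inv (chart_at_dom ((1%g, 1%g) : G * G)) h.
exists (Num.min r1 r2); first by rewrite lt_min r10.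
move=> x y; rewrite !lt_min => /andP[x1 x2] /andP[y1 y2].
have xi := r1P x x1; have yi := r1P y y1.
have d : chart_dom psi (iota x * iota y)%g.
  have r2P' : forall u : V * V, nrm (u - (o, o)) < r2 ->
    chart_dom psi (mul (chart_inv psi u.1, chart_inv psi u.2)) := r2P.
  apply: (r2P' (x + o, y + o)).
  have -> : (x + o, y + o) - (o, o) = (x, y) :> V * V.
    by rewrite -[LHS]/(x + o - o, y + o - o) !addrK.
  exact: nrm_prod_lt.
split; [exact: xi|exact: yi|exact: d|].
pose z : G * G := (iota x, iota y).
have dz : chart_dom (chart_at ((1%g, 1%g) : G * G)) z by split; exact: chart_inv_dom.
have [de _] := expr_in_differentiable (mulg_holomorphic_at z) dz d.
have ze : chart_at ((1%g, 1%g) : G * G) z = (x, y) + (o, o).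
  by rewrite /z /= /iota !chart_invK.
rewrite ze in de.
apply: (@differentiableB _ _ _ (fun p : V * V => expr_in ((1%g, 1%g) : G * G) (1%g : G) mul (p + (o, o)))
   (fun=> o)); last exact: differentiable_cst.
exact: (@shift_differentiable _ (V * V)%type _ _ (x, y) (o, o)).
Qed.

(** The differential of the product at [(1, 1)] is addition, because [1] is neutral
    on both sides; the rest is the strict derivative of a holomorphic map. *)
Lemma local_mul_strict : exists r K : R, [/\ 0 < r, 0 < K,
  (forall x y : V, nrm x < r -> nrm y < r ->
    [/\ chart_img psi (x + o), chart_img psi (y + o), chart_dom psi (iota x * iota y)%g &
    differentiable (fun p : V * V => mu p.1 p.2) (x, y)]) &
  forall x y x' y' : V, nrm x < r -> nrm y < r -> nrm x' < r -> nrm y' < r ->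
  nrm (mu x y - mu x' y' - ((x - x') + (y - y'))) <=
    K * (nrm x + nrm y + nrm x' + nrm y') * (nrm (x - x') + nrm (y - y'))].
Proof.
have [r1 r10 r1P] := local_mul_near.
pose f (p : V * V) := mu p.1 p.2.
have df : \forall p \near (0, 0) : V * V, differentiable f p.
  apply/nbhs_nrmP; exists r1; first exact: r10.
  move=> p; rewrite subr0 => pr.
  have [_ _ _ h] := r1P p.1 p.2 (le_lt_trans (nrm_fst p) pr) (le_lt_trans (nrm_snd p) pr).
  by rewrite [p]surjective_pairing; exact: h.
have df0 := nbhs_singleton df.
have z0 : nrm (0 : V) < r1 by rewrite nrm0.
have dl (x : V) : 'd f (0, 0) (x, 0) = x.
  have [d1 e1] := @diff_incl1 R V V 0 x.
  have h : \forall u \near (0 : V), (f \o (fun x : V => (x, 0 : V))) u = idfun u.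
    apply/nbhs_nrmP; exists r1; first exact: r10.
    move=> u; rewrite subr0 => ur.
    by have [h _ _ _] := r1P u 0 ur z0; exact: local_mul0r.
  have [d e] := chain2 (erefl ((0 : V), (0 : V))) d1 df0.
  have [_ e2] := @near_eq_diff _ _ _ _ (@idfun V) _ h d.
  have := e x; rewrite e1 => <-.
  exact: (etrans (esym (congr1 (fun L : V -> V => L x) e2)) (congr1 (fun L => L x) (diff_id_eq 0))).
have dr (y : V) : 'd f (0, 0) (0, y) = y.
  have [d1 e1] := @diff_slice R V V 0 0 y.
  have h : \forall u \near (0 : V), (f \o (fun x : V => (0 : V, x))) u = idfun u.
    apply/nbhs_nrmP; exists r1; first exact: r10.
    move=> u; rewrite subr0 => ur.
    by have [h _ _ _] := r1P u 0 ur z0; exact: local_mul0l.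
  have [d e] := chain2 (erefl ((0 : V), (0 : V))) d1 df0.
  have [_ e2] := @near_eq_diff _ _ _ _ (@idfun V) _ h d.
  have := e y; rewrite e1 => <-.
  exact: (etrans (esym (congr1 (fun L : V -> V => L y) e2)) (congr1 (fun L => L y) (diff_id_eq 0))).
have dE (p : V * V) : 'd f (0, 0) p = p.1 + p.2.
  case: p => x y; have -> : (x, y) = (x, 0) + (0, y) :> V * V.
    by rewrite /GRing.add /= /add_pair /= addr0 add0r.
  by rewrite linearD dl dr /= addr0 add0r.
have [K [r2 [K0 r20 KP]]] := strict_rV df.
exists (Num.min r1 r2), (K + 1); split.
- by rewrite lt_min r10.
- by rewrite ltr_wpDl.
- by move=> x y; rewrite !lt_min => /andP[x1 _] /andP[y1 _]; exact: r1P.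
move=> x y x' y'; rewrite !lt_min => /andP[_ xr] /andP[_ yr] /andP[_ x'r] /andP[_ y'r].
have s (u v : V) : (u, v) - (0, 0) = (u, v) :> V * V by rewrite subr0.
have pr (u v : V) : nrm u < r2 -> nrm v < r2 -> nrm ((u, v) - (0, 0) : V * V) < r2.
  by move=> ur vr; rewrite s; exact: nrm_prod_lt.
have := KP (x, y) (x', y') (pr _ _ xr yr) (pr _ _ x'r y'r).
rewrite dE !s => h; apply: le_trans h _.
have n0 (u v : V) : 0 <= nrm u + nrm v by rewrite addr_ge0 ?nrm_ge0.
apply: ler_pM; rewrite ?nrm_ge0 //.
- by rewrite mulr_ge0 // addr_ge0 ?nrm_ge0.
- have h1 := nrm_prod_le (x, y); have h2 := nrm_prod_le (x', y').
  rewrite /= in h1 h2.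
  apply: ler_pM => //; first by rewrite addr_ge0 ?nrm_ge0.
    by rewrite lerDl.
  by rewrite -addrA lerD.
- exact: (nrm_prod_le ((x, y) - (x', y'))).
Qed.

Lemma local_exponential : exists (Ex : V -> V) (rho c : R),
  [/\ 0 < rho, 0 <= c,
    forall xi, nrm xi <= rho -> chart_img psi (Ex xi + o) /\ nrm (Ex xi - xi) <= c * nrm xi ^+ 2,
    forall xi, nrm xi < rho -> differentiable Ex xi &
    forall (s t : R) xi, 0 <= s -> 0 <= t -> (s + t) * nrm xi <= rho ->
      (iota (Ex (s%:C%C *: xi)) * iota (Ex (t%:C%C *: xi)))%g = iota (Ex ((s + t)%:C%C *: xi))].
Proof.
have [r [K [r0 K0 near strict]]] := local_mul_strict.
pose rho := Num.min (r / 8) (1 / (128 * K)).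
have rho0 : 0 < rho by rewrite lt_min !divr_gt0 // mulr_gt0.
have rhor : 4 * rho < r.
  have : rho <= r / 8 by rewrite ge_min lexx.
  lra.
have rhoc : 32 * (4 * K) * rho <= 1.
  have : rho <= 1 / (128 * K) by rewrite ge_min lexx orbT.
  rewrite ler_pdivlMr ?mulr_gt0 //; lra.
have z0 : nrm (0 : V) < r by rewrite nrm0.
have mu00 : mu 0 0 = 0 by have [h _ _ _] := near 0 0 z0 z0; rewrite local_mul0r.
have iota_mul (x y : V) : nrm x < r -> nrm y < r -> iota (mu x y) = (iota x * iota y)%g.
  by move=> xr yr; have [_ _ h _] := near x y xr yr; rewrite {1}/iota /mu subrK chart_mapK.
have iota_inj (x y : V) : nrm x < r -> nrm y < r -> iota x = iota y -> x = y.
  move=> xr yr xy; have [h1 h2 _ _] := near x y xr yr.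
  by apply: (addIr o); rewrite -(chart_invK h1) -(chart_invK h2) -/(iota x) xy.
have [Ex EP] := approx_exp_cvg K0 r0 mu00 strict rho0 rhor rhoc.
exists Ex, rho, (4 * K); split=> //.
- by rewrite mulr_ge0 // ltW.
- move=> xi xr; split; last exact: koenigs_quad EP xi xr.
  have h := koenigs_lt_r K0 rho0 rhor rhoc EP xr.
  by have [] := near _ _ h h.
- move=> xi xr.
  apply: (koenigs_differentiable K0 mu00 strict rho0 rhor rhoc EP) xr.
  move=> x xr; have [_ _ _ d] := near x x xr xr.
  have [d2 _] := @chain2 _ _ _ _ (fun x : V => (x, x)) (fun p : V * V => mu p.1 p.2) x (x, x)
     erefl (differentiable_pair (@ex_diff _ _ _ _ _ _ _ (is_diff_id x)) (@ex_diff _ _ _ _ _ _ _ (is_diff_id x))) d.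
  exact: d2.
move=> s t xi s0 t0 str.
rewrite -(koenigs_add_real K0 r0 mu00 strict rho0 rhor rhoc iota_mul iota_inj EP s0 t0 str).
have x0 := nrm_ge0 xi.
have lt (a : R) : 0 <= a -> a <= s + t -> nrm (Ex (a%:C%C *: xi)) < r.
  move=> a0 ast; apply: (koenigs_lt_r K0 rho0 rhor rhoc EP).
  by rewrite nrmZ nrmC ger0_norm // (le_trans _ str) // ler_wpM2r.
by rewrite iota_mul // lt // ?lerDl ?lerDr.
Qed.

End LocalGroup.

(** * Velocities of holomorphic curves in a group *)

Section Velocity.
Context {R : realType}.
Local Notation C := (R[i]^o).

(** A complex derivative is determined by the behaviour along one real ray; the
    subgroup law of the exponential is available along such rays only. *)
Lemma diff_unique_ray (W : normedModType R[i]) (F : C -> W) (a : C) (v : W) :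
  differentiable F a ->
  (forall e : R, 0 < e -> exists2 d : R, 0 < d & forall h : R, 0 < h -> h < d ->
     nrm (F (a + h%:C%C) - F a - h%:C%C *: v) <= e * h) ->
  'd F a (1 : C) = v.
Proof.
move=> dF Fv; apply/subr0_eq/nrm_eq0/le_anti; rewrite nrm_ge0 andbT.
apply/ler_addgt0Pl => e e0; rewrite addr0.
have e2 : 0 < e / 2 by rewrite divr_gt0.
have [d1 d10 P1] := diff_nrm dF e2; have [d2 d20 P2] := Fv _ e2.
pose h := Num.min d1 d2 / 2.
have m0 : 0 < Num.min d1 d2 by rewrite lt_min d10.
have h0 : 0 < h by rewrite divr_gt0.
have hm : h < Num.min d1 d2 by rewrite /h; lra.
move: (hm); rewrite lt_min => /andP[h1 h2].
have ah : a + h%:C%C - a = h%:C%C by rewrite addrC addKr.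
have k1 := P1 (a + h%:C%C); rewrite ah nrmC gtr0_norm // in k1.
have k2 := P2 h h0 h2.
have lin : 'd F a (h%:C%C : C) = h%:C%C *: 'd F a (1 : C).
  by rewrite -linearZ /=; congr ('d F a _); rewrite /GRing.scale /= mulr1.
rewrite lin in k1; have {}k1 := k1 h1.
rewrite -(ler_pM2l h0) -[X in X * nrm _](gtr0_norm h0) -nrmC -nrmZ.
have -> : h%:C%C *: ('d F a (1 : C) - v) =
  (F (a + h%:C%C) - F a - h%:C%C *: v) - (F (a + h%:C%C) - F a - h%:C%C *: 'd F a (1 : C)).
  by rewrite scalerBr opprB [RHS]addrC addrA subrK.
rewrite (le_trans (nrmB _ _)) //; lra.
Qed.

Lemma holomorphic_affine (t u : C) : holomorphic_at (fun h : C => t + h * u : C) (0 : C) /\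
  differential (fun h : C => t + h * u : C) (x := 0 : C) (1 : C) = u.
Proof.
have d0 : differentiable (fun h : C => t + h * u : C) (0 : C).
  apply: differentiableD; first exact: differentiable_cst.
  apply: differentiableM; last exact: differentiable_cst.
  exact: (@ex_diff _ _ _ _ _ _ _ (is_diff_id _)).
split.
  by split; [exact: differentiable_continuous|exact: d0].
apply: (diff_unique_ray d0) => e e0; exists 1 => // h h0 _.
have -> : t + (0 + h%:C%C) * u - (t + 0 * u) - h%:C%C *: u = 0 :> C.
  by rewrite /GRing.scale /=; ring.
by rewrite nrm0 mulr_ge0 // ltW.
Qed.

Context {m : nat} {G : complexLieGroupType R m}.
Implicit Types (A B P Q : C -> G).

Lemma differential_scale A (t u : C) :
  differential A (x := t) u = u *: (differential A (x := t) (1 : C) : 'rV[R[i]]_m).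
Proof.
by rewrite /differential -linearZ /=; congr ('d _ _ _); rewrite /GRing.scale /= mulr1.
Qed.

Lemma agree_ray A B : holomorphic_at A (0 : C) -> holomorphic_at B (0 : C) ->
  (forall h : R, 0 <= h -> A h%:C%C = B h%:C%C) ->
  differential A (x := 0 : C) (1 : C) = differential B (x := 0 : C) (1 : C) :> 'rV[R[i]]_m.
Proof.
move=> [_ dA] [_ dB] AB; apply: (diff_unique_ray dA) => e e0.
have [d d0 dP] := diff_nrm dB e0; exists d => // h h0 hd.
have E k : 0 <= k -> local_expr A (0 : C) (k%:C%C : C) = local_expr B (0 : C) (k%:C%C : C).
  by move=> k0; rewrite /local_expr /= (AB k k0) (AB 0 (lexx 0)).
have := dP (0 + h%:C%C); rewrite /= subr0 add0r nrmC gtr0_norm // => /(_ hd).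
rewrite (E h (ltW h0)) (E 0 (lexx 0)) /differential /=.
have -> : 'd (local_expr B (0 : C)) (0 : C) (h%:C%C : C) =
   h%:C%C *: 'd (local_expr B (0 : C)) (0 : C) (1 : C).
  by rewrite -linearZ /=; congr ('d _ _ _); rewrite /GRing.scale /= mulr1.
exact.
Qed.

Lemma line_velocity A (t u : C) : holomorphic_at A t ->
  holomorphic_at (fun h : C => A (t + h * u)) (0 : C) /\
  differential (fun h : C => A (t + h * u)) (x := 0 : C) (1 : C) =
    u *: (differential A (x := t) (1 : C) : 'rV[R[i]]_m).
Proof.
move=> hA; have [ha da] := holomorphic_affine t u.
have t0 : t + 0 * u = t by rewrite mul0r addr0.
have hA' : holomorphic_at A (t + 0 * u) by rewrite t0.
have [h d] := holomorphic_at_comp ha hA'.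
split; first exact: h.
have aux t' : t' = t -> differential A (x := t') u = u *: (differential A (x := t) (1 : C)
    : 'rV[R[i]]_m) by move=> ->; exact: differential_scale.
exact: (etrans (d 1) (etrans (congr1 _ da) (aux _ t0))).
Qed.

(** The differential of a product of curves involves the first curve only through
    its value and its velocity. *)
Lemma same_velocity P1 P2 Q : holomorphic_at P1 (0 : C) -> holomorphic_at P2 (0 : C) ->
  holomorphic_at Q (0 : C) -> P1 0 = P2 0 ->
  differential P1 (x := 0 : C) (1 : C) = differential P2 (x := 0 : C) (1 : C) :> 'rV[R[i]]_m ->
  differential (fun h => (P1 h * Q h)%g) (x := 0 : C) (1 : C) =
  differential (fun h => (P2 h * Q h)%g) (x := 0 : C) (1 : C) :> 'rV[R[i]]_m.
Proof.
move=> h1 h2 hQ e12 d12.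
have [_ e1] := holomorphic_mulg h1 hQ; have [_ e2] := holomorphic_mulg h2 hQ.
have aux (a b q : G) (v w z : 'rV[R[i]]_m) : a = b -> v = w ->
    differential (fun p : G * G => (p.1 * p.2)%g : G) (x := (a, q)) (v, z) =
    differential (fun p : G * G => (p.1 * p.2)%g : G) (x := (b, q)) (w, z) :> 'rV[R[i]]_m.
  by move=> -> ->.
exact: (etrans (e1 1) (etrans (aux _ _ _ _ _ _ e12 d12) (esym (e2 1)))).
Qed.

(** In the chart at the value the differential vanishes near [t0], so the mean
    value inequality applies. *)
Lemma zero_velocity_local A (t0 : C) : (forall t, holomorphic_at A t) ->
  (forall t, differential A (x := t) (1 : C) = 0 :> 'rV[R[i]]_m) ->
  exists2 d : R, 0 < d & forall t, nrm (t - t0) < d -> A t = A t0.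
Proof.
move=> hA dA.
have [cA _] := hA t0.
have /nbhs_nrmP[d d0 dP] := cA _ (near_chart_dom (chart_at_dom (A t0))).
exists d => // t td.
pose F : C -> 'rV[R[i]]_m := expr_in t0 (A t0) A.
have dF s : nrm (s - t0) < d -> differentiable F s /\ forall v, 'd F s v = 0.
  move=> sd; have [h1 h2] := expr_in_differentiable (p := t0) (q := A t0) (hA s) I (dP s sd).
  split; first exact: h1.
  by move=> v; rewrite (h2 v) differential_scale dA scaler0 linear0.
suff FE : F t = F t0.
  have t0d : nrm (t0 - t0) < d by rewrite subrr nrm0.
  exact: (etrans (esym (chart_mapK (dP t td))) (etrans
    (congr1 (chart_inv (chart_at (A t0))) FE) (chart_mapK (dP t0 t0d)))).
apply/subr0_eq/nrm_eq0/le_anti; rewrite nrm_ge0 andbT.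
pose phi (s : R) := F (t0 + s%:C%C * (t - t0)).
have -> : F t = phi 1 by rewrite /phi mul1r addrC subrK.
have -> : F t0 = phi 0 by rewrite /phi mul0r addr0.
apply: mean_value => s /andP[s0 s1] e e0.
pose x : C := t0 + s%:C%C * (t - t0).
have xd : nrm (x - t0) < d.
  rewrite /x addrC addKr nrmM nrmC ger0_norm // (le_lt_trans _ td) //.
  by rewrite -[leRHS]mul1r ler_wpM2r ?nrm_ge0.
have [dx zx] := dF x xd.
have ed : 0 < e / d by rewrite divr_gt0.
have [d' d'0 d'P] := diff_nrm dx ed.
exists (d' / d); first by rewrite divr_gt0.
move=> r _ rs; pose y : C := t0 + r%:C%C * (t - t0).
have yx : nrm (y - x) <= `|r - s| * d.
  have -> : y - x = (r - s)%:C%C * (t - t0) by rewrite /y /x rmorphB; ring.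
  by rewrite nrmM nrmC ler_wpM2l // ltW.
have := d'P y; rewrite zx subr0 -/(phi r) -/(phi s) => h.
rewrite add0r (le_trans (h _)) //.
  by rewrite (le_lt_trans yx) // -ltr_pdivlMr.
rewrite (@le_trans _ _ (e / d * (`|r - s| * d))) ?ler_pM2l //.
by rewrite le_eqVlt; apply/orP; left; apply/eqP; field; rewrite gt_eqF.
Qed.

(** Locally constant along the segment from [0] to [1]: the mean value
    inequality applied to the indicator of the value at [0]. *)
Lemma zero_velocity_const A : (forall t, holomorphic_at A t) ->
  (forall t, differential A (x := t) (1 : C) = 0 :> 'rV[R[i]]_m) -> A 1 = A 0.
Proof.
move=> hA dA; pose phi (s : R) : C := if pselect (A s%:C%C = A 0) then 0 else 1.
have h : nrm (phi 1 - phi 0) <= 0.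
  apply: mean_value => s _ e e0.
  have [d d0 dP] := zero_velocity_local s%:C%C hA dA.
  exists d => // r _ rs; rewrite /phi (dP r%:C%C) ?subrr ?nrm0 ?mulr_ge0 ?add0r ?(ltW e0) //.
  by rewrite -rmorphB nrmC.
have : phi 1 = phi 0 by apply/subr0_eq/nrm_eq0/le_anti; rewrite h nrm_ge0.
rewrite /phi; case: pselect => [e1 _|n1]; first exact: e1.
case: pselect => [_ /eqP|n0 _]; first by rewrite oner_eq0.
by case: n0.
Qed.

End Velocity.

(** * The global exponential and integral curves *)

Section GlobalExponential.
Context {R : realType} {m : nat} (G : complexLieGroupType R m).
Local Notation V := ('rV[R[i]]_m).
Local Notation C := (R[i]^o).
Local Notation psi := (chart_at (1%g : G)).
Local Notation o := (chart_at (1%g : G) (1%g : G)).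
Local Notation iota := (@chart_exp R m G).

Lemma half_scale_near (b r : R) : 0 < r -> exists k, b * half k < r.
Proof.
move=> r0; have b1 : 0 < `|b| + 1 by rewrite ltr_wpDl.
have [k kP] := half_pow_small (divr_gt0 r0 b1); exists k.
rewrite (@le_lt_trans _ _ ((`|b| + 1) * half k)) //.
  by rewrite ler_wpM2r ?(ltW (half_gt0 k)) // (le_trans (ler_norm _)) // lerDl.
by rewrite mulrC -ltr_pdivlMr.
Qed.

Lemma chart_exp_holomorphic (b : C -> V) (t : C) : differentiable b t ->
  (\forall s \near t, chart_img psi (b s + o)) -> holomorphic_at (fun s : C => iota (b s)) t.
Proof.
move=> db nb; have bi := nbhs_singleton nb.
have dbo : differentiable (fun s : C => b s + o) t.
  by apply: differentiableD; [exact: db|exact: differentiable_cst].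
have ca : {for t, continuous (fun s : C => iota (b s))}.
  apply: (@continuous_comp _ _ _ (fun s : C => b s + o) (chart_inv psi)).
    exact: (differentiable_continuous dbo).
  exact: chart_inv_continuous.
apply: (@holomorphic_at_expr _ _ _ _ _ _ t t 1%g ca I).
  exact: chart_inv_dom.
have h : \forall s \near t, (b s + o) = expr_in t (1%g : G) (fun s : C => iota (b s)) s.
  by apply: filterS nb => s bs; exact: (esym (chart_invK bs)).
exact: (proj1 (@near_eq_diff _ _ _ (fun s => b s + o) (expr_in t (1%g : G) (fun s : C => iota (b s))) t h dbo)).
Qed.

Lemma scale_line_diff (a : R[i]) (xi : V) (t : C) :
  differentiable (fun s : C => a *: (s *: xi) : V) t.
Proof.
apply: (@differentiableZ _ _ _ (fun s : C => s *: xi)).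
exact: (@differentiableZl _ _ _ (@idfun C) xi t (@ex_diff _ _ _ _ _ _ _ (is_diff_id t))).
Qed.

(** The [2 ^ k]-th power of the local exponential at [xi / 2 ^ k] depends on [k]
    only as long as [xi / 2 ^ k] is outside the ball of radius [rho].  Each
    property is checked with one [k] that serves all the vectors involved. *)
Lemma global_exponential : exists ex : V -> G,
  [/\ exists (Ex : V -> V) (rho c : R), [/\ 0 < rho, 0 <= c & forall xi : V, nrm xi <= rho ->
        [/\ ex xi = iota (Ex xi), chart_img psi (Ex xi + o) & nrm (Ex xi - xi) <= c * nrm xi ^+ 2]],
    forall (s t : R) (xi : V), 0 <= s -> 0 <= t ->
      (ex (s%:C%C *: xi) * ex (t%:C%C *: xi))%g = ex ((s + t)%:C%C *: xi),
    forall (xi : V) (t : C), holomorphic_at (fun s : C => ex (s *: xi)) t,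
    forall xi : V, differential (fun s : C => ex (s *: xi)) (x := 0 : C) (1 : C) = xi :> V &
    ex 0 = 1%g].
Proof.
have [Ex [rho [c [rho0 c0 Eimg Ediff Eadd]]]] := local_exponential G.
pose hexp k (xi : V) : G := (iota (Ex ((half k)%:C%C *: xi)) ^+ (2 ^ k))%g.
have hs k (xi : V) : nrm ((half k)%:C%C *: xi) = nrm xi * half k.
  by rewrite nrm_halfZ mulrC.
have step k (xi : V) : nrm xi * half k <= rho -> hexp k.+1 xi = hexp k xi.
  move=> xr; rewrite /hexp expnS expgnA; congr (_ ^+ _)%g.
  have h2 : (half k.+1)%:C%C *: xi = (2^-1 : R)%:C%C *: ((half k)%:C%C *: xi).
    by rewrite scalerA -rmorphM; congr (_%:C%C *: _); rewrite /half exprS.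
  have h1 : 2^-1 + 2^-1 = 1 :> R by lra.
  rewrite expg2 h2 Eadd ?invr_ge0 // h1; first by rewrite scale1r.
  by rewrite mul1r hs.
have stable k j (xi : V) : nrm xi * half k <= rho -> hexp (k + j)%N xi = hexp k xi.
  move=> xr; elim: j => [|j IH]; first by rewrite addn0.
  rewrite addnS step // halfD mulrA (le_trans _ xr) // -[leRHS]mulr1.
  by rewrite ler_wpM2l ?half_le1 // mulr_ge0 ?nrm_ge0 // ltW // half_gt0.
have scale_ex (xi : V) : exists k, nrm xi * half k <= rho.
  by have [k kP] := half_scale_near (nrm xi) rho0; exists k; exact: ltW.
have [kk kkP] := choice scale_ex.
pose ex xi := hexp (kk xi) xi.
have exE k (xi : V) : nrm xi * half k <= rho -> ex xi = hexp k xi.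
  by move=> xr; rewrite /ex -(stable (kk xi) k) // addnC stable.
have ex_loc (xi : V) : nrm xi <= rho -> ex xi = iota (Ex xi).
  move=> xr; rewrite (exE 0%N) ?half0 ?mulr1 // /hexp half0 scale1r expn0 expg1 //.
have E0 : Ex 0 = 0.
  have z0 : nrm (0 : V) <= rho by rewrite nrm0 ltW.
  have [_ h] := Eimg 0 z0; apply: nrm_eq0; apply: le_anti.
  by rewrite nrm_ge0 andbT; move: h; rewrite nrm0 expr0n /= mulr0 subr0.
have ex0 : ex 0 = 1%g by rewrite ex_loc ?nrm0 ?(ltW rho0) // E0 chart_exp0.
have exhol xi (t : C) : holomorphic_at (fun s : C => ex (s *: xi)) t.
  have [k kP] := half_scale_near ((nrm t + 1) * nrm xi) rho0.
  have bnd (s : C) : nrm (s - t) < 1 -> nrm (s *: xi) * half k < rho.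
    move=> st; rewrite (le_lt_trans _ kP) // ler_wpM2r ?(ltW (half_gt0 k)) //.
    rewrite nrmZ ler_wpM2r ?nrm_ge0 // -(subrK t s) addrC (le_trans (nrmD _ _)) //.
    by rewrite lerD2l ltW.
  have near1 : \forall s \near t, nrm (s - t) < 1 by apply/nbhs_nrmP; exists 1.
  have tt : nrm (t - t) < 1 by rewrite subrr nrm0.
  have hb : differentiable (fun s : C => Ex ((half k)%:C%C *: (s *: xi))) t.
    apply: (@differentiable_comp _ _ _ _ (fun s : C => (half k)%:C%C *: (s *: xi)) Ex).
      exact: scale_line_diff.
    by apply: Ediff; rewrite hs; exact: bnd.
  have hi : \forall s \near t, chart_img psi (Ex ((half k)%:C%C *: (s *: xi)) + o).
    apply: filterS near1 => s st.
    have sr : nrm ((half k)%:C%C *: (s *: xi)) <= rho by rewrite hs ltW // bnd.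
    exact: (proj1 (Eimg _ sr)).
  have hh := holomorphic_expg (2 ^ k) (chart_exp_holomorphic hb hi).
  have hn : \forall s \near t, (iota (Ex ((half k)%:C%C *: (s *: xi))) ^+ (2 ^ k))%g = ex (s *: xi).
    by apply: filterS near1 => s st; rewrite (exE k) // ltW // bnd.
  exact: (proj1 (near_eq_holomorphic hn hh)).
exists ex; split.
- exists Ex, rho, c; split; [exact: rho0|exact: c0|].
  by move=> xi xr; have [h1 h2] := Eimg xi xr; split; [exact: ex_loc|exact: h1|exact: h2].
- move=> s t xi s0 t0.
  have [k kP] := half_scale_near ((s + t) * nrm xi) rho0.
  have st0 := addr_ge0 s0 t0.
  have nZ (a : R) : 0 <= a -> a <= s + t -> nrm (a%:C%C *: xi) * half k <= rho.
    move=> a0 ast; rewrite (le_trans _ (ltW kP)) // ler_wpM2r ?(ltW (half_gt0 k)) //.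
    by rewrite nrmZ nrmC ger0_norm // ler_wpM2r // nrm_ge0.
  have sw (a : R) : (half k)%:C%C *: (a%:C%C *: xi) = a%:C%C *: ((half k)%:C%C *: xi).
    by rewrite !scalerA mulrC.
  rewrite (exE k (s%:C%C *: xi)) ?nZ ?lerDl // (exE k (t%:C%C *: xi)) ?nZ ?lerDr //.
  rewrite (exE k ((s + t)%:C%C *: xi)) ?nZ //.
  rewrite /hexp !sw.
  have sr : (s + t) * nrm ((half k)%:C%C *: xi) <= rho by rewrite hs mulrA ltW.
  have ts : (t + s) * nrm ((half k)%:C%C *: xi) <= rho by rewrite [t + s]addrC.
  have e1 := Eadd _ _ _ s0 t0 sr; have e2 := Eadd _ _ _ t0 s0 ts.
  rewrite [t + s]addrC in e2.
  have cm := etrans e1 (esym e2).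
  exact: (etrans (esym (expgMn (2 ^ k) cm)) (congr1 (fun g : G => g ^+ (2 ^ k))%g e1)).
- exact: exhol.
- move=> xi; have [_ dh] := exhol xi 0.
  apply: (diff_unique_ray dh) => e e0.
  have x1 : 0 < nrm xi + 1 by rewrite ltr_wpDl // nrm_ge0.
  have cx : 0 < c * nrm xi ^+ 2 + 1 by rewrite ltr_wpDl // mulr_ge0 // exprn_ge0 // nrm_ge0.
  exists (Num.min (rho / (nrm xi + 1)) (e / (c * nrm xi ^+ 2 + 1))).
    by rewrite lt_min !divr_gt0.
  move=> h h0; rewrite lt_min => /andP[h1 h2].
  have hx : nrm (h%:C%C *: xi) = h * nrm xi by rewrite nrmZ nrmC gtr0_norm.
  have hr : nrm (h%:C%C *: xi) <= rho.
    rewrite hx (@le_trans _ _ (h * (nrm xi + 1))) ?ler_pM2l ?lerDl //.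
    by rewrite -ler_pdivlMr // ltW.
  have [img quad] := Eimg _ hr.
  have e1 : local_expr (fun s : C => ex (s *: xi)) (0 : C) (0 + h%:C%C : C) = Ex (h%:C%C *: xi) + o.
    rewrite /local_expr /= scale0r ex0 add0r ex_loc //.
    by rewrite /chart_exp chart_invK.
  have e2 : local_expr (fun s : C => ex (s *: xi)) (0 : C) (0 : C) = o.
    by rewrite /local_expr /= scale0r ex0.
  rewrite /= e1 e2 addrK (le_trans quad) // hx.
  have -> : c * (h * nrm xi) ^+ 2 = (c * nrm xi ^+ 2 * h) * h by ring.
  rewrite ler_pM2r // (@le_trans _ _ ((c * nrm xi ^+ 2 + 1) * h)) ?ler_pM2r ?lerDl //.
  by rewrite mulrC -ler_pdivlMr // ltW.
- exact: ex0.
Qed.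

Section IntegralCurves.
Variable ex : V -> G.
Hypothesis ex_add : forall (s t : R) (xi : V), 0 <= s -> 0 <= t ->
  (ex (s%:C%C *: xi) * ex (t%:C%C *: xi))%g = ex ((s + t)%:C%C *: xi).
Hypothesis ex_hol : forall (xi : V) (t : C), holomorphic_at (fun s : C => ex (s *: xi)) t.
Hypothesis ex_vel : forall xi : V,
  differential (fun s : C => ex (s *: xi)) (x := 0 : C) (1 : C) = xi :> V.
Hypothesis ex0 : ex 0 = 1%g.

(** Additivity holds along real rays, and every complex time lies on one. *)
Lemma ray_of (t : C) : exists (u : C) (s : R), [/\ u != 0, 0 <= s & t = s%:C%C * u].
Proof.
have [->|t0] := eqVneq t 0; first by exists 1, 0; rewrite mul0r oner_eq0.
by exists t, 1; rewrite mul1r.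
Qed.

Lemma ray_add (xi : V) (u : C) (s h : R) : 0 <= s -> 0 <= h ->
  ex ((s%:C%C * u + h%:C%C * u) *: xi) = (ex ((s%:C%C * u) *: xi) * ex ((h%:C%C * u) *: xi))%g.
Proof.
move=> s0 h0; rewrite -mulrDl -rmorphD -scalerA -ex_add // !scalerA //.
Qed.

Lemma line_exp_velocity (xi : V) (u : C) :
  holomorphic_at (fun h : C => ex ((h * u) *: xi)) (0 : C) /\
  differential (fun h : C => ex ((h * u) *: xi)) (x := 0 : C) (1 : C) = u *: xi :> V.
Proof.
have e : (fun h : C => ex ((h * u) *: xi)) = (fun h : C => ex (h *: (u *: xi))).
  by apply/funext => h; rewrite scalerA.
by rewrite e; split; [exact: ex_hol|exact: ex_vel].
Qed.

(** Moving away from [t] along the real ray through [t], the curve is the left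
    translate by [ex (t *: xi)] of its beginning. *)
Lemma exp_velocity (xi : V) (t : C) :
  differential (fun s : C => ex (s *: xi)) (x := t) (1 : C) = dL (ex (t *: xi)) 1%g xi :> V.
Proof.
have [u [s [u0 s0 ->]]] := ray_of t.
pose t' : C := s%:C%C * u.
have [hA dA] := line_velocity u (ex_hol xi t').
have [hl dl] := line_exp_velocity xi u.
have [hB dB] := holomorphic_mulL (ex (t' *: xi)) hl.
have AB := agree_ray hA hB (fun h h0 => ray_add xi u s0 h0).
have aux (g : G) v : g = 1%g -> dL (ex (t' *: xi)) g v = dL (ex (t' *: xi)) 1%g v :> V.
  by move=> ->.
have e0 : ex ((0 * u) *: xi) = 1%g by rewrite mul0r scale0r.
have dLZ : dL (ex (t' *: xi)) 1%g (u *: xi) = u *: (dL (ex (t' *: xi)) 1%g xi : V) :> V.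
  by rewrite /dL /differential linearZ.
have := etrans (esym dA) (etrans AB (etrans (dB 1) (etrans (congr1 _ dl) (etrans (aux _ _ e0) dLZ)))).
exact: scalerI.
Qed.

Lemma translated_exp_curve (g : G) (xi : V) :
  @integral_curve R m G g (dL g 1%g xi) (fun t : C => (g * ex (t *: xi))%g).
Proof.
split.
- by move=> t _; have [] := holomorphic_mulL g (ex_hol xi t).
- by rewrite scale0r ex0 mulg1.
- move=> t; have [_ d] := holomorphic_mulL g (ex_hol xi t).
  apply: (etrans (d 1)); apply: (etrans (congr1 _ (exp_velocity xi t))).
  have e1 := @dL_mulg R m G g (ex (t *: xi)) 1%g xi.
  have e2 := @dL_mulg R m G (g * ex (t *: xi) * g^-1)%g g 1%g xi.
  have aux (h h' k k' : G) (v : V) : h = h' -> k = k' -> dL h k v = dL h' k' v :> V.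
    by move=> -> ->.
  apply: (etrans (aux _ _ _ _ _ erefl (esym (mulg1 _)))).
  apply: (etrans (esym e1)).
  apply: (etrans (aux _ _ _ _ _ (esym (mulgVK g (g * ex (t *: xi))%g)) erefl)).
  apply: (etrans e2).
  exact: (aux (g * ex (t *: xi) * g^-1)%g (g * ex (t *: xi) * g^-1)%g (g * 1)%g g
    (dL g 1%g xi) erefl (mulg1 g)).
Qed.

(** The curve [gamma t * ex (t xi) ^-1] has zero velocity: near [t], [gamma] can be
    replaced to first order by [gamma t * ex (h xi)], which turns the product into
    a constant. *)
Lemma integral_curve_unique (g : G) (xi : V) (gamma : C -> G) :
  @integral_curve R m G g (dL g 1%g xi) gamma -> gamma 1 = (g * ex xi)%g.
Proof.
move=> [hg g0 dg].
have dgE t : differential gamma (x := t) (1 : C) = dL (gamma t) 1%g xi :> V.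
  apply: (etrans (dg t)).
  have e2 := @dL_mulg R m G (gamma t * g^-1)%g g 1%g xi.
  have aux (h h' k k' : G) (v : V) : h = h' -> k = k' -> dL h k v = dL h' k' v :> V.
    by move=> -> ->.
  apply: (etrans (aux _ _ _ _ _ erefl (esym (mulg1 g)))).
  apply: (etrans (esym e2)).
  exact: (aux _ _ _ _ _ (mulgVK g (gamma t)) erefl).
pose beta (t : C) : G := (gamma t * (ex (t *: xi))^-1)%g.
have hbeta t : holomorphic_at beta t.
  exact: (proj1 (holomorphic_mulg (hg t I) (proj1 (holomorphic_invg (ex_hol xi t))))).
have dbeta t : differential beta (x := t) (1 : C) = 0 :> V.
  have [u [s [u0 s0 tE]]] := ray_of t.
  have [hA dA] := line_velocity u (hbeta t).
  have [hP dP] := line_velocity u (hg t I).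
  have [hl dl] := line_exp_velocity xi u.
  pose Q (h : C) : G := ((ex ((h * u) *: xi))^-1 * (ex (t *: xi))^-1)%g.
  have hQ : holomorphic_at Q (0 : C).
    exact: (proj1 (holomorphic_mulg (proj1 (holomorphic_invg hl)) (holomorphic_at_cst _ _))).
  pose P2 (h : C) : G := (gamma t * ex ((h * u) *: xi))%g.
  have [hP2 dP2] := holomorphic_mulL (gamma t) hl.
  have P20 : gamma (t + 0 * u) = P2 0.
    by rewrite /P2 mul0r addr0 scale0r ex0 mulg1.
  have dPP2 : differential (fun h : C => gamma (t + h * u)) (x := 0 : C) (1 : C) =
      differential P2 (x := 0 : C) (1 : C) :> V.
    apply: (etrans dP); apply: (etrans (congr1 _ (dgE t))).
    apply: esym; apply: (etrans (dP2 1)); apply: (etrans (congr1 _ dl)).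
    have aux (k : G) v : k = 1%g -> dL (gamma t) k v = dL (gamma t) 1%g v :> V.
      by move=> ->.
    have e0 : ex ((0 * u) *: xi) = 1%g by rewrite mul0r scale0r.
    apply: (etrans (aux _ _ e0)).
    by rewrite /dL /differential linearZ.
  have hB : holomorphic_at (fun h : C => (gamma (t + h * u) * Q h)%g) (0 : C).
    exact: (proj1 (holomorphic_mulg hP hQ)).
  have AB : forall h : R, 0 <= h ->
      beta (t + h%:C%C * u) = (gamma (t + h%:C%C * u) * Q h%:C%C)%g.
    move=> h h0; rewrite /beta /Q; congr (_ * _)%g.
    by rewrite -invgM tE -ray_add.
  have B0 := same_velocity hP hP2 hQ P20 dPP2.
  have Bc : (fun h : C => (P2 h * Q h)%g) = (fun=> (gamma t * (ex (t *: xi))^-1)%g).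
    by apply/funext => h; rewrite /P2 /Q mulgA mulgK.
  have := etrans (esym dA) (etrans (agree_ray hA hB AB) B0).
  rewrite Bc => h0; apply: (scalerI u0); rewrite scaler0.
  exact: (etrans h0 (@differential_cst R _ _ _ _ (gamma t * (ex (t *: xi))^-1)%g (0 : C) (1 : C))).
have := zero_velocity_const hbeta dbeta; rewrite /beta scale0r ex0 invg1 mulg1 scale1r g0.
by move=> <-; rewrite mulgVK.
Qed.

Lemma exp_atE (g : G) (xi : V) : exp_at g (dL g 1%g xi) = (g * ex xi)%g.
Proof.
rewrite /exp_at; apply: integral_curve_unique.
exact: (@xgetPex _ (fun=> g) (@integral_curve R m G g (dL g 1%g xi))
   (ex_intro _ _ (translated_exp_curve g xi))).
Qed.

Lemma zoomE (eps : m.-tuple (tangent (1%g : G))) (p : G) (r : R) (z : V) :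
  zoom eps p r z = (p * ex (r%:C%C *: (\sum_(k < m) z 0 k *: (tnth eps k : V))))%g.
Proof.
rewrite -exp_atE /zoom; congr (exp_at p _).
by rewrite /dL /differential linearZ.
Qed.

End IntegralCurves.

End GlobalExponential.

(** * Multiplication near a moving base point *)

Section MovingChart.
Context {R : realType} {m : nat} (G : complexLieGroupType R m).
Local Notation V := ('rV[R[i]]_m).
Local Notation psi := (chart_at (1%g : G)).
Local Notation o := (chart_at (1%g : G) (1%g : G)).
Local Notation iota := (@chart_exp R m G).

Section AtPoint.
Variable p0 : G.
Local Notation phi := (chart_at p0).
Local Notation u0 := (chart_at p0 p0).

(** The base point [p.1] moves while the chart stays the one at [p0]. *)
Definition right_mul (p : V * V) : V := phi (chart_inv phi p.1 * iota p.2)%g.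

Lemma right_mul_near (A : set G) : nbhs p0 A -> exists2 r : R, 0 < r &
  forall u x : V, nrm (u - u0) < r -> nrm x < r ->
  [/\ chart_img phi u, chart_img psi (x + o), A (chart_inv phi u * iota x)%g,
    chart_dom phi (chart_inv phi u * iota x)%g & differentiable right_mul (u, x)].
Proof.
move=> Ap0.
have [r1 r10 r1P] := near_chart_img0 G.
have /nbhs_nrmP[r3 r30 r3P] := near_chart_img (chart_at_dom p0).
pose mul (p : G * G) : G := (p.1 * p.2)%g.
pose pt : G * G := (p0, 1%g).
have [cm _] := mulg_holomorphic_at pt.
have h : nbhs pt [set p | (A `&` chart_dom phi) (mul p)].
  have h' : nbhs (mul pt) (A `&` chart_dom phi).
    by rewrite /mul /= mulg1; apply: filterI => //; exact: near_chart_dom (chart_at_dom _).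
  exact: cm h'.
have /nbhs_nrmP[r2 r20 r2P] := near_chart_inv (chart_at_dom pt) h.
exists (Num.min (Num.min r1 r2) r3); first by rewrite !lt_min r10 r20.
move=> u x; rewrite !lt_min => /andP[/andP[u1 u2] u3] /andP[/andP[x1 x2] x3].
have ui : chart_img phi u by exact: r3P.
have xi := r1P x x1.
have [dA dd] : (A `&` chart_dom phi) (chart_inv phi u * iota x)%g.
  have r2P' : forall w : V * V, nrm (w - (u0, o)) < r2 ->
    (A `&` chart_dom phi) (mul (chart_inv phi w.1, chart_inv psi w.2)) := r2P.
  apply: (r2P' (u, x + o)).
  have -> : (u, x + o) - (u0, o) = (u - u0, x) :> V * V.
    by rewrite -[LHS]/(u - u0, x + o - o) addrK.
  exact: nrm_prod_lt.
split; [exact: ui|exact: xi|exact: dA|exact: dd|].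
pose z : G * G := (chart_inv phi u, iota x).
have dz : chart_dom (chart_at pt) z by split; exact: chart_inv_dom.
have [de _] := expr_in_differentiable (mulg_holomorphic_at z) dz dd.
have ze : chart_at pt z = (u, x) + (0, o).
  have -> : (u, x) + (0, o) = (u, x + o) :> V * V.
    by rewrite -[LHS]/(u + 0, x + o) addr0.
  by rewrite /z /= /iota !chart_invK.
rewrite ze in de.
have e : right_mul = (fun p : V * V => expr_in pt p0 mul (p + (0, o))).
  apply/funext => -[a b]; rewrite /right_mul /expr_in /=.
  by rewrite addr0.
rewrite e; exact: (@shift_differentiable _ (V * V)%type _ _ (u, x) (0, o)).
Qed.

Lemma right_mul0 (u : V) : chart_img phi u -> right_mul (u, 0) = u.
Proof. by move=> ui; rewrite /right_mul /= chart_exp0 mulg1 chart_invK. Qed.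

(** Since [right_mul (u, 0) = u], the strict derivative at [(u0, 0)], applied to the
    points [(u, x)] and [(u, 0)], leaves the partial derivative [L] in the second
    variable, uniformly in the base point. *)
Lemma right_mul_strict : exists (L : {linear V -> V}) (K CL r : R),
  [/\ 0 <= K, 0 <= CL, 0 < r &
    [/\ forall x, nrm (L x) <= CL * nrm x,
      forall w, exists x, L x = w &
      forall u x : V, nrm (u - u0) < r -> nrm x < r ->
        nrm (right_mul (u, x) - u - L x) <= K * (nrm (u - u0) + nrm x) * nrm x]].
Proof.
have [r1 r10 r1P] := right_mul_near (@filterT _ (nbhs p0) _).
have df : \forall p \near (u0, 0) : V * V, differentiable right_mul p.
  apply/nbhs_nrmP; exists r1; first exact: r10.
  move=> p pr; rewrite [p]surjective_pairing.
  have h1 : nrm (p.1 - u0) < r1 by exact: le_lt_trans (nrm_fst (p - (u0, 0))) pr.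
  have h2 : nrm (p.2) < r1.
    by rewrite -[p.2]subr0; exact: le_lt_trans (nrm_snd (p - (u0, 0))) pr.
  by have [_ _ _ _ h] := r1P _ _ h1 h2; exact: h.
have df0 := nbhs_singleton df.
pose D := 'd right_mul (u0, 0 : V).
pose incl (x : V) : V * V := (u0, x).
have inclD (a v : V) : differentiable incl a /\ 'd incl a v = (0, v) := diff_slice u0 a v.
pose f (x : V) := right_mul (u0, x).
have [di _] := inclD 0 0.
have [dF eF] := chain2 (erefl (u0, 0 : V)) di df0.
have {eF}eF x : 'd f 0 x = D (0, x).
  by apply: (etrans (eF x)); rewrite (proj2 (inclD 0 x)).
pose L : {linear V -> V} := 'd f 0.
pose M := lin1_mx L.
exists L.
have LM x : L x = x *m M by rewrite mul_rV_lin1.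
have [K [r2 [K0 r20 KP]]] := strict_rV df.
exists (2 * K), (\sum_k \sum_i nrm (M k i : R[i]^o)), (Num.min r1 r2); split.
- by rewrite mulr_ge0.
- by apply: sumr_ge0 => k _; apply: sumr_ge0 => i _; exact: nrm_ge0.
- by rewrite lt_min r10.
split.
- by move=> x; rewrite LM nrm_mulmx.
- move=> w.
  (* a right inverse of [f] near [u0]: left translation by [p0^-1] *)
  pose T (v : V) : V := psi (p0^-1 * chart_inv phi v)%g - o.
  have hT : differentiable T u0.
    apply: differentiableB; last exact: differentiable_cst.
    have pT : chart_dom psi (p0^-1 * p0)%g by rewrite mulVg; exact: chart_at_dom.
    exact: (proj1 (expr_in_differentiable (holomorphic_left p0^-1%g p0) (chart_at_dom p0) pT)).
  have T0 : T u0 = 0.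
    by rewrite /T chart_mapK ?mulVg ?subrr //; exact: chart_at_dom.
  have TK : \forall v \near u0, (f \o T) v = idfun v.
    have cT : nbhs (p0^-1 * p0)%g (chart_dom psi).
      by rewrite mulVg; exact: near_chart_dom (chart_at_dom _).
    have h1 := near_chart_inv (chart_at_dom p0) ((proj1 (holomorphic_left p0^-1%g p0)) _ cT).
    have h2 := near_chart_img (chart_at_dom p0).
    apply: filterS2 h1 h2 => v v1 v2; rewrite /f /right_mul /T /= /chart_exp subrK.
    rewrite (chart_mapK v1) chart_mapK ?mulVKg ?mulKVg; last exact: chart_at_dom.
    exact: chart_invK.
  have [dfT eT] := chain2 T0 hT dF.
  have [_ e2] := @near_eq_diff _ _ _ _ (@idfun V) _ TK dfT.
  exists ('d T u0 w).
  apply: (etrans (esym (eT w))).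
  exact: (etrans (esym (congr1 (fun L : V -> V => L w) e2)) (congr1 (fun L => L w) (diff_id_eq u0))).
move=> u x; rewrite !lt_min => /andP[u1 u2] /andP[x1 x2].
have s (v : V) : (u, v) - (u0, 0) = (u - u0, v) :> V * V.
  by rewrite -[LHS]/(u - u0, v - 0) subr0.
have z2 : nrm (0 : V) < r2 by rewrite nrm0.
have := KP (u, x) (u, 0); rewrite !s => h.
have {}h := h (nrm_prod_lt (p := (u - u0, x)) u2 x2) (nrm_prod_lt (p := (u - u0, 0)) u2 z2).
have e : (u, x) - (u, 0) = (0, x) :> V * V.
  by rewrite -[LHS]/(u - u, x - 0) subrr subr0.
have [ui _ _ _ _] := r1P u x u1 x1.
rewrite e right_mul0 // in h.
rewrite [L x]eF; apply: le_trans h _.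
have n1 := nrm_prod_le (u - u0, x); have n2 := nrm_prod_le (u - u0, 0 : V).
have n3 := nrm_prod_le (0 : V, x).
rewrite /= nrm0 ?addr0 ?add0r in n1 n2 n3.
have x0 := nrm_ge0 x; have uu := nrm_ge0 (u - u0).
apply: ler_pM => //; rewrite ?nrm_ge0 //.
  by rewrite mulr_ge0 // addr_ge0 // nrm_ge0.
by rewrite [2 * K]mulrC -mulrA ler_wpM2l //; move: n1 n2 uu x0; clear - p0; lra.
Qed.

End AtPoint.

End MovingChart.

(** * Ascoli's theorem in the compact-open topology *)

Section Ascoli.
Context {R : realType} {T Y : topologicalType} (d : Y -> Y -> R).
Hypothesis dd : is_distance d.
Hypothesis cY : compact [set: Y].

Let dsym := dist_sym dd.
Let dtri := dist_trans dd.

Lemma compact_open_near (f : {compact-open, T -> Y}) (K : set T) (O : set Y) :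
  compact K -> open O -> f @` K `<=` O -> nbhs f [set g : {compact-open, T -> Y} | g @` K `<=` O].
Proof.
move=> cK oO fO; apply: open_nbhs_nbhs; split; last exact: fO.
exact: compact_open_open.
Qed.

Lemma compact_open_near_point (f : {compact-open, T -> Y}) (x : T) (e : R) : 0 < e ->
  nbhs f [set g : {compact-open, T -> Y} | d (f x) (g x) < e].
Proof.
move=> e0.
have h : nbhs (f x) [set y | d (f x) y < e] by apply/(dist_nbhs dd); exists e.
have sub : f @` [set x] `<=` interior [set y | d (f x) y < e].
  by move=> _ [_ -> <-]; exact: h.
have := compact_open_near (@compact_set1 _ x) (@open_interior _ _) sub.
apply: filterS => g gx; apply: (@interior_subset _ [set y | d (f x) y < e]).
by apply: gx; exists x.
Qed.

(** The pointwise limit of an ultrafilter on an equicontinuous set is its limit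
    in the compact-open topology. *)
Lemma ascoli (g_ : nat -> T -> Y) :
  (forall x (e : R), 0 < e -> \forall y \near x, forall k, d (g_ k x) (g_ k y) < e) ->
  relatively_compact (range g_).
Proof.
move=> equi; rewrite /relatively_compact.
set A : set {compact-open, T -> Y} := range g_.
have equiA x (e : R) : 0 < e -> \forall y \near x, forall f, closure A f -> d (f x) (f y) < e.
  move=> e0; have e3 : 0 < e / 3 by rewrite divr_gt0.
  apply: filterS (equi x _ e3) => y xy f Af.
  have [g [[k _ gk] [fx fy]]] := Af _ (filterI (compact_open_near_point f x e3) (compact_open_near_point f y e3)).
  have := xy k; rewrite gk => xyk.
  rewrite (le_lt_trans (dtri (g x) _ _)) //.
  have := dtri (g y) (g x) (f y); rewrite (dsym (g y)).
  move: fx fy => /=; lra.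
rewrite compact_ultra => U UU UA.
have PU : ProperFilter U by exact: ultra_proper.
have UcA : U (closure A) by apply: filterS UA => f [].
have [h hP] := choice (fun x => ultra_limit (fun f : {compact-open, T -> Y} => f x) UU cY).
have hU x (e : R) : 0 < e -> U [set f | d (h x) (f x) < e].
  by move=> e0; exact: (proj1 (dist_cvg dd _ (fun f : {compact-open, T -> Y} => f x) (h x)) (hP x) e e0).
have hequi x (e : R) : 0 < e -> \forall y \near x, d (h x) (h y) < e.
  move=> e0; have e3 : 0 < e / 3 by rewrite divr_gt0.
  apply: filterS (equiA x _ e3) => y xy.
  have [f [[f1 f2] f3]] := filter_ex (filterI (filterI (hU x _ e3) (hU y _ e3)) UcA).
  have xyf := xy f f3.
  rewrite (le_lt_trans (dtri (f x) _ _)) //.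
  have := dtri (f y) (f x) (h y); rewrite (dsym (f y)).
  move: f1 f2 => /=; lra.
have cvgU : U --> (h : {compact-open, T -> Y}).
  apply/compact_open_cvgP => K O cK oO hKO.
  have H : \forall f \near U, K `<=` (fun x => closure A f -> O (f x)).
    apply: (proj1 (compact_near_coveringP _) cK) => x Kx.
    have Ohx : nbhs (h x) O by apply: open_nbhs_nbhs; split=> //; apply: hKO; exists x.
    have [e e0 eO] := proj1 (dist_nbhs dd _ _) Ohx.
    have e2 : 0 < e / 2 by rewrite divr_gt0.
    exists ([set y | forall f, closure A f -> d (f x) (f y) < e / 2], [set f | d (h x) (f x) < e / 2]).
      by split; [exact: equiA|exact: hU].
    move=> [y f] /= [yP fP] Af; apply: eO.
    rewrite (le_lt_trans (dtri (f x) _ _)) //; have := yP f Af; lra.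
  apply: filterS2 H UcA => f fK Af _ [x Kx <-].
  exact: fK.
exists h; split; last exact: cvgU.
split.
  rewrite closureE => B [cB AB].
  apply: contrapT => nB.
  have oB : nbhs (h : {compact-open, T -> Y}) (~` B).
    by apply: open_nbhs_nbhs; split; [exact: closed_openC|].
  have [f [f1 f2]] := filter_ex (filterI (cvgU _ oB) UcA).
  by apply: f1; move: f2; rewrite closureE; apply.
move=> x; apply/(dist_cvg dd) => e e0; exact: hequi.
Qed.

End Ascoli.

(** * Limits of maps along points that concentrate *)

Section SetTypeCompact.
Context {M : topologicalType} (Omega : set M).

Lemma set_type_nbhs (x : Omega) (A : set Omega) : nbhs x A ->
  exists2 C : set M, open_nbhs (set_val x) C & set_val @^-1` C `<=` A.
Proof.
rewrite nbhsE => -[B [oB Bx] BA]; case: oB Bx BA => C oC <- Cx CA.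
by exists C.
Qed.

Lemma set_val_nbhs (x : Omega) (C : set M) : nbhs (set_val x) C -> nbhs x (set_val @^-1` C).
Proof. by move=> h; apply: (@initial_continuous _ _ (set_val : Omega -> M) x). Qed.

Lemma set_type_compact (K : set M) : compact K -> K `<=` Omega ->
  compact (set_val @^-1` K : set Omega).
Proof.
move=> cK KO F PF FK.
have [p [Kp cp]] := cK (set_val @ F) _ FK.
pose x : Omega := exist _ p (mem_set (KO p Kp)).
exists x; split; first exact: Kp.
move=> B A FB /set_type_nbhs[C [oC Cx] CA].
have FsB : (set_val @ F) (set_val @` B) by apply: (@filterS _ F _ B) FB => y By; exists y.
have [_ [[z Bz <-] Cz]] := cp _ _ FsB (open_nbhs_nbhs (conj oC Cx)).
by exists z; split=> //; exact: CA.
Qed.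

End SetTypeCompact.

Section LocalCompactness.
Context {R : realType} {m : nat} {M : chartedType 'rV[R[i]]_m}.

Lemma charted_locally_compact (p : M) (A : set M) : nbhs p A ->
  exists K : set M, [/\ compact K, nbhs p K & K `<=` A].
Proof.
move=> Ap; have dp := chart_at_dom p.
have /nbhs_nrmP[r r0 rP] : \forall u \near chart_at p p,
    chart_img (chart_at p) u /\ A (chart_inv (chart_at p) u).
  exact: (filterI (near_chart_img dp) (near_chart_inv dp Ap)).
have r2 : 0 < r / 2 by rewrite divr_gt0.
pose B : set 'rV[R[i]]_m := [set v | nrm (v - chart_at p p) <= r / 2].
have Br v : B v -> nrm (v - chart_at p p) < r by rewrite /B /= => v2; lra.
exists (chart_inv (chart_at p) @` B); split.
- apply: continuous_compact; last exact: ball_rV_compact.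
  apply: continuous_in_subspaceT => v /set_mem /Br vr.
  exact: chart_inv_continuous (proj1 (rP v vr)).
- have h1 := near_chart_dom dp.
  have h2 : \forall y \near p, nrm (chart_at p y - chart_at p p) < r / 2.
    exact: (proj1 (cvg_nrmP _ _ _) (chart_map_continuous dp) _ r2).
  apply: filterS2 h1 h2 => y dy yr; exists (chart_at p y); last exact: chart_mapK.
  exact: ltW.
- by move=> _ [v /Br vr <-]; exact: (proj2 (rP v vr)).
Qed.

End LocalCompactness.

Section ConcentratedLimit.
Context {R : realType} {m : nat} {M : chartedType 'rV[R[i]]_m} {Y : topologicalType}.
Variable d : Y -> Y -> R.
Hypothesis dd : is_distance d.

(** A cluster point of the sequence is continuous at [p0], while the points
    [q_ j z] concentrate at [p0]. *)
Lemma concentrated_limit_constant (Z : Type) (Omega : set M) (g_ : nat -> M -> Y)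
    (q_ : nat -> Z -> M) (p0 : M) (phi : Z -> Y) (s : nat -> nat) :
  open Omega -> Omega p0 ->
  (forall j x, Omega x -> {for x, continuous (g_ j)}) ->
  (forall z, q_ ^~ z @ \oo --> p0) ->
  (forall z (e : R), 0 < e -> \forall j \near \oo, d (g_ j (q_ j z)) (phi z) < e) ->
  {homo s : i j / (i < j)%N >-> (i < j)%N} ->
  relatively_compact (range (fun k => g_ (s k) \o set_val : Omega -> Y)) ->
  exists y, forall z, phi z = y.
Proof.
move=> oO Op0 cg qp gphi smono rc.
have sge k : (k <= s k)%N by elim: k => // k IH; rewrite (leq_ltn_trans IH) // smono.
pose F : set_system {compact-open, Omega -> Y} := (fun k => g_ (s k) \o set_val : Omega -> Y) @ \oo.
have PF : ProperFilter F by exact: fmap_proper_filter.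
pose x0 : Omega := exist _ p0 (mem_set Op0).
have [|h [[_ ch] clh]] := rc F PF.
  exists 0%N => // k _; split; first by apply: subset_closure; exists k.
  move=> x; apply: continuous_comp.
    exact: (@initial_continuous _ _ (set_val : Omega -> M) x).
  by apply: cg; exact: set_mem (valP x).
have [d0 _ _ _] := dd.
exists (h x0) => z; apply/esym/d0.
apply: le_anti; rewrite (dist_ge0 dd) andbT.
apply/ler_addgt0Pr => e e0; rewrite add0r.
have e2 : 0 < e / 2 by rewrite divr_gt0.
have e4 : 0 < e / 4 by rewrite divr_gt0.
have he : nbhs x0 [set y | d (h x0) (h y) < e / 4].
  exact: (proj1 (dist_cvg dd _ _ _) (ch x0) _ e4).
have [C oC CA] := set_type_nbhs he.
have OC : nbhs p0 (C `&` Omega).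
  by apply: filterI; [exact: open_nbhs_nbhs oC|apply: open_nbhs_nbhs].
have [K [cK Kp KC]] := charted_locally_compact OC.
have cK' := @set_type_compact _ Omega K cK (fun y Ky => proj2 (KC y Ky)).
pose W : set Y := interior [set y | d (h x0) y < e / 2].
have hW : h @` (set_val @^-1` K) `<=` W.
  move=> _ [y Ky <-]; apply/(dist_nbhs dd); exists (e / 4) => // b hb.
  rewrite /= (le_lt_trans (dist_trans dd (h y) _ _)) //.
  have := CA y (proj1 (KC _ Ky)) => /=; lra.
have nW := compact_open_near cK' (@open_interior _ _) hW.
have qK : \forall j \near \oo, K (q_ j z) := qp z _ Kp.
have [k0 _ k0P] := filterI qK (gphi z _ e2).
have FI : F ((fun k => g_ (s k) \o set_val : Omega -> Y) @` [set k | (k0 <= k)%N]).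
  by exists k0 => // k /= kk; exists k.
have [_ [[k /= kk <-] gW]] := clh _ _ FI nW.
have [Kq gq] := k0P (s k) (leq_trans kk (sge k)).
pose y : Omega := exist _ (q_ (s k) z) (mem_set (proj2 (KC _ Kq))).
have Wy : W (g_ (s k) (q_ (s k) z)) by apply: gW; exists y.
have := interior_subset Wy => /= h1.
have := dist_trans dd (g_ (s k) (q_ (s k) z)) (h x0) (phi z).
by move: gq => /=; lra.
Qed.

End ConcentratedLimit.

(** * Rescaled exponential maps in a fixed chart *)

Section ZoomedMaps.
Context {R : realType} {m : nat} (G : complexLieGroupType R m).
Local Notation V := ('rV[R[i]]_m).
Local Notation C := (R[i]^o).
Local Notation psi := (chart_at (1%g : G)).
Local Notation o := (chart_at (1%g : G) (1%g : G)).
Local Notation iota := (@chart_exp R m G).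
Variable ex : V -> G.

Lemma exp_zoom_cvg (p_ : nat -> G) (p0 : G) (rho_ : nat -> R) (xi : V) :
  holomorphic_at (fun s : C => ex (s *: xi)) (0 : C) -> ex 0 = 1%g ->
  p_ @ \oo --> p0 -> rho_ @ \oo --> (0 : R) ->
  (fun j => p_ j * ex ((rho_ j)%:C%C *: xi))%g @ \oo --> p0.
Proof.
move=> [cex _] ex0 pp0 rho0.
have cs : (fun j => (rho_ j)%:C%C : C) @ \oo --> (0 : C).
  apply/cvg_nrmP => e e0; have /cvgrPdist_lt/(_ e e0) h := rho0.
  by apply: filterS h => j; rewrite subr0 nrmC sub0r normrN.
have ce : (fun j => ex ((rho_ j)%:C%C *: xi)) @ \oo --> (1%g : G).
  have := cvg_comp _ _ cs cex; rewrite scale0r ex0; exact.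
have [cm _] := mulg_holomorphic_at (p0, 1%g : G).
have := cvg_comp _ _ (cvg_pair pp0 ce) cm; rewrite /= mulg1; exact.
Qed.

(** Only a fixed chart makes the rescaled exponential maps at moving base points
    comparable with the dilations [u_ j + r_ j w] of Zalcman's lemma.  Their
    deviation from [L] has two sources, the strict derivative of [right_mul] and
    the quadratic error of [Ex]; both are [o(r_ j)]. *)
Lemma exp_zoom_chart (p0 : G) (A : set G) (Ex : V -> V) (rho c : R) :
  nbhs p0 A -> 0 < rho -> 0 <= c ->
  (forall xi : V, nrm xi <= rho ->
     [/\ ex xi = iota (Ex xi), chart_img psi (Ex xi + o) & nrm (Ex xi - xi) <= c * nrm xi ^+ 2]) ->
  exists (L : {linear V -> V}) (CL : R),
  [/\ 0 <= CL, forall x, nrm (L x) <= CL * nrm x, forall w, exists x, L x = w &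
   forall (u_ : nat -> V) (r_ : nat -> R),
    (forall j, 0 < r_ j) -> (forall e, 0 < e -> \forall j \near \oo, r_ j < e) ->
    (forall e, 0 < e -> \forall j \near \oo, nrm (u_ j - chart_at p0 p0) < e) ->
    forall B e : R, 0 <= B -> 0 < e -> \forall j \near \oo, forall xi, nrm xi <= B ->
    let y := (chart_inv (chart_at p0) (u_ j) * ex ((r_ j)%:C%C *: xi))%g in
    [/\ A y, chart_dom (chart_at p0) y &
      nrm (chart_at p0 y - u_ j - (r_ j)%:C%C *: L xi) <= e * r_ j]].
Proof.
move=> Ap0 rho0 c0 exP.
have [L [K [CL [r1 [K0 CL0 r10 [Lb Ls Lq]]]]]] := right_mul_strict p0.
have [r2 r20 r2P] := right_mul_near Ap0.
exists L, CL; split; [exact: CL0|exact: Lb|exact: Ls|].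
move=> u_ r_ r0 rsmall usmall B e B0 e0.
(* [S] collects the constants of all the requirements: each of them follows from
   [r_ j * S] and [nrm (u_ j - u0) * S] being below [q] *)
pose S := 2 * K * B * (1 + 2 * B) + CL * c * B ^+ 2 + c * B + 2 * B + 1.
have B2 : 0 <= B ^+ 2 by exact: exprn_ge0.
have KB : 0 <= 2 * K * B * (1 + 2 * B) by rewrite !mulr_ge0 ?addr_ge0 ?mulr_ge0.
have cB : 0 <= c * B by exact: mulr_ge0.
have CcB : 0 <= CL * c * B ^+ 2 by rewrite !mulr_ge0.
have [S1 SB ScB Smain] : [/\ 1 <= S, 2 * B <= S, c * B <= S &
    2 * K * B * (1 + 2 * B) + CL * c * B ^+ 2 <= S].
  rewrite /S; move: KB cB CcB B0.
  move: (2 * K * B * (1 + 2 * B)) (c * B) (CL * c * B ^+ 2); clear - ex; move=> a1 a2 a3 *.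
  by split; lra.
have S0 : 0 < S by exact: lt_le_trans S1.
move: (S) S1 SB ScB Smain S0 => {}S S1 SB ScB Smain S0.
pose q := Num.min (Num.min e 1) (Num.min rho (Num.min r1 r2)).
have q0 : 0 < q by rewrite !lt_min e0 ltr01 rho0 r10 r20.
have de0 : 0 < q / S by rewrite divr_gt0.
near=> j.
have rj : r_ j < q / S by near: j; exact: rsmall.
have uj : nrm (u_ j - chart_at p0 p0) < q / S by near: j; exact: usmall.
have rj0 := r0 j.
move: rj uj; rewrite !ltr_pdivlMr //.
set t := r_ j; set s := nrm (u_ j - chart_at p0 p0) => tS sS.
have s0 : 0 <= s by exact: nrm_ge0.
have t0 : 0 < t by exact: rj0.
have [[qe q1] [qrho [qr1 qr2]]] : (q <= e /\ q <= 1) /\ (q <= rho /\ (q <= r1 /\ q <= r2)).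
  by rewrite /q !ge_min !lexx !orbT.
have s1 : s < q by rewrite (le_lt_trans _ sS) // ler_peMr.
have tB : t * (2 * B) < q by apply: le_lt_trans tS; rewrite ler_pM2l.
have tc : t * (c * B) <= 1.
  by apply: le_trans q1; apply: le_trans (ltW tS); rewrite ler_pM2l.
move=> xi xiB.
have xi0 := nrm_ge0 xi.
have nx : nrm (t%:C%C *: xi) = t * nrm xi by rewrite nrmZ nrmC gtr0_norm.
have nxB : nrm (t%:C%C *: xi) <= t * B by rewrite nx ler_pM2l.
have nxr : nrm (t%:C%C *: xi) <= rho.
  have : t * B <= t * (2 * B) by rewrite ler_pM2l //; move: B0; clear - ex; lra.
  by move=> h; rewrite (le_trans nxB) // (le_trans h) // (le_trans (ltW tB)).
have [eE eI eQ] := exP _ nxr.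
set x := Ex (t%:C%C *: xi) in eE eI eQ *.
have tB0 : 0 <= t * B by rewrite mulr_ge0 // ltW.
have eQ' : nrm (x - t%:C%C *: xi) <= c * (t * B) ^+ 2.
  rewrite (le_trans eQ) // ler_wpM2l // ler_sqr ?nnegrE //; exact: nrm_ge0.
have nxx : nrm x <= t * (2 * B).
  have h : c * (t * B) ^+ 2 <= t * B.
    have -> : c * (t * B) ^+ 2 = t * (c * B) * (t * B) by ring.
    by rewrite -[leRHS]mul1r ler_wpM2r.
  have := nrmD (x - t%:C%C *: xi) (t%:C%C *: xi); rewrite subrK => h2.
  apply: le_trans h2 _; rewrite [2 * B]mulrC mulrA; move: eQ' h nxB; clear - ex; lra.
have [_ _ Ay dy _] := r2P (u_ j) x (lt_le_trans s1 qr2) (le_lt_trans nxx (lt_le_trans tB qr2)).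
have Q := Lq (u_ j) x (lt_le_trans s1 qr1) (le_lt_trans nxx (lt_le_trans tB qr1)).
rewrite eE; split; [exact: Ay|exact: dy|].
have LZ : t%:C%C *: L xi = L (t%:C%C *: xi) by rewrite linearZ.
have h1 : nrm (L x - t%:C%C *: L xi) <= CL * (c * (t * B) ^+ 2).
  rewrite LZ -linearB (le_trans (Lb _)) //; exact: ler_wpM2l.
have h2 : K * (s + nrm x) * nrm x <= K * (s + t * (2 * B)) * (t * (2 * B)).
  apply: ler_pM; rewrite ?nrm_ge0 ?mulr_ge0 ?addr_ge0 ?nrm_ge0 //.
  by rewrite ler_wpM2l // lerD2l.
have h3 := nrm_dist_trans (L x) (chart_at p0 (chart_inv (chart_at p0) (u_ j) * iota x)%g - u_ j)
  (t%:C%C *: L xi).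
rewrite (le_trans h3) // (le_trans (lerD (le_trans Q h2) h1)) //.
have -> : K * (s + t * (2 * B)) * (t * (2 * B)) + CL * (c * (t * B) ^+ 2) =
  t * (2 * K * B * (s + 2 * B * t) + CL * c * B ^+ 2 * t) by ring.
rewrite [e * t]mulrC ler_pM2l // (le_trans _ qe) //.
pose w := Num.max s t.
have sw : s <= w by rewrite le_max lexx.
have tw : t <= w by rewrite le_max lexx orbT.
have wS : w * S < q by rewrite /w /Num.max; case: ifP.
have w0 : 0 <= w by exact: le_trans s0 sw.
have a1 : 2 * B * t <= 2 * B * w by rewrite ler_wpM2l // mulr_ge0.
have a2 : 2 * K * B * (s + 2 * B * t) <= 2 * K * B * (w * (1 + 2 * B)).
  by rewrite ler_wpM2l ?mulr_ge0 //; move: a1 sw; clear - ex; lra.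
have a3 : CL * c * B ^+ 2 * t <= CL * c * B ^+ 2 * w by rewrite ler_wpM2l.
have a4 : w * (2 * K * B * (1 + 2 * B) + CL * c * B ^+ 2) <= w * S.
  exact: ler_wpM2l.
rewrite (le_trans (lerD a2 a3)) // (le_trans _ (ltW wS)) // (le_trans _ a4) //.
by rewrite le_eqVlt; apply/orP; left; apply/eqP; ring.
Unshelve. all: by end_near. Qed.

End ZoomedMaps.

(** * Normality and equicontinuity *)

Section ChartReading.
Context {R : realType} {m n : nat} {M : complexManifoldType R m} {N : complexManifoldType R n}.
Local Notation V := ('rV[R[i]]_m).

Lemma hol_into_chart (f : M -> N) (p : M) (u : V) : chart_img (chart_at p) u ->
  holomorphic_at f (chart_inv (chart_at p) u) -> hol_into (f \o chart_inv (chart_at p)) u.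
Proof.
move=> pu hf; have [cf _] := hf; split.
  by apply: continuous_comp cf; exact: chart_inv_continuous.
move=> y fy; have du := chart_inv_dom pu.
have [h _] := expr_in_differentiable hf du fy.
by rewrite (chart_invK pu) in h; exact: h.
Qed.

Lemma hol_into_holomorphic_at (f : V -> N) (z : V) : hol_into f z -> holomorphic_at f z.
Proof.
move=> [cf df]; split; first exact: cf.
exact: (df (f z) (chart_at_dom _)).
Qed.

Variable d : N -> N -> R.
Hypothesis dd : is_distance d.

(** Ascoli's theorem makes a sequence that is equicontinuous at every point
    relatively compact.  The failure of equicontinuity is read in a chart, where
    Zalcman's lemma takes place. *)
Lemma not_normal_not_equicontinuous (Omega : set M) (F : set (M -> N)) :
  compact [set: N] ->
  ~ normal_family [set (f \o set_val : Omega -> N) | f in F] ->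
  exists f_ : nat -> M -> N, (forall k, F (f_ k)) /\ exists2 p0, Omega p0 &
    exists2 e : R, 0 < e & forall tau : R, 0 < tau -> exists k x,
      nrm (x - chart_at p0 p0) < tau /\
      e <= d (f_ k p0) (f_ k (chart_inv (chart_at p0) x)).
Proof.
move=> cN nn; apply: contrapT => no; apply: nn => g_ gF.
have gF' k : exists f : M -> N, F f /\ (f \o set_val : Omega -> N) = g_ k.
  by have [f Ff fg] := gF k; exists f.
have [f_ fP] := choice gF'.
exists idfun; split; first by [].
left; apply: (ascoli dd cN) => x e e0.
apply: contrapT => nx; apply: no; exists f_; split; first by move=> k; have [] := fP k.
exists (set_val x); first exact: set_mem (valP x).
exists e => // tau tau0; apply: contrapT => no; apply: nx.
have dx := chart_at_dom (set_val x).
have h2 : \forall y \near set_val x, nrm (chart_at (set_val x) y - chart_at (set_val x) (set_val x)) < tau.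
  exact: (proj1 (cvg_nrmP _ _ _) (chart_map_continuous dx) _ tau0).
have h : nbhs x (set_val @^-1` (chart_dom (chart_at (set_val x)) `&`
    (fun y => nrm (chart_at (set_val x) y - chart_at (set_val x) (set_val x)) < tau))).
  apply: set_val_nbhs; exact: (filterI (near_chart_dom dx) h2).
apply: (@filterS _ (nbhs x) _ _ _ _ h) => y [/= dy yt] k.
have [_ <-] := fP k; rewrite ltNge; apply/negP => ge; apply: no.
exists k, (chart_at (set_val x) (set_val y)); split; first exact: yt.
by rewrite chart_mapK.
Qed.

End ChartReading.

Section BasisCoordinates.
Context {R : realType} {m : nat}.
Local Notation V := ('rV[R[i]]_m).

Definition combination (eps : m.-tuple V) (z : V) : V := \sum_(k < m) z 0 k *: tnth eps k.

Lemma combination_mulmx (eps : m.-tuple V) z :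
  combination eps z = z *m (\matrix_k tnth eps k).
Proof. by rewrite mulmx_sum_row; apply: eq_bigr => k _; rewrite rowK. Qed.

Lemma combination_surjective (eps : m.-tuple V) : basis_of fullv eps ->
  forall w, exists z, combination eps z = w.
Proof.
move=> be w; exists (\row_k coord eps k w).
rewrite [RHS](coord_basis be (memvf w)); apply: eq_bigr => k _.
by rewrite mxE (tnth_nth 0).
Qed.

Lemma compact_rV_bounded (K : set V) : compact K ->
  exists2 B : R, 0 <= B & forall z, K z -> nrm z <= B.
Proof.
move=> cK; have [] := proj1 (compact_near_coveringP _) cK nat \oo (fun k z => nrm z <= k%:R) _ _.
  move=> x _; have [k _ kP] := @nbhs_infty_ger R (nrm x + 1).
  have h1 : \forall x' \near x, nrm (x' - x) < 1 by apply/nbhs_nrmP; exists 1.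
  exists ([set x' | nrm (x' - x) < 1], [set j | (k <= j)%N]).
    by split=> //; exists k.
  move=> [x' j] /= [xx kj]; have := kP j kj; have := nrmD (x' - x) x; rewrite subrK /=; lra.
by move=> k _ /(_ k (leqnn k)) kP; exists k%:R.
Qed.

End BasisCoordinates.

(** * Normality and zoomed limits *)

Section ZoomedLimits.
Context {R : realType} {m n : nat} {G : complexLieGroupType R m} {N : hermitianManifoldType R n}.
Local Notation V := ('rV[R[i]]_m).
Local Notation C := (R[i]^o).
Variables (Omega : set G) (eps : m.-tuple (tangent (1%g : G))) (d : N -> N -> R) (F : set (G -> N)).
Hypothesis oO : open Omega.
Hypothesis dd : is_distance d.
Hypothesis cN : compact [set: N].
Hypothesis hF : forall f, F f -> holomorphic_on Omega f.

Lemma zoom_exp : exists ex : V -> G,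
  [/\ forall p r z, zoom eps p r z = (p * ex (r%:C%C *: combination (eps : m.-tuple V) z))%g,
    ex 0 = 1%g, forall xi : V, holomorphic_at (fun s : C => ex (s *: xi)) (0 : C) &
    exists (Ex : V -> V) (rho c : R), [/\ 0 < rho, 0 <= c & forall xi : V, nrm xi <= rho ->
      [/\ ex xi = @chart_exp R m G (Ex xi),
        chart_img (chart_at (1%g : G)) (Ex xi + chart_at (1%g : G) (1%g : G)) &
        nrm (Ex xi - xi) <= c * nrm xi ^+ 2]]].
Proof.
have [ex [loc ex_add ex_hol ex_vel ex0]] := global_exponential G.
exists ex; split; [|exact: ex0|by move=> xi; exact: ex_hol|exact: loc].
by move=> p r z; exact: (zoomE ex_add ex_hol ex_vel ex0).
Qed.

(** A point of [Omega] and the compact manifold [N] itself exclude compact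
    divergence. *)
Lemma normal_zoom_limit_constant (f_ : nat -> G -> N) (p_ : nat -> G) (p0 : G)
    (rho_ : nat -> R) (phi : V -> N) :
  normal_family [set (f \o set_val : Omega -> N) | f in F] ->
  (forall j, F (f_ j)) -> Omega p0 -> p_ @ \oo --> p0 -> rho_ @ \oo --> (0 : R) ->
  cvg_on_compacts d (fun j => [set z | Omega (zoom eps (p_ j) (rho_ j) z)])
    (fun j z => f_ j (zoom eps (p_ j) (rho_ j) z)) phi ->
  exists y, forall z, phi z = y.
Proof.
move=> nF Ff Op0 pp0 rr0 cphi.
have [ex [zE ex0 exh _]] := zoom_exp.
have [s [smono [rc|div]]] := nF (fun j => f_ j \o set_val) (fun j => ex_intro2 _ _ (f_ j) (Ff j) erefl).
  apply: (@concentrated_limit_constant _ _ _ _ d dd V Omega f_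
    (fun j z => zoom eps (p_ j) (rho_ j) z) p0 phi s) => //.
  - by move=> j x Ox; exact: (proj1 (hF (Ff j) Ox)).
  - move=> z; have := exp_zoom_cvg (exh (combination (eps : m.-tuple V) z)) ex0 pp0 rr0.
    have -> : (fun j => zoom eps (p_ j) (rho_ j) z) =
        (fun j => p_ j * ex ((rho_ j)%:C%C *: combination (eps : m.-tuple V) z))%g.
      by apply/funext => j; exact: zE.
    exact.
  - move=> z e e0; have [_ h] := cphi [set z] (@compact_set1 _ z).
    by apply: filterS (h e e0) => j; exact.
pose x0 : Omega := exist _ p0 (mem_set Op0).
have [k _ /(_ k (leqnn k)) kP] := div [set x0] [set: N] (@compact_set1 _ x0) cN.
have : set0 (f_ (s k) p0) by rewrite -kP; split=> //; exists x0.
by [].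
Qed.

(** The point of [G] reached by the zoom at [z] has coordinate [u_ j + r_ j w] with
    [w] close to [L (zeta z)], so the zoomed maps have the limit [h \o L \o zeta]
    by the uniform continuity of [h]. *)
Lemma not_normal_zoom : basis_of fullv (eps : m.-tuple V) ->
  ~ normal_family [set (f \o set_val : Omega -> N) | f in F] ->
  exists (f_ : nat -> G -> N) (p_ : nat -> G) (p0 : G) (rho_ : nat -> R)
         (phi : V -> N),
    [/\ forall j, F (f_ j),
        [/\ forall j, Omega (p_ j), p_ @ \oo --> p0 & Omega p0],
        (forall j, 0 < rho_ j) /\ rho_ @ \oo --> (0 : R),
        cvg_on_compacts d
          (fun j => [set z | Omega (zoom eps (p_ j) (rho_ j) z)])
          (fun j z => f_ j (zoom eps (p_ j) (rho_ j) z)) phi &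
        holomorphic phi /\ nonconstant phi].
Proof.
move=> be nn.
have [f_ [Ff [p0 Op0 [e0 e00 osc]]]] := not_normal_not_equicontinuous dd cN nn.
set phi0 := chart_at p0 in osc.
pose u0 := phi0 p0.
have dp0 := chart_at_dom p0.
have On : nbhs p0 Omega by apply: open_nbhs_nbhs.
have /nbhs_nrmP[rho rho0 rhoP] : \forall u \near u0, chart_img phi0 u /\ Omega (chart_inv phi0 u).
  exact: (filterI (near_chart_img dp0) (near_chart_inv dp0 On)).
pose F_ k := f_ k \o chart_inv phi0.
have hF_ k u : nrm (u - u0) < rho -> hol_into (F_ k) u.
  move=> ur; have [ui Ou] := rhoP u ur.
  exact: (hol_into_chart ui (hF (Ff k) Ou)).
have ne : exists2 e : R, 0 < e & forall tau : R, 0 < tau ->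
    exists k x, nrm (x - u0) < tau /\ e <= d (F_ k u0) (F_ k x).
  exists e0; first exact: e00.
  move=> tau tau0; have [k [x [xt ed]]] := osc tau tau0.
  by exists k, x; split; [exact: xt|rewrite /F_ /= /u0 chart_mapK].
have [k_ [u_ [r_ [h [[r0 rs] [ur us] hc hu [hh [w1 hw1]]]]]]] := zalcman dd cN rho0 hF_ ne.
have [ex [zE ex0 _ [Ex [rho1 [c [rho10 c0 exP]]]]]] := zoom_exp.
have [L [CL [CL0 Lb Ls Lz]]] := exp_zoom_chart On rho10 c0 exP.
pose E : 'M[R[i]]_m := \matrix_k tnth (eps : m.-tuple V) k.
pose zeta := combination (eps : m.-tuple V).
have zetaE z : zeta z = z *m E by exact: combination_mulmx.
pose CE := \sum_k \sum_i nrm (E k i : R[i]^o).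
have CE0 : 0 <= CE by apply: sumr_ge0 => k _; apply: sumr_ge0 => i _; exact: nrm_ge0.
have zetab z : nrm (zeta z) <= CE * nrm z by rewrite zetaE; exact: nrm_mulmx.
have p_O j : Omega (chart_inv phi0 (u_ j)) by exact: (proj2 (rhoP _ (ur j))).
exists (fun j => f_ (k_ j)), (fun j => chart_inv phi0 (u_ j)), p0, r_, (fun z => h (L (zeta z))).
split.
- by move=> j; exact: Ff.
- split; [exact: p_O| |exact: Op0].
  have cu : u_ @ \oo --> u0 by apply/cvg_nrmP => e; exact: us.
  have := cvg_comp _ _ cu (chart_inv_at dp0).
  by rewrite (chart_mapK dp0).
- split; first exact: r0.
  apply/cvgrPdist_lt => e ep; apply: filterS (rs e ep) => j rj.
  by rewrite sub0r normrN gtr0_norm.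
- move=> K cK; have [B B0 BP] := compact_rV_bounded cK.
  have BB : 0 <= CE * B by exact: mulr_ge0.
  have zB z : K z -> nrm (zeta z) <= CE * B.
    by move=> Kz; rewrite (le_trans (zetab z)) // ler_wpM2l // BP.
  split.
    apply: filterS (Lz u_ r_ r0 rs us _ 1 BB ltr01) => j jP z Kz.
    by rewrite /= zE; have [h1 _ _] := jP _ (zB z Kz); exact: h1.
  move=> e ep; have e2 : 0 < e / 2 by rewrite divr_gt0.
  have [tau tau0 tauP] := hu _ e2.
  have tm0 : 0 < tau / 2 by rewrite divr_gt0.
  have near1 := Lz u_ r_ r0 rs us _ (tau / 2) BB tm0.
  have near2 := hc (CL * (CE * B) + tau) _ e2.
  apply: filterS2 near1 near2 => j j1 j2 z Kz.
  have [_ dy yq] := j1 _ (zB z Kz); rewrite -zE in dy yq.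
  set y := zoom _ _ _ _ in dy yq *.
  have rj := r0 j.
  pose w := (r_ j)^-1%:C%C *: (phi0 y - u_ j).
  have rr : (r_ j)%:C%C * (r_ j)^-1%:C%C = 1 :> R[i].
    by rewrite -rmorphM mulfV ?gt_eqF // rmorph1.
  have yw : phi0 y = u_ j + (r_ j)%:C%C *: w.
    by rewrite /w scalerA rr scale1r addrC subrK.
  have wL : nrm (w - L (zeta z)) <= tau / 2.
    rewrite yw (addrC (u_ j)) addrK -scalerBr nrmZ nrmC gtr0_norm // mulrC in yq.
    by rewrite ler_pM2r in yq.
  have Fy : f_ (k_ j) y = F_ (k_ j) (u_ j + (r_ j)%:C%C *: w).
    by rewrite -yw /F_ /= chart_mapK.
  have wB : nrm w <= CL * (CE * B) + tau.
    have := nrmD (w - L (zeta z)) (L (zeta z)); rewrite subrK => h1.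
    have h2 := Lb (zeta z).
    have h3 : CL * nrm (zeta z) <= CL * (CE * B) by rewrite ler_wpM2l // zB.
    move: h1 h2 h3 wL tau0; clear - oO dd cN hF eps; lra.
  have := j2 w wB; rewrite -Fy => q1.
  have wL' : nrm (w - L (zeta z)) < tau by apply: le_lt_trans wL _; move: tau0; clear - oO dd cN hF eps; lra.
  have q2 := tauP _ _ wL'.
  rewrite (dist_sym dd) (le_lt_trans (dist_trans dd (h w) _ _)) //.
  move: q1 q2; clear - oO dd cN hF eps; lra.
- split.
    move=> z _; apply: hol_into_holomorphic_at.
    pose A := E *m lin1_mx L.
    have e : (fun z => h (L (zeta z))) = h \o (mulmxr A).
      by apply/funext => v; rewrite /= /A zetaE mulmxA mul_rV_lin1.
    rewrite e; apply: hol_into_comp; last exact: hh.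
    apply: linear_differentiable; exact: mulmxr_continuous.
  have [x1 x1P] := Ls w1.
  have [z1 z1P] := combination_surjective be x1.
  exists z1, 0; rewrite /zeta z1P x1P.
  have -> : combination (eps : m.-tuple V) 0 = 0 by rewrite combination_mulmx mul0mx.
  by rewrite linear0.
Qed.

End ZoomedLimits.

Theorem theorem1p1 (R : realType) (m n : nat)
    (G : complexLieGroupType R m) (Omega : set G)
    (eps : m.-tuple (tangent (1%g : G)))
    (N : hermitianManifoldType R n) (d : N -> N -> R)
    (F : set (G -> N)) :
  is_domain Omega ->
  basis_of fullv eps ->
  compact [set: N] ->
  is_distance d ->
  (forall f, F f -> holomorphic_on Omega f) ->
  ~ normal_family [set (f \o set_val : Omega -> N) | f in F] <->
  exists (f_ : nat -> G -> N) (p_ : nat -> G) (p0 : G) (rho_ : nat -> R)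
         (phi : 'rV[R[i]]_m -> N),
    [/\ forall j, F (f_ j),
        [/\ forall j, Omega (p_ j), p_ @ \oo --> p0 & Omega p0],
        (forall j, 0 < rho_ j) /\ rho_ @ \oo --> (0 : R),
        cvg_on_compacts d
          (fun j => [set z | Omega (zoom eps (p_ j) (rho_ j) z)])
          (fun j z => f_ j (zoom eps (p_ j) (rho_ j) z)) phi &
        holomorphic phi /\ nonconstant phi].
Proof.
move=> [oO _ _] be cN dd hF; split; first exact: (not_normal_zoom oO dd cN hF be).
move=> [f_ [p_ [p0 [rho_ [phi [Ff [_ pp0 Op0] [_ rr0] cphi [_ [x [y xy]]]]]]]]] nF.
have [w wP] := normal_zoom_limit_constant oO dd cN hF nF Ff Op0 pp0 rr0 cphi.
by apply: xy; rewrite !wP.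
Qed.
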